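(* Let $u^\nu$ be a family of weak solutions on $[0,1]$ of the Navier-Stokes equations on $\mathbb{T}^3$ satisfying the energy equality, with viscosity $\nu\to0$ and force $f^\nu\to f$ in $L^1(0,1;L^2)$, converging weakly in $L^2$ to $u\in L^\infty(0,1;L^2)$: $$u^\nu\to u\quad\text{in } C_w([0,1];L^2),$$ converging strongly at $t=0$: $$u^\nu(0)\to u(0)\quad\text{in } L^2,$$ and exhibiting the dissipation anomaly, i.e. $$\limsup_{\nu\to0}\nu\int_0^1\|\nabla u^\nu\|_{L^2}^2\,dt>0.$$ Assume also that there are constants $c>0$, $\alpha>1$ such that for every $\nu$ and every $t\in[0,1]$ there exists $\tilde q(\nu,t)\in\mathbb{N}$ with the following localization property: $$\|\Delta_qu^\nu(t)\|_{L^2}\le c\,\lambda_{|q-\tilde q(\nu,t)|}^{-\alpha}\qquad\text{for all } q\in\mathbb{N}\text{ and all }\nu.$$ Then $u(t)$ is discontinuous in $L^2$ at some $t\in[0,1]$, i.e. $t\mapsto u(t)$ is not a (strongly) continuous map from $[0,1]$ to $L^2$.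
   Context: The Navier-Stokes equations with viscosity $\nu>0$ and force $f^\nu$ on $\mathbb{T}^3$ are $\partial_tu^\nu+(u^\nu\cdot\nabla)u^\nu=-\nabla p^\nu+\nu\Delta u^\nu+f^\nu$, $\nabla\cdot u^\nu=0$. The energy equality is $$\|u^\nu(t)\|_{L^2}^2=\|u^\nu(0)\|_{L^2}^2-2\nu\int_0^t\|\nabla u^\nu(\tau)\|_{L^2}^2\,d\tau+2\int_0^t(f^\nu,u^\nu)\,d\tau\qquad\text{for all } t\in[0,1].$$ $L^2=L^2(\mathbb{T}^3)$ with inner product $(\cdot,\cdot)$. $C_w([0,1];L^2)$ is the space of weakly continuous $L^2$-valued functions, and convergence in it means that $(u^\nu(t)-u(t),\phi)\to0$ uniformly in $t$ for every $\phi\in L^2$. $\lambda_q:=2^q$, and $\Delta_q$, $q\in\mathbb{N}=\{0,1,2,\dots\}$, is the Littlewood-Paley projection onto frequencies of size $\sim\lambda_q$ (supported on the dyadic shell $[\lambda_{q-1},\lambda_{q+1}]$), where the lowest block $\Delta_0$ is understood to include all lower frequencies, so that $u=\sum_{q\in\mathbb{N}}\Delta_qu$. *)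

(* Defs.v *)
From HB Require Import structures.
From mathcomp Require Import all_boot all_order all_algebra.
From mathcomp Require Import all_classical all_reals all_analysis.
Set Implicit Arguments.
Unset Strict Implicit.
Unset Printing Implicit Defensive.
Import Order.TTheory GRing.Theory Num.Theory.
Import numFieldNormedType.Exports.
Local Open Scope classical_set_scope.
Local Open Scope ring_scope.

(** * The torus [T^3 = (R / 2 pi Z)^3]

    A function on the torus is a function on [R^3] of which only the values on
    the cell [[0, 2 pi[^3] matter: every integral is taken against the Lebesgue
    measure restricted to that cell.  Only the smooth test functions are
    required to be periodic. *)

Definition cell (R : realType) :
    set (measurableTypeR R * measurableTypeR R * measurableTypeR R) :=
  (`[0, 2 * pi[%classic `*` `[0, 2 * pi[%classic) `*` `[0, 2 * pi[%classic.
Arguments cell R : clear implicits.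

Lemma measurable_cell (R : realType) : measurable (cell R).
Proof. by apply: measurableX => //; exact: measurableX. Qed.

Definition torus_measure (R : realType) :
    {measure set (measurableTypeR R * measurableTypeR R * measurableTypeR R)
      -> \bar R} :=
  mrestr ((@lebesgue_measure R \x @lebesgue_measure R) \x @lebesgue_measure R)%E
    (@measurable_cell R).

Definition xcoord (R : realType) (x : R * R * R) (i : 'I_3) : R :=
  match val i with 0%N => x.1.1 | 1%N => x.1.2 | _ => x.2 end.

Definition unit_vector (R : realType) (i : 'I_3) : R * R * R :=
  ((i == 0%N :> nat)%:R, (i == 1%N :> nat)%:R, (i == 2%N :> nat)%:R).
Arguments unit_vector R i : clear implicits.

(** * Square integrable fields

    [I] is ['I_3] for vector fields and ['I_3 * 'I_3] for their gradients. *)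

Definition torus_field (R : realType) (I : Type) : Type := I -> R * R * R -> R.

Definition inL2 (R : realType) (I : finType) (v : torus_field R I) : Prop :=
  forall i, v i \in Lfun (torus_measure R) 2%:E.

Definition inner (R : realType) (I : finType) (v w : torus_field R I) : R :=
  \int[torus_measure R]_x (\sum_i v i x * w i x).

Definition euclid (R : realType) (I : finType) (v : torus_field R I)
    (x : R * R * R) : R :=
  Num.sqrt (\sum_i v i x ^+ 2).

Definition l2norm (R : realType) (I : finType) (v : torus_field R I) : \bar R :=
  'N[torus_measure R]_2%:E[EFin \o euclid v]%E.

(** * Smooth functions and weak derivatives *)

(** In finite dimension, [f] is of class C^n as soon as all iterated directional
    derivatives of order at most [n] exist everywhere and are continuous. *)
Fixpoint Ck (R : realType) (V : normedModType R) (n : nat) (f : V -> R) : Prop :=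
  continuous f /\
  match n with
  | 0%N => True
  | m.+1 => forall v : V, (forall x, derivable f x v) /\ Ck m ('D_v f)
  end.

Definition smooth (R : realType) (V : normedModType R) (f : V -> R) : Prop :=
  forall n, Ck n f.

Definition periodic (R : realType) (g : R * R * R -> R) : Prop :=
  forall x j, g (x + (2 * pi) *: unit_vector R j) = g x.

Definition partial (R : realType) (j : 'I_3) (g : R * R * R -> R) :
    R * R * R -> R := 'D_(unit_vector R j) g.

(** [G (i, j)] is the weak derivative of [v i] in the direction [j]. *)
Definition is_weak_gradient (R : realType) (v : torus_field R 'I_3)
    (G : torus_field R ('I_3 * 'I_3)%type) : Prop :=
  inL2 G /\
  forall (i j : 'I_3) (g : R * R * R -> R), smooth g -> periodic g ->
    \int[torus_measure R]_x (v i x * partial j g x) =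
    - \int[torus_measure R]_x (G (i, j) x * g x).

Definition inH1 (R : realType) (v : torus_field R 'I_3) : Prop :=
  inL2 v /\ exists G, is_weak_gradient v G.

(** Meaningful when [inH1 v]; weak gradients are unique up to a null set. *)
Definition grad (R : realType) (v : torus_field R 'I_3) :
    torus_field R ('I_3 * 'I_3)%type :=
  xget (fun _ _ => 0) [set G | is_weak_gradient v G].

(** * Time-dependent fields on [[0, 1]]

    Elements of the Bochner spaces L^p(0,1;L^2) are represented by jointly
    measurable functions of time and space. *)

Definition unit_itv (R : realType) : set R := `[0, 1]%classic.
Arguments unit_itv R : clear implicits.

Definition spacetime_measurable (R : realType) (u : R -> torus_field R 'I_3) : Prop :=
  forall i, measurable_fun
    ((unit_itv R : set (measurableTypeR R)) `*`
     [set: measurableTypeR R * measurableTypeR R * measurableTypeR R])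
    (fun p => u p.1 i p.2).

Definition inCwL2 (R : realType) (u : R -> torus_field R 'I_3) : Prop :=
  [/\ spacetime_measurable u,
      forall t, unit_itv R t -> inL2 (u t) &
      forall phi : torus_field R 'I_3, inL2 phi ->
        {within unit_itv R, continuous (fun t => inner (u t) phi)}].

Definition inL1L2 (R : realType) (f : R -> torus_field R 'I_3) : Prop :=
  spacetime_measurable f /\
  (\int[@lebesgue_measure R]_(t in unit_itv R) l2norm (f t) < +oo)%E.

Definition inLooL2 (R : realType) (u : R -> torus_field R 'I_3) : Prop :=
  spacetime_measurable u /\
  exists M : R, {ae @lebesgue_measure R,
    forall t, unit_itv R t -> (l2norm (u t) <= M%:E)%E}.

Definition inL2H1 (R : realType) (u : R -> torus_field R 'I_3) : Prop :=
  [/\ spacetime_measurable u,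
      {ae @lebesgue_measure R, forall t, unit_itv R t -> inH1 (u t)},
      (@lebesgue_measure R).-integrable (unit_itv R)
        (fun t => l2norm (u t) ^+ 2)%E &
      (@lebesgue_measure R).-integrable (unit_itv R)
        (fun t => l2norm (grad (u t)) ^+ 2)%E].

(** * Weak solutions of the Navier-Stokes equations *)

(** Divergence-free fields of test functions of [(t, x)], periodic in [x]; the
    pressure drops out of the weak formulation. *)
Definition test_field (R : realType) (phi : 'I_3 -> R * (R * R * R) -> R) :
    Prop :=
  [/\ forall i, smooth (phi i),
      forall i t, periodic (fun x => phi i (t, x)) &
      forall t x, \sum_i partial i (fun y => phi i (t, y)) x = 0].

Definition at_time (R : realType) (phi : 'I_3 -> R * (R * R * R) -> R) (t : R) :
    torus_field R 'I_3 :=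
  fun i x => phi i (t, x).

Definition dt_at_time (R : realType) (phi : 'I_3 -> R * (R * R * R) -> R)
    (t : R) : torus_field R 'I_3 :=
  fun i x => 'D_((1, 0) : R * (R * R * R)) (phi i) (t, x).

Definition dx_at_time (R : realType) (phi : 'I_3 -> R * (R * R * R) -> R)
    (t : R) : torus_field R ('I_3 * 'I_3)%type :=
  fun p x => partial p.2 (fun y => phi p.1 (t, y)) x.

Definition tensor (R : realType) (v w : torus_field R 'I_3) :
    torus_field R ('I_3 * 'I_3)%type :=
  fun p x => v p.1 x * w p.2 x.

Definition weakly_divergence_free (R : realType) (v : torus_field R 'I_3) : Prop :=
  forall g : R * R * R -> R, smooth g -> periodic g ->
    inner v (fun j => partial j g) = 0.

(** The momentum equation is tested on every [[0, t]], using
    [(u . grad) u = div (u (x) u)]. *)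
Definition weak_solution (R : realType) (nu : R) (f u : R -> torus_field R 'I_3) :
    Prop :=
  [/\ inCwL2 u,
      inL2H1 u,
      forall t, unit_itv R t -> weakly_divergence_free (u t) &
      forall phi, test_field phi -> forall t, unit_itv R t ->
        inner (u t) (at_time phi t) = inner (u 0) (at_time phi 0) +
        \int[@lebesgue_measure R]_(s in `[0, t])
          (inner (u s) (dt_at_time phi s)
           + inner (tensor (u s) (u s)) (dx_at_time phi s)
           - nu * inner (grad (u s)) (dx_at_time phi s)
           + inner (f s) (at_time phi s))].

Definition energy_equality (R : realType) (nu : R) (f u : R -> torus_field R 'I_3) :
    Prop :=
  forall t, unit_itv R t ->
    (l2norm (u t) ^+ 2 = l2norm (u 0%R) ^+ 2
     - (2 * nu)%:E *
         \int[@lebesgue_measure R]_(s in `[0%R, t]) l2norm (grad (u s)) ^+ 2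
     + (2 * \int[@lebesgue_measure R]_(s in `[0, t])
          inner (f s) (u s))%R%:E)%E.

(** * Littlewood-Paley projections *)

Definition lp_lambda (R : realType) (q : nat) : R := 2 ^+ q.
Arguments lp_lambda R q : clear implicits.

(** Radial profile of the low-frequency cutoff. *)
Definition lp_cutoff (R : realType) (rho : R -> R) : Prop :=
  [/\ smooth rho,
      forall r, 0 <= rho r <= 1,
      forall r, r <= 2^-1 -> rho r = 1 &
      forall r, 1 <= r -> rho r = 0].

(** For [q > 0] this vanishes for [r] outside [[lp_lambda (q-1), lp_lambda (q+1)]];
    the symbols of index at most [Q] add up to [rho (r / lp_lambda Q.+1)]. *)
Definition lp_symbol (R : realType) (rho : R -> R) (q : nat) (r : R) : R :=
  if q is 0%N then rho (r / lp_lambda R 1)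
  else rho (r / lp_lambda R q.+1) - rho (r / lp_lambda R q).

Definition wavevector : Type := {ffun 'I_3 -> int}.

Definition wavenumber (R : realType) (k : wavevector) : R :=
  Num.sqrt (\sum_i (k i)%:~R ^+ 2).
Arguments wavenumber R k : clear implicits.

Definition phase (R : realType) (k : wavevector) (x : R * R * R) : R :=
  \sum_i (k i)%:~R * xcoord x i.

(** Real and imaginary parts of the conjugate of the Fourier coefficient
    [(2 pi)^-3 \int g(x) exp(- i k.x) dx]. *)
Definition fourier_cos (R : realType) (g : R * R * R -> R) (k : wavevector) : R :=
  ((2 * pi) ^+ 3)^-1 * \int[torus_measure R]_x (g x * cos (phase k x)).

Definition fourier_sin (R : realType) (g : R * R * R -> R) (k : wavevector) : R :=
  ((2 * pi) ^+ 3)^-1 * \int[torus_measure R]_x (g x * sin (phase k x)).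

(** [Delta_q v], i.e. the sum over [k] of [symbol(|k|) * vhat(k) * exp(i k.x)].
    The symbol being even in [k], the imaginary parts cancel and only the real
    part of each term is written.  The sum has finite support. *)
Definition lp_block (R : realType) (rho : R -> R) (q : nat) (v : torus_field R 'I_3) :
    torus_field R 'I_3 :=
  fun i x => \sum_(k \in [set: wavevector])
    lp_symbol rho q (wavenumber R k) *
    (fourier_cos (v i) k * cos (phase k x)
     + fourier_sin (v i) k * sin (phase k x)).

(* Main.v *)
Require Import Defs.
From HB Require Import structures.
From mathcomp Require Import all_boot all_order all_algebra.
From mathcomp Require Import all_classical all_reals all_analysis.
From mathcomp Require Import measurable_realfun zify ring lra.
Set Implicit Arguments.
Unset Strict Implicit.
Unset Printing Implicit Defensive.
Import Order.TTheory GRing.Theory Num.Theory.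
Import numFieldNormedType.Exports.
Local Open Scope classical_set_scope.
Local Open Scope ring_scope.

(** Suppose that [u] is strongly continuous in [L^2].  The heart of the proof is that
    [u] then keeps the inviscid energy balance
      [||u(1)||^2 - ||u(0)||^2 = 2 \int_0^1 (f, u)]     ([limit_energy_balance]).
    Compare it with the energy equality of [u^nu] on [[0, 1]]: the norms at time [0]
    converge, the powers of the forces converge, and the norm at time [1] can only
    drop in the weak limit.  Hence [nu \int_0^1 ||grad u^nu||^2] has to tend to [0]
    ([dissipation_vanishes]), which the anomaly forbids.

    The balance is a local matter, by induction on intervals, and two regimes occur.

    Near a time [t] with [u(t) <> 0], some trigonometric polynomial pairs with [u(t)]
    to a nonzero number, hence, by weak continuity of [u] and uniform weak convergence,
    it pairs with [u^nu(s)] to a number bounded away from [0] for [s] near [t] and [nu]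
    small.  A field localized around a very high frequency is nearly orthogonal to it,
    so the frequencies [2 ^ q~(nu, s)] stay bounded ([localization_bounded]).  Now all
    blocks obey [||Delta_q u^nu(s)|| <= K 2 ^ (- alpha q)] with the same [K].  As
    [alpha > 1], Bernstein's inequality bounds [||grad u^nu(s)||], so that viscosity
    dissipates nothing in the limit ([grad_l2norm_le]); and uniform decay upgrades weak
    to strong convergence ([localized_cvg]).  The energy equality of [u^nu] thus passes
    to the limit near [t] ([local_energy_balance]).

    The times at which [u] vanishes are where strong continuity is needed.  Away from
    them the local balances make [h = ||u||] Lipschitz with respect to [2 \int ||f||];
    truncating [h] from below by [d > 0] shows that the same holds across them.  So where
    [h <= d] both sides of the balance are [O(d)] times [\int ||f||], and [d] is
    arbitrary ([energy_balance]).

    Underneath lies some Fourier analysis: trigonometric polynomials are dense in [L^2]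
    of the torus ([trigonometric_dense]), so that [L^2] bounds can be proved by duality
    against them ([nrm_dual_le]), where blocks and derivatives act on finitely many
    coefficients.  The a priori bound on [||u^nu||] that all limits rely on comes from
    the energy equality ([energy_bound]). *)

(** * Square integrable functions *)

(** The degenerate case [c = 0] matters: a bilinear form on functions vanishes on those
    that are null almost everywhere. *)
Lemma discriminant_le (R : realType) (a b c : R) : 0 <= c ->
  (forall t, 0 <= a + 2 * t * b + t ^+ 2 * c) -> b ^+ 2 <= a * c.
Proof.
rewrite le_eqVlt => /orP[/eqP <-|c0] h.
  have [->|b0] := eqVneq b 0; first by rewrite expr0n/= mulr0.
  have := h (- (a + 1) / (2 * b)).
  suff -> : a + 2 * (- (a + 1) / (2 * b)) * b + (- (a + 1) / (2 * b)) ^+ 2 * 0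
    = -1 by rewrite oppr_ge0 ler10.
  by field.
have := h (- b / c).
have -> : a + 2 * (- b / c) * b + (- b / c) ^+ 2 * c = a - b ^+ 2 / c.
  by field; rewrite gt_eqF.
by rewrite subr_ge0 ler_pdivrMr.
Qed.

Section L2space.
Context d (T : measurableType d) (R : realType) (mu : {measure set T -> \bar R}).
Implicit Types f g h : T -> R.

Definition L2 f : Prop := f \in Lfun mu 2%:E.

Definition ip f g : R := \int[mu]_x (f x * g x).

Definition nrm f : R := Num.sqrt (ip f f).

Lemma L2_measurable f : L2 f -> measurable_fun setT f.
Proof. by rewrite /L2 inE => /andP[/[!inE]]. Qed.

Lemma L2P f : L2 f <-> measurable_fun setT f /\
  mu.-integrable setT (fun x => (f x ^+ 2)%:E).
Proof.
split=> [Lf|[mf]]; first by split; [exact: L2_measurable|exact: Lfun2_integrable_sqr].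
move=> /integrableP[_ ify]; rewrite /L2 inE; apply/andP; split; rewrite inE//=.
rewrite /finite_norm unlock poweR_lty//.
move: ify; congr (_ < _)%E; apply: eq_integral => x _ /=.
by rewrite powR_mulrn// normrX.
Qed.

Lemma L2_mul f g : L2 f -> L2 g -> mu.-integrable setT (EFin \o (fun x => f x * g x)).
Proof. by move=> Lf Lg; apply/Lfun1_integrable; exact: Lfun2_mul_Lfun1. Qed.

Lemma L2D f g : L2 f -> L2 g -> L2 (fun x => f x + g x).
Proof.
have p1 : (1 <= 2%:E :> \bar R)%E by rewrite lee_fin ler1n.
by move=> Lf Lg; exact: (Lfun_addr_closed mu p1).2.
Qed.

Lemma L2Z a f : L2 f -> L2 (fun x => a * f x).
Proof.
move=> /(Lfun_scale a) => /(_ _); rewrite /L2.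
have -> : (fun x => a * f x) = a \o* f by apply/funext => x /=; rewrite mulrC.
by apply; rewrite ler1n.
Qed.

Lemma L2N f : L2 f -> L2 (fun x => - f x).
Proof. by move=> /(L2Z (-1)); under eq_fun do rewrite mulN1r. Qed.

Lemma L2B f g : L2 f -> L2 g -> L2 (fun x => f x - g x).
Proof. by move=> Lf Lg; apply: L2D => //; exact: L2N. Qed.

Lemma L2_0 : L2 (fun=> 0).
Proof.
apply/L2P; split=> //; rewrite expr0n/=; exact: integrable0.
Qed.

Lemma L2_sum (I : Type) (s : seq I) (F : I -> T -> R) :
  (forall i, L2 (F i)) -> L2 (fun x => \sum_(i <- s) F i x).
Proof.
move=> h; elim: s => [|i s ih].
  by under eq_fun do rewrite big_nil; exact: L2_0.
by under eq_fun do rewrite big_cons; exact: L2D.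
Qed.

Lemma ipC f g : ip f g = ip g f.
Proof. by rewrite /ip; under eq_Rintegral do rewrite mulrC. Qed.

Lemma ipDl f g h : L2 f -> L2 g -> L2 h ->
  ip (fun x => f x + g x) h = ip f h + ip g h.
Proof.
move=> Lf Lg Lh; rewrite /ip -RintegralD//; [|exact: L2_mul..].
by apply: eq_Rintegral => x _; rewrite mulrDl.
Qed.

Lemma ipZl a f h : L2 f -> L2 h -> ip (fun x => a * f x) h = a * ip f h.
Proof.
move=> Lf Lh; rewrite /ip -RintegralZl//; last exact: L2_mul.
by apply: eq_Rintegral => x _; rewrite mulrA.
Qed.

Lemma ipNl f h : L2 f -> L2 h -> ip (fun x => - f x) h = - ip f h.
Proof.
move=> Lf Lh; rewrite -mulN1r -ipZl//.
by congr (ip _ _); apply/funext => x; rewrite mulN1r.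
Qed.

Lemma ipBl f g h : L2 f -> L2 g -> L2 h ->
  ip (fun x => f x - g x) h = ip f h - ip g h.
Proof. by move=> Lf Lg Lh; rewrite ipDl ?ipNl//; exact: L2N. Qed.

Lemma ipDr f g h : L2 f -> L2 g -> L2 h ->
  ip h (fun x => f x + g x) = ip h f + ip h g.
Proof. by move=> Lf Lg Lh; rewrite ipC ipDl// !(ipC h). Qed.

Lemma ipZr a f h : L2 f -> L2 h -> ip h (fun x => a * f x) = a * ip h f.
Proof. by move=> Lf Lh; rewrite ipC ipZl// (ipC h). Qed.

Lemma ip_suml (I : Type) (s : seq I) (F : I -> T -> R) h :
  (forall i, L2 (F i)) -> L2 h ->
  ip (fun x => \sum_(i <- s) F i x) h = \sum_(i <- s) ip (F i) h.
Proof.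
move=> LF Lh; elim: s => [|i s ih].
  rewrite big_nil /ip; under eq_Rintegral do rewrite big_nil mul0r.
  by rewrite Rintegral_cst// mul0r.
rewrite big_cons -ih -ipDl//; last exact: L2_sum.
by congr (ip _ _); apply/funext => x; rewrite big_cons.
Qed.

Lemma ip_ge0 f : 0 <= ip f f.
Proof. by apply: Rintegral_ge0 => x _; rewrite -expr2 sqr_ge0. Qed.

Lemma nrm_ge0 f : 0 <= nrm f.
Proof. exact: sqrtr_ge0. Qed.

Lemma nrm_sqr f : nrm f ^+ 2 = ip f f.
Proof. by rewrite sqr_sqrtr// ip_ge0. Qed.

Lemma Cauchy_Schwarz f g : L2 f -> L2 g -> `|ip f g| <= nrm f * nrm g.
Proof.
move=> Lf Lg; rewrite -sqrtr_sqr -sqrtrM ?ip_ge0// ler_wsqrtr//.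
apply: discriminant_le; first exact: ip_ge0.
move=> t; have := ip_ge0 (fun x => f x + t * g x).
have Ltg := L2Z t Lg.
rewrite ipDl// ?ipDr// ?(ipZl _ Lg)// ?(ipZr _ Lg)//; last exact: L2D.
by rewrite (ipC g f); congr (_ <= _); ring.
Qed.

Lemma nrmD_le f g : L2 f -> L2 g -> nrm (fun x => f x + g x) <= nrm f + nrm g.
Proof.
move=> Lf Lg; rewrite -(@ler_pXn2r _ 2)// ?nnegrE ?nrm_ge0 ?addr_ge0 ?nrm_ge0//.
have LD := L2D Lf Lg.
rewrite nrm_sqr ipDl// !ipDr// sqrrD !nrm_sqr (ipC g f).
have := le_trans (ler_norm _) (Cauchy_Schwarz Lf Lg).
lra.
Qed.

Lemma nrmZ a f : L2 f -> nrm (fun x => a * f x) = `|a| * nrm f.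
Proof.
move=> Lf; have Laf := L2Z a Lf.
by rewrite /nrm ipZl// ipZr// mulrA -expr2 sqrtrM ?sqr_ge0// sqrtr_sqr.
Qed.

Lemma nrmN f : L2 f -> nrm (fun x => - f x) = nrm f.
Proof.
move=> Lf; transitivity (nrm (fun x => (-1) * f x)).
  by congr nrm; apply/funext => x; rewrite mulN1r.
by rewrite nrmZ// normrN normr1 mul1r.
Qed.

Lemma nrmB_le f g : L2 f -> L2 g -> nrm (fun x => f x - g x) <= nrm f + nrm g.
Proof. by move=> Lf Lg; rewrite -(nrmN Lg); apply: nrmD_le => //; exact: L2N. Qed.

End L2space.

(** * Integration over the torus *)

Section torus_integral.
Variable R : realType.
Local Notation X := (measurableTypeR R * measurableTypeR R * measurableTypeR R)%type.
Local Notation leb := (@lebesgue_measure R).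
Local Notation leb3 := ((leb \x leb) \x leb)%E.
Local Notation torus := (torus_measure R).
Local Notation period := (`[0, 2 * pi[%classic : set (measurableTypeR R)).

Definition volume : R := (2 * pi) ^+ 3.

Lemma twopi_gt0 : 0 < 2 * pi :> R.
Proof. by rewrite mulr_gt0 // pi_gt0. Qed.

Lemma volume_gt0 : 0 < volume.
Proof. by rewrite exprn_gt0// twopi_gt0. Qed.

Lemma leb_period : leb period = (2 * pi)%:E.
Proof. by rewrite lebesgue_measure_itv/= lte_fin twopi_gt0 oppr0 adde0. Qed.

Lemma torus_measureT : torus setT = volume%:E.
Proof.
rewrite /torus_measure/= /mrestr setTI /cell.
have mI : measurable period by [].
have mII : measurable (period `*` period) by exact: measurableX.
apply: etrans (product_measure1E _ leb mII mI) _.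
apply: etrans (congr1 ( *%E^~ _) (product_measure1E leb leb mI mI)) _.
apply: etrans (congr2 *%E (congr2 *%E leb_period leb_period) leb_period) _.
by rewrite -!EFinM /volume !exprS expr0 mulr1 mulrA.
Qed.

Lemma torus_measure_fin : fin_num_fun torus.
Proof.
move=> A mA; rewrite ge0_fin_numE//.
by rewrite (@le_lt_trans _ _ (torus setT)) ?le_measure ?inE// torus_measureT ltry.
Qed.

(** Partial integrals against a bare measure need not be measurable; finiteness is what
    Tonelli's theorem asks for. *)
Definition finite_torus_measure : {finite_measure set X -> \bar R} :=
  HB.pack (Measure.sort torus)
    (Measure_isFinite.Build _ _ _ (Measure.sort torus) torus_measure_fin).

(** The restriction of a product measure does not show its factors any more; on the right
    the product is back in sight, and iterated integration applies. *)
Lemma torus_integralE (f : X -> \bar R) : measurable_fun setT f ->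
  (\int[torus]_x f x = \int[leb3]_(x in cell R) f x)%E.
Proof.
move=> mf; have mc := @measurable_cell R.
transitivity (\int[torus]_(x in cell R) f x)%E; last first.
  apply: eq_measure_integral => A mA AB.
  by rewrite /torus_measure/= /mrestr setIidl.
have h (g : X -> \bar R) : measurable_fun setT g -> (forall x, 0 <= g x)%E ->
    (\int[torus]_x g x = \int[torus]_(x in cell R) g x)%E.
  move=> mg g0; rewrite (@ge0_negligible_integral _ _ _ torus _ (~` cell R))//.
  - by rewrite setTD setCK.
  - exact: measurableC.
  - by rewrite /torus_measure/= /mrestr setICl measure0.
rewrite integralE [RHS]integralE; congr (_ - _)%E; apply: h => //.
- exact: measurable_funepos.
- exact: measurable_funeneg.
Qed.

Lemma measurable_prod_fun d1 d2 (T1 : measurableType d1) (T2 : measurableType d2)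
    (F : T1 -> R) (G : T2 -> R) :
  measurable_fun setT F -> measurable_fun setT G ->
  measurable_fun setT (fun x : T1 * T2 => F x.1 * G x.2).
Proof.
by move=> mF mG; apply: measurable_funM; exact: measurableT_comp.
Qed.

(** Integrability is part of the conclusion, so that the lemma can be iterated. *)
Lemma integral_prod d1 d2 (T1 : measurableType d1) (T2 : measurableType d2)
    (m1 : {sigma_finite_measure set T1 -> \bar R})
    (m2 : {sigma_finite_measure set T2 -> \bar R}) (F : T1 -> R) (G : T2 -> R) :
  m1.-integrable setT (EFin \o F) -> m2.-integrable setT (EFin \o G) ->
  (m1 \x m2)%E.-integrable setT (EFin \o (fun x => F x.1 * G x.2)) /\
  (\int[(m1 \x m2)%E]_x (F x.1 * G x.2) =
  \int[m1]_x F x * \int[m2]_x G x).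
Proof.
move=> iF iG.
have /integrableP[mF fF] := iF.
have /integrableP[mG fG] := iG.
have i12 : (m1 \x m2)%E.-integrable setT (EFin \o (fun x => F x.1 * G x.2)).
  apply/integrable12ltyP => /=.
    apply/measurable_EFinP; apply: measurable_prod_fun; exact/measurable_EFinP.
  have -> : (\int[m1]_x \int[m2]_y `|(F x * G y)%:E| =
     \int[m1]_x (`|F x|%:E * \int[m2]_y `|G y|%:E))%E.
    apply: eq_integral => x _.
    rewrite -ge0_integralZl//; last first.
      by apply/measurable_EFinP; apply: measurableT_comp => //; exact/measurable_EFinP.
    by apply: eq_integral => y _; rewrite -EFinM -normrM.
  rewrite ge0_integralZr//; last 2 first.
  - by apply/measurable_EFinP; apply: measurableT_comp => //; exact/measurable_EFinP.
  - exact: integral_ge0.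
  by rewrite lte_mul_pinfty// ?integral_ge0// ge0_fin_numE// integral_ge0.
split=> //; rewrite /Rintegral -integral12_prod_meas1// /fubini_F/=.
rewrite -fineM; [|exact: integrable_fin_num..].
congr fine.
under eq_integral do under eq_integral do rewrite EFinM.
under eq_integral => x _ do rewrite integralZl//.
have /fineK <- := integrable_fin_num measurableT iG.
by rewrite integralZr//.
Qed.

(** Products with three factors are formed as [(leb \x leb) \x leb]. *)
Lemma sigma_finite_leb2 : sigma_finite setT (leb \x leb)%E.
Proof.
pose I n : set (measurableTypeR R) := `[- n%:R, n%:R]%classic.
have mI n : measurable (I n) by exact: measurable_itv.
exists (fun n => I n `*` I n) => [|n].
  apply/esym; rewrite -subTset => -[x y] _.
  exists (Num.bound (`|x| + `|y|)) => //=.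
  have /ltW := archi_boundP (addr_ge0 (normr_ge0 x) (normr_ge0 y)).
  rewrite /I /= !in_itv/= -!ler_norml => h.
  by split; apply: le_trans h; rewrite ?lerDl ?lerDr.
split; first by apply: measurableX; exact: measurable_itv.
apply: (@le_lt_trans _ _ (leb (I n) * leb (I n))%E); first by rewrite product_measure1E.
by rewrite !lebesgue_measure_itv/=; case: ifPn => _; rewrite ?mule0 ?ltry.
Qed.

Definition leb2 :
    {sigma_finite_measure set (measurableTypeR R * measurableTypeR R)%type -> \bar R} :=
  HB.pack (leb \x leb)%E
    (Measure_isSigmaFinite.Build _ _ _ (leb \x leb)%E sigma_finite_leb2).

Lemma torus_integral_prod (F G H : R -> R) :
  measurable_fun setT F -> measurable_fun setT G -> measurable_fun setT H ->
  leb.-integrable period (EFin \o F) -> leb.-integrable period (EFin \o G) ->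
  leb.-integrable period (EFin \o H) ->
  \int[torus]_x (F x.1.1 * G x.1.2 * H x.2) =
  (\int[leb]_(x in period) F x) * (\int[leb]_(x in period) G x) *
  (\int[leb]_(x in period) H x).
Proof.
move=> mF mG mH iF iG iH.
rewrite {1}/Rintegral torus_integralE; last first.
  apply/measurable_EFinP.
  apply: (@measurable_prod_fun _ _ _ _ (fun x => F x.1 * G x.2)) => //.
  exact: measurable_prod_fun.
rewrite integral_mkcond.
have restr (K : R -> R) : leb.-integrable period (EFin \o K) ->
    leb.-integrable setT (EFin \o (K \_ period)).
  by rewrite integrable_mkcond//; apply: eq_integrable => // x _; rewrite restrict_EFin.
have [i1 e1] := integral_prod (restr _ iF) (restr _ iG).
have [i2 e2] := @integral_prod _ _ _ _ leb2 leb
  (fun x => (F \_ period) x.1 * (G \_ period) x.2) _ i1 (restr _ iH).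
rewrite (Rintegral_mkcond leb _ F) (Rintegral_mkcond leb _ G) (Rintegral_mkcond leb _ H).
rewrite -e1 -e2; congr fine; apply: eq_integral => x _.
rewrite restrict_EFin /patch /=; congr EFin.
have [[[h1 h2] h3]|h] := pselect (cell R x).
  by rewrite !ifT//; apply/mem_set.
rewrite ifF; last by apply/negbTE; rewrite notin_setE.
case: ifPn => [h1|_]; last by rewrite !mul0r.
case: ifPn => [h2|_]; last by rewrite mulr0 mul0r.
case: ifPn => [h3|_]; last by rewrite mulr0.
by case: h; exact: (conj (conj (set_mem h1) (set_mem h2)) (set_mem h3)).
Qed.

End torus_integral.

(** * Means of the Fourier modes *)

Section phases.
Variable R : realType.
Local Notation leb := (@lebesgue_measure R).
Local Notation torus := (torus_measure R).
Local Notation period := (`[0, 2 * pi[%classic : set (measurableTypeR R)).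
Implicit Types (k l : wavevector).

Lemma cos_sin_2piZ (m : int) :
  cos (m%:~R * (2 * pi)) = 1 :> R /\ sin (m%:~R * (2 * pi)) = 0 :> R.
Proof.
have nat n : cos (n%:R * (2 * pi)) = 1 :> R /\ sin (n%:R * (2 * pi)) = 0 :> R.
  have -> : n%:R * (2 * pi) = 0 + (pi *+ 2) *+ n :> R by ring.
  by rewrite (periodicn (@cosD2pi R)) (periodicn (@sinD2pi R)) cos0 sin0.
case: m => n; first exact: nat.
by rewrite NegzE rmorphN/= mulNr cosN sinN !(nat n.+1).1 !(nat n.+1).2 oppr0.
Qed.

Lemma derivable_oo_LRcontinuous_derivable (F : R -> R) (a b : R) :
  (forall x, derivable F x 1) -> derivable_oo_LRcontinuous F a b.
Proof.
move=> dF; have cF x : {for x, continuous F}.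
  by apply/differentiable_continuous/derivable1_diffP.
by split => [x _//||]; [apply: cvg_at_right_filter|apply: cvg_at_left_filter]; exact: cF.
Qed.

Lemma continuous_integrable_period (f : R -> R) : continuous f ->
  leb.-integrable period (EFin \o f).
Proof.
move=> cf; apply: (@integrableS _ (measurableTypeR R) _ leb (`[0, 2 * pi]%classic)) => //.
  by apply: subset_itvl; rewrite bnd_simp.
apply: continuous_compact_integrable; first exact: segment_compact.
exact: continuous_subspaceT.
Qed.

Lemma integral_period (f F : R -> R) : continuous f ->
  (forall x : R, is_derive x (1 : R) F (f x)) ->
  \int[leb]_(x in period) f x = F (2 * pi) - F 0.
Proof.
move=> cf dF; rewrite Rintegral_itv_bndo_bndc; last first.
  exact: continuous_integrable_period.
rewrite /Rintegral (@continuous_FTC2 _ _ F)//.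
- exact: twopi_gt0.
- exact: continuous_subspaceT.
- by apply: derivable_oo_LRcontinuous_derivable => x; exact: ex_derive.
- by move=> x _; rewrite derive1E derive_val.
Qed.

Lemma continuous_cosZ (a : R) : continuous (fun x : R => cos (a * x)).
Proof.
move=> x; apply: (@continuous_comp _ _ _ (fun x => a * x) cos).
  exact: mulrl_continuous.
exact: continuous_cos.
Qed.

Lemma continuous_sinZ (a : R) : continuous (fun x : R => sin (a * x)).
Proof.
move=> x; apply: (@continuous_comp _ _ _ (fun x => a * x) sin).
  exact: mulrl_continuous.
exact: continuous_sin.
Qed.

Lemma integral_cos (m : int) :
  \int[leb]_(x in period) cos (m%:~R * x) = if m == 0 then 2 * pi else 0.
Proof.
case: eqVneq => [->|m0].
  under eq_Rintegral do rewrite mul0r cos0.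
  by rewrite Rintegral_cst// mul1r; exact: (congr1 fine (leb_period R)).
have mR : m%:~R != 0 :> R by rewrite intr_eq0.
have dF (x : R) : is_derive x (1 : R) (fun x => m%:~R^-1 * sin (m%:~R * x))
    (cos (m%:~R * x)).
  by apply: is_derive_eq; rewrite /GRing.scale/=; field.
rewrite (integral_period _ dF); last exact: continuous_cosZ.
by rewrite (cos_sin_2piZ m).2 !mulr0 sin0 mulr0 subrr.
Qed.

Lemma integral_sin (m : int) : \int[leb]_(x in period) sin (m%:~R * x) = 0.
Proof.
have [->|m0] := eqVneq m 0.
  under eq_Rintegral do rewrite mul0r sin0.
  by rewrite Rintegral_cst// mul0r.
have mR : m%:~R != 0 :> R by rewrite intr_eq0.
have dF (x : R) : is_derive x (1 : R) (fun x => - (m%:~R^-1 * cos (m%:~R * x)))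
    (sin (m%:~R * x)).
  by apply: is_derive_eq; rewrite /GRing.scale/=; field.
rewrite (integral_period _ dF); last exact: continuous_sinZ.
by rewrite (cos_sin_2piZ m).1 !mulr0 cos0 mulr1 opprK addrC subrr.
Qed.

Lemma phaseE k (x : R * R * R) : phase k x =
  (k (@Ordinal 3 0 isT))%:~R * x.1.1 + (k (@Ordinal 3 1 isT))%:~R * x.1.2 +
  (k (@Ordinal 3 2 isT))%:~R * x.2.
Proof.
rewrite /phase !big_ord_recl big_ord0 addr0 /= addrA.
by congr (_ + _ + _); congr ((k _)%:~R * _); exact: val_inj.
Qed.

Lemma measurable_prod3 (F G H : R -> R) :
  measurable_fun setT F -> measurable_fun setT G -> measurable_fun setT H ->
  measurable_fun [set: measurableTypeR R * measurableTypeR R * measurableTypeR R]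
    (fun x => F x.1.1 * G x.1.2 * H x.2).
Proof.
move=> mF mG mH.
apply: (@measurable_prod_fun _ _ _ _ _ (fun x => F x.1 * G x.2)) => //.
exact: measurable_prod_fun.
Qed.

Lemma bounded_integrable M
    (f : measurableTypeR R * measurableTypeR R * measurableTypeR R -> R) :
  measurable_fun setT f -> (forall x, `|f x| <= M) ->
  torus.-integrable setT (EFin \o f).
Proof.
move=> mf fM; apply: measurable_bounded_integrable => //.
  by rewrite torus_measureT ltry.
exists M; split; first exact: num_real.
by move=> y My x _ /=; rewrite (le_trans (fM x))// ltW.
Qed.

(** The sum has the shape of the cosine or sine of a sum of three angles, expanded by
    the addition formulas. *)
Lemma torus_integral4 (s1 s2 s3 : R) (F1 G1 H1 F2 G2 H2 F3 G3 H3 F4 G4 H4 : R -> R) :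
  let good (f : R -> R) := [/\ measurable_fun setT f, (forall x, `|f x| <= 1) &
    leb.-integrable period (EFin \o f)] in
  good F1 -> good G1 -> good H1 -> good F2 -> good G2 -> good H2 ->
  good F3 -> good G3 -> good H3 -> good F4 -> good G4 -> good H4 ->
  let I F := \int[leb]_(x in period) F x in
  \int[torus]_x (F1 x.1.1 * G1 x.1.2 * H1 x.2 + s1 * (F2 x.1.1 * G2 x.1.2 * H2 x.2)
    + s2 * (F3 x.1.1 * G3 x.1.2 * H3 x.2) + s3 * (F4 x.1.1 * G4 x.1.2 * H4 x.2)) =
  I F1 * I G1 * I H1 + s1 * (I F2 * I G2 * I H2) + s2 * (I F3 * I G3 * I H3) +
  s3 * (I F4 * I G4 * I H4).
Proof.
move=> good gF1 gG1 gH1 gF2 gG2 gH2 gF3 gG3 gH3 gF4 gG4 gH4 I.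
have int F G H : good F -> good G -> good H ->
    torus.-integrable setT (EFin \o (fun x => F x.1.1 * G x.1.2 * H x.2)).
  move=> [mF bF _] [mG bG _] [mH bH _].
  apply: (@bounded_integrable 1); first exact: measurable_prod3.
  by move=> x; rewrite !normrM !mulr_ile1// mulr_ge0.
have intZ s F G H : good F -> good G -> good H ->
    torus.-integrable setT (EFin \o (fun x => s * (F x.1.1 * G x.1.2 * H x.2))).
  by move=> gF gG gH; have := integrableZl measurableT s (int _ _ _ gF gG gH).
have intD (f g : R * R * R -> R) : torus.-integrable setT (EFin \o f) ->
    torus.-integrable setT (EFin \o g) ->
    torus.-integrable setT (EFin \o (fun x => f x + g x)).
  by move=> h1 h2; exact: (integrableD measurableT h1 h2).
have E F G H : good F -> good G -> good H ->
    \int[torus]_x (F x.1.1 * G x.1.2 * H x.2) = I F * I G * I H.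
  by move=> [? ? ?] [? ? ?] [? ? ?]; exact: torus_integral_prod.
rewrite !RintegralD// ?RintegralZl// ?E//; try exact: int; try exact: intZ.
- by apply: intD; [exact: int|exact: intZ].
- by apply: (intD) => //; [apply: (intD) => //; [exact: int|exact: intZ]|exact: intZ].
Qed.

Definition cosk k (x : R * R * R) : R := cos (phase k x).
Definition sink k (x : R * R * R) : R := sin (phase k x).

(** After expansion by the addition formulas every term is a product of functions of
    one coordinate, and only a cosine of zero frequency has a nonzero mean. *)
Lemma mean_cosk_sink k :
  \int[torus]_x cosk k x = (if k == 0 then volume R else 0) /\
  \int[torus]_x sink k x = 0.
Proof.
pose c (m : int) (x : R) := cos (m%:~R * x); pose s (m : int) (x : R) := sin (m%:~R * x).
have gc m : [/\ measurable_fun setT (c m), (forall x, `|c m x| <= 1) &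
    leb.-integrable period (EFin \o c m)].
  split; [|by move=> x; exact: cos_max|].
  - by apply: continuous_measurable_fun; exact: continuous_cosZ.
  - by apply: continuous_integrable_period; exact: continuous_cosZ.
have gs m : [/\ measurable_fun setT (s m), (forall x, `|s m x| <= 1) &
    leb.-integrable period (EFin \o s m)].
  split; [|by move=> x; exact: sin_max|].
  - by apply: continuous_measurable_fun; exact: continuous_sinZ.
  - by apply: continuous_integrable_period; exact: continuous_sinZ.
set a := k (@Ordinal 3 0 isT); set b := k (@Ordinal 3 1 isT).
set d := k (@Ordinal 3 2 isT).
have k0 : (k == 0) = [&& a == 0, b == 0 & d == 0].
  apply/eqP/and3P => [k0|[/eqP a0 /eqP b0 /eqP d0]].
    by rewrite /a /b /d k0 !ffunE.
  apply/ffunP => -[[|[|[|]]] i3]//; rewrite ffunE.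
  - by rewrite -[RHS]a0; congr (k _); exact: val_inj.
  - by rewrite -[RHS]b0; congr (k _); exact: val_inj.
  - by rewrite -[RHS]d0; congr (k _); exact: val_inj.
split.
  transitivity (\int[torus]_x (c a x.1.1 * c b x.1.2 * c d x.2
    + (-1) * (s a x.1.1 * s b x.1.2 * c d x.2)
    + (-1) * (s a x.1.1 * c b x.1.2 * s d x.2)
    + (-1) * (c a x.1.1 * s b x.1.2 * s d x.2))).
    apply: eq_Rintegral => x _; rewrite /cosk phaseE -/a -/b -/d !(cosD, sinD) /c /s.
    ring.
  rewrite torus_integral4// !integral_cos !integral_sin !(mulr0, mul0r) !addr0.
  rewrite k0 /volume; do 3 (case: ifPn => _; rewrite ?mulr0 ?mul0r//=).
  by rewrite !exprS expr0; ring.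
transitivity (\int[torus]_x (s a x.1.1 * c b x.1.2 * c d x.2
    + 1 * (c a x.1.1 * s b x.1.2 * c d x.2)
    + 1 * (c a x.1.1 * c b x.1.2 * s d x.2)
    + (-1) * (s a x.1.1 * s b x.1.2 * s d x.2))).
  apply: eq_Rintegral => x _; rewrite /sink phaseE -/a -/b -/d !(cosD, sinD) /c /s.
  ring.
by rewrite torus_integral4// !integral_sin !(mulr0, mul0r) !addr0.
Qed.

End phases.

(** * Null sequences *)

Lemma cvg0Ml (R : realType) (I : Type) (F : set_system I) {FF : Filter F}
    (z : I -> R) (a : R) :
  z n @[n --> F] --> (0 : R) -> a * z n @[n --> F] --> (0 : R).
Proof.
by move=> z0; rewrite -[X in _ --> X](mulr0 a); apply: cvgM z0; exact: cvg_cst.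
Qed.

Lemma cvg_sum0 (R : realType) (I : Type) (F : set_system I) {FF : Filter F}
    (J : Type) (s : seq J) (z : J -> I -> R) :
  (forall j, z j n @[n --> F] --> (0 : R)) ->
  \sum_(j <- s) z j n @[n --> F] --> (0 : R).
Proof.
move=> z0; elim: s => [|j s ih].
  by under eq_fun do rewrite big_nil; exact: cvg_cst.
have -> : (fun n => \sum_(i <- j :: s) z i n) = (fun n => z j n + \sum_(i <- s) z i n).
  by apply/funext => n; rewrite big_cons.
by rewrite -[X in _ --> X](addr0 (0 : R)); exact: cvgD.
Qed.

Lemma mulrn_exp_cvg0 (R : realType) (r : R) : 0 <= r < 1 ->
  n%:R * r ^+ n @[n --> \oo] --> (0 : R).
Proof.
move=> /andP[r0 r1]; pose s := Num.sqrt r.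
have s0 : 0 <= s by exact: sqrtr_ge0.
have s1 : s < 1 by rewrite /s -[X in _ < X]sqrtr1 ltr_sqrt.
have sr : s ^+ 2 = r by rewrite sqr_sqrtr.
have sn0 n : 0 <= s ^+ n by exact: exprn_ge0.
have sn1 n : s ^+ n <= 1 by exact/exprn_ile1/ltW.
(* With [s = sqrt r], the sum [1 + s + ... + s ^ (n - 1)] is at least [n s ^ n], which
   gives [n r ^ n <= s ^ n / (1 - s)]. *)
have ge n : n%:R * s ^+ n * (1 - s) <= 1 - s ^+ n.
  elim: n => [|n ih]; first by rewrite !mul0r expr0 subrr.
  have h1 := ler_wpM2l s0 ih.
  have h2 : 0 <= (1 - s) * (1 - s ^+ n.+1).
    by rewrite mulr_ge0// subr_ge0 ?sn1// ltW.
  by move: h1 h2; rewrite -[in n.+1%:R]addn1 natrD !exprS; lra.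
have ge' n : n%:R * s ^+ n <= (1 - s)^-1.
  rewrite -[leRHS]mul1r ler_pdivlMr ?subr_gt0// (le_trans (ge n))//.
  by rewrite gerBl.
apply: (@squeeze_cvgr _ _ _ _ (cst 0) (fun n => (1 - s)^-1 * s ^+ n)).
- near=> n; rewrite mulr_ge0 ?exprn_ge0//= -sr -exprM mulnC exprM expr2 mulrA.
  by rewrite ler_wpM2r.
- exact: cvg_cst.
- by apply: cvg0Ml; apply: cvg_expr; rewrite ger0_norm.
Unshelve. all: by end_near. Qed.

(** * Domination in the space of square integrable functions *)

Section dominated_L2.
Context d (T : measurableType d) (R : realType) (mu : {measure set T -> \bar R}).
Implicit Types f g h : T -> R.

Lemma L2_le f g : measurable_fun setT f -> L2 mu g -> (forall x, `|f x| <= `|g x|) ->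
  L2 mu f.
Proof.
move=> mf /L2P[mg ig] fg; apply/L2P; split=> //.
apply: le_integrable ig => //.
  by apply/measurable_EFinP; exact: measurable_funX.
by move=> x _; rewrite lee_fin !normrX lerXn2r// nnegrE.
Qed.

Lemma le_nrm f g : L2 mu f -> L2 mu g -> (forall x, `|f x| <= `|g x|) ->
  nrm mu f <= nrm mu g.
Proof.
move=> Lf Lg fg; rewrite ler_wsqrtr//; apply: le_Rintegral => //; try exact: L2_mul.
by move=> x _; rewrite -!expr2 -(real_normK (num_real (f x)))
   -(real_normK (num_real (g x))) lerXn2r// nnegrE.
Qed.

Lemma L2_cvg (f_ : nat -> T -> R) f g :
  (forall n, measurable_fun setT (f_ n)) -> measurable_fun setT f -> L2 mu g ->
  (forall n x, `|f_ n x| <= g x) ->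
  (forall x, f_ n x @[n --> \oo] --> f x) ->
  L2 mu f /\ nrm mu (fun x => f x - f_ n x) @[n --> \oo] --> (0 : R).
Proof.
move=> mf_ mf Lg fg ff.
have fg' x : `|f x| <= g x.
  have h : (fun n => `|f_ n x|) @ \oo --> `|f x| by exact: cvg_norm (ff x).
  rewrite -(cvg_lim _ h)//; apply: limr_le; first by apply/cvg_ex; eexists; exact: h.
  by near=> n.
have gn x : g x = `|g x| by rewrite ger0_norm// (le_trans _ (fg' x)).
have Lf : L2 mu f by apply: L2_le Lg _ => // x; rewrite -gn.
split=> //.
have Lf_ n : L2 mu (f_ n) by apply: L2_le Lg _ => // x; rewrite -gn.
have LB n : L2 mu (fun x => f x - f_ n x) by exact: L2B.
have Lgg : L2 mu (fun x => 2 * g x) by exact: L2Z.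
rewrite -[X in _ --> X]sqrtr0; apply: continuous_cvg; first exact: sqrt_continuous.
have : (\int[mu]_x ((f x - f_ n x) ^+ 2)%:E)%E @[n --> \oo] --> (\int[mu]_x (cst 0%E x))%E.
  apply: (@dominated_cvg _ _ _ _ _ _ _ _ (fun x => ((2 * g x) ^+ 2)%:E)) => //.
  - by move=> n; apply/measurable_EFinP/measurable_funX/measurable_funB.
  - move=> x _; apply/cvg_EFin; first exact: nearW.
    rewrite -[X in _ --> X](expr0n _ 2) -(subrr (f x)).
    by apply: cvgM; apply: cvgB => //; exact: cvg_cst.
  - by case/L2P: Lgg.
  - move=> n x _; rewrite lee_fin ger0_norm ?sqr_ge0//.
    rewrite -(real_normK (num_real _)) -[leRHS](real_normK (num_real _)).
    rewrite lerXn2r ?nnegrE// (le_trans (ler_normB _ _))//.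
    by rewrite normrM -gn ger0_norm// mulr_natl mulr2n lerD.
rewrite integral0 => h; rewrite /ip /Rintegral.
apply: (@fine_cvg _ _ _ _ _ 0).
apply: cvg_trans h; apply: near_eq_cvg; near=> n.
by apply: eq_integral => x _; rewrite expr2.
Unshelve. all: by end_near. Qed.

End dominated_L2.

(** * Density of an algebra of bounded functions *)

(** An algebra [P] of bounded functions is dense as soon as every measurable set has
    its indicator in the closure of [P].  The sets with that property form a
    sigma-algebra, and they include the sublevel sets of the functions of [P]: so it is
    enough that these generate all measurable sets. *)
Section algebra_density.
Context d (T : measurableType d) (R : realType) (mu : {measure set T -> \bar R}).
Hypothesis mufin : (mu setT < +oo)%E.
Variable P : (T -> R) -> Prop.
Hypothesis Pcst : forall c, P (fun=> c).
Hypothesis PD : forall p q, P p -> P q -> P (fun x => p x + q x).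
Hypothesis PM : forall p q, P p -> P q -> P (fun x => p x * q x).
Hypothesis Pbd : forall p, P p ->
  measurable_fun setT p /\ exists M, forall x, `|p x| <= M.
Implicit Types f g h p q : T -> R.

Definition bdd f := measurable_fun setT f /\ exists M, forall x, `|f x| <= M.

(** The closure of [P] in [L^2]. *)
Definition adherent f := L2 mu f /\
  forall e : R, 0 < e -> exists2 p, P p & nrm mu (fun x => f x - p x) <= e.

Lemma L2_cst c : L2 mu (fun=> c).
Proof.
apply/L2P; split=> //; apply: measurable_bounded_integrable => //.
exact: bounded_cst.
Qed.

Lemma bdd_L2 f : bdd f -> L2 mu f.
Proof.
move=> [mf [M fM]]; apply: (@L2_le _ _ _ _ _ (fun=> M)) => //; first exact: L2_cst.
by move=> x; rewrite (le_trans (fM x))// ler_norm.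
Qed.

Lemma bddM f g : bdd f -> bdd g -> bdd (fun x => f x * g x).
Proof.
move=> [mf [M fM]] [mg [N gN]]; split; first exact: measurable_funM.
by exists (M * N) => x; rewrite normrM ler_pM.
Qed.

Lemma bddD f g : bdd f -> bdd g -> bdd (fun x => f x + g x).
Proof.
move=> [mf [M fM]] [mg [N gN]]; split; first exact: measurable_funD.
by exists (M + N) => x; rewrite (le_trans (ler_normD _ _))// lerD.
Qed.

Lemma bdd_cst c : bdd (fun=> c).
Proof. by split=> //; exists `|c|. Qed.

Lemma adherentW f : P f -> adherent f.
Proof.
move=> Pf; split; first exact/bdd_L2/Pbd.
move=> e e0; exists f => //; rewrite /nrm /ip.
under eq_Rintegral do rewrite subrr mul0r.
by rewrite Rintegral_cst// mul0r sqrtr0 ltW.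
Qed.

Lemma adherent_closed f : L2 mu f ->
  (forall e : R, 0 < e -> exists2 g, adherent g & nrm mu (fun x => f x - g x) <= e) ->
  adherent f.
Proof.
move=> Lf h; split=> // e e0.
have e20 : 0 < e / 2 by rewrite divr_gt0.
have [g [Lg ag] fg] := h _ e20; have [p Pp gp] := ag _ e20.
exists p => //; have Lp := bdd_L2 (Pbd Pp).
rewrite (le_trans _ (_ : e / 2 + e / 2 <= e))//; last by rewrite -splitr.
apply: le_trans (lerD fg gp).
have -> : (fun x => f x - p x) = (fun x => (f x - g x) + (g x - p x)).
  by apply/funext => x; rewrite addrA subrK.
by apply: nrmD_le; exact: L2B.
Qed.

Lemma adherentD f g : adherent f -> adherent g -> adherent (fun x => f x + g x).
Proof.
move=> [Lf af] [Lg ag]; split; first exact: L2D.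
move=> e e0; have e20 : 0 < e / 2 by rewrite divr_gt0.
have [p Pp fp] := af _ e20; have [q Pq gq] := ag _ e20.
have Lp := bdd_L2 (Pbd Pp); have Lq := bdd_L2 (Pbd Pq).
exists (fun x => p x + q x); first exact: PD.
rewrite (le_trans _ (_ : e / 2 + e / 2 <= e))//; last by rewrite -splitr.
apply: le_trans (lerD fp gq).
have -> : (fun x => f x + g x - (p x + q x)) = (fun x => (f x - p x) + (g x - q x)).
  by apply/funext => x; ring.
by apply: nrmD_le; exact: L2B.
Qed.

Lemma nrm_bddM f g M : L2 mu f -> measurable_fun setT g -> (forall x, `|g x| <= M) ->
  L2 mu (fun x => g x * f x) /\ nrm mu (fun x => g x * f x) <= M * nrm mu f.
Proof.
move=> Lf mg gM.
have M0 : 0 <= M by exact: le_trans (gM point).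
have Lgf : L2 mu (fun x => g x * f x).
  apply: (@L2_le _ _ _ _ _ (fun x => M * f x)); [|exact: L2Z|].
  - by apply: measurable_funM => //; exact: L2_measurable Lf.
  - by move=> y; rewrite !normrM ler_wpM2r// (le_trans (gM y))// ler_norm.
split=> //; rewrite -[X in X * nrm _ _](ger0_norm M0) -nrmZ//.
apply: le_nrm => //; first exact: L2Z.
by move=> y; rewrite !normrM ler_wpM2r// (le_trans (gM y))// ler_norm.
Qed.

(** The factors are approximated one after the other, as the error in one factor is
    multiplied by the bound of the other. *)
Lemma adherentM f g : bdd f -> adherent f -> bdd g -> adherent g ->
  adherent (fun x => f x * g x).
Proof.
move=> [mf [M fM]] af [mg [N gN]] ag.
have M0 : forall K : R, 0 < `|K| + 1 by move=> K; rewrite ltr_wpDl.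
have mul_P p : P p -> adherent (fun x => f x * p x).
  move=> Pp; have [mp [K pK]] := Pbd Pp.
  apply: adherent_closed.
    by have [] := nrm_bddM (bdd_L2 (Pbd Pp)) mf fM.
  move=> e e0; have [q Pq fq] := af.2 _ (divr_gt0 e0 (M0 K)).
  have Lq := bdd_L2 (Pbd Pq).
  exists (fun x => q x * p x); first exact/adherentW/PM.
  have [_] := nrm_bddM (L2B af.1 Lq) mp pK.
  have -> : (fun x => p x * (f x - q x)) = (fun x => f x * p x - q x * p x).
    by apply/funext => x; ring.
  move=> /le_trans; apply.
  have K1 : K <= `|K| + 1 by rewrite (le_trans (ler_norm _))// lerDl.
  apply: le_trans (ler_wpM2r (nrm_ge0 _ _) K1) _.
  by rewrite mulrC -ler_pdivlMr.
apply: adherent_closed.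
  by have [] := nrm_bddM ag.1 mf fM.
move=> e e0; have [q Pq gq] := ag.2 _ (divr_gt0 e0 (M0 M)).
have Lq := bdd_L2 (Pbd Pq).
exists (fun x => f x * q x); first exact: mul_P.
have [_] := nrm_bddM (L2B ag.1 Lq) mf fM.
have -> : (fun x => f x * (g x - q x)) = (fun x => f x * g x - f x * q x).
  by apply/funext => x; ring.
move=> /le_trans; apply.
have K1 : M <= `|M| + 1 by rewrite (le_trans (ler_norm _))// lerDl.
apply: le_trans (ler_wpM2r (nrm_ge0 _ _) K1) _.
by rewrite mulrC -ler_pdivlMr.
Qed.

Lemma adherent_lim (f_ : nat -> T -> R) f g : L2 mu g ->
  (forall n, adherent (f_ n)) -> (forall n x, `|f_ n x| <= g x) ->
  (forall x, f_ n x @[n --> \oo] --> f x) -> adherent f.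
Proof.
move=> Lg af fg ff.
have mf_ n : measurable_fun setT (f_ n) by exact: L2_measurable (af n).1.
have mf : measurable_fun setT f.
  by apply: (measurable_fun_cvg (h := f_)) => // x _; exact: ff.
have [Lf cf] := L2_cvg mf_ mf Lg fg ff.
apply: adherent_closed => // e e0.
move/cvgrPdist_le : cf => /(_ _ e0) [N _ /(_ N (leqnn _))] h.
by exists (f_ N) => //; move: h; rewrite sub0r normrN ger0_norm// nrm_ge0.
Qed.

(** Boundedness makes the closure of [P] stable by multiplication. *)
Definition tame f := bdd f /\ adherent f.

Lemma tame_cst c : tame (fun=> c).
Proof. by split; [exact: bdd_cst|exact: adherentW]. Qed.

Lemma tameM f g : tame f -> tame g -> tame (fun x => f x * g x).
Proof. by move=> [bf af] [bg ag]; split; [exact: bddM|exact: adherentM]. Qed.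

Lemma tameD f g : tame f -> tame g -> tame (fun x => f x + g x).
Proof. by move=> [bf af] [bg ag]; split; [exact: bddD|exact: adherentD]. Qed.

Lemma tameN f : tame f -> tame (fun x => - f x).
Proof.
move=> tf; have := tameM (tame_cst (-1)) tf.
by under eq_fun do rewrite mulN1r.
Qed.

Lemma tameX f n : tame f -> tame (fun x => f x ^+ n).
Proof.
move=> tf; elim: n => [|n ih]; first exact: tame_cst.
by under eq_fun do rewrite exprS; exact: tameM.
Qed.

Lemma tame_lim (f_ : nat -> T -> R) f M :
  (forall n, tame (f_ n)) -> (forall n x, `|f_ n x| <= M) ->
  (forall x, f_ n x @[n --> \oo] --> f x) -> tame f.
Proof.
move=> tf fM ff.
have af := adherent_lim (L2_cst M) (fun n => (tf n).2) fM ff.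
split=> //; split; first exact: L2_measurable af.1.
exists M => x.
have h : (fun n => `|f_ n x|) @ \oo --> `|f x| by exact: cvg_norm (ff x).
rewrite -(cvg_lim _ h)//; apply: limr_le; first by apply/cvg_ex; eexists; exact: h.
exact: nearW.
Qed.

Definition tame_set (A : set T) := tame (\1_A : T -> R).

Lemma tame_setC A : tame_set A -> tame_set (~` A).
Proof.
move=> tA; have := tameD (tame_cst 1) (tameN tA).
rewrite /tame_set; congr tame; apply/funext => x.
by rewrite !indicE in_setC; case: (x \in A); rewrite /= ?subrr ?subr0.
Qed.

Lemma tame_setI A B : tame_set A -> tame_set B -> tame_set (A `&` B).
Proof.
move=> tA tB; have := tameM tA tB.
rewrite /tame_set; congr tame; apply/funext => x.
by rewrite !indicE in_setI; do 2 case: (x \in _); rewrite /= ?(mulr0, mulr1).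
Qed.

Lemma tame_setT : tame_set setT.
Proof.
have := tame_cst 1; rewrite /tame_set; congr tame; apply/funext => x.
by rewrite indicE in_setT.
Qed.

(** Complements and intersections are polynomials in indicators, and the indicator of a
    countable union is a bounded pointwise limit. *)
Lemma tame_sigma_algebra : sigma_algebra setT [set A | tame_set A].
Proof.
split=> /= [|A tA|A tA].
- by rewrite -setCT; exact/tame_setC/tame_setT.
- by rewrite setTD; exact: tame_setC.
have tU n : tame_set (\big[setU/set0]_(i < n) A i).
  elim: n => [|n ih].
    by rewrite big_ord0 -setCT; exact/tame_setC/tame_setT.
  rewrite big_ord_recr/= -[X in tame_set X]setCK setCU.
  by apply/tame_setC/tame_setI; exact: tame_setC.
apply: (@tame_lim (fun n => \1_(\big[setU/set0]_(i < n) A i)) _ 1) => //.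
- by move=> n x; rewrite indicE; case: (_ \in _); rewrite ?normr1 ?normr0.
- move=> x; rewrite indicE.
  have [[k _ Akx]|h] := pselect ((\bigcup_k A k) x).
    rewrite mem_set; last by exists k.
    apply: cvg_near_cst; near=> n; rewrite indicE mem_set//.
    rewrite -bigcup_mkord; exists k => //=.
    by near: n; exact: nbhs_infty_gt.
  rewrite memNset//; apply: cvg_near_cst; near=> n; rewrite indicE memNset//.
  by rewrite -bigcup_mkord => -[k /= _ Akx]; apply: h; exists k.
Unshelve. all: by end_near. Qed.

(** Bernoulli's inequality gives [1 - N a <= (1 - a) ^ N <= 1 / (1 + N a)].  For
    [a = y ^ n] and [N = n 2 ^ n] the quantity [N a = n (2 y) ^ n] tends to [0] if
    [y < 1 / 2] and is at least [n] otherwise.  Thus an indicator is a bounded limit of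
    polynomials. *)
Lemma power_threshold (y : R) : 0 <= y <= 1 ->
  (1 - y ^+ n) ^+ (n * 2 ^ n) @[n --> \oo] --> (if y < 2^-1 then 1 else 0 : R).
Proof.
move=> /andP[y0 y1].
have yn n : 0 <= y ^+ n <= 1 by rewrite exprn_ge0// exprn_ile1.
have a0 n : 0 <= 1 - y ^+ n by rewrite subr_ge0; case/andP: (yn n).
have a1 n : 1 - y ^+ n <= 1 by rewrite gerBl; case/andP: (yn n).
have bern1 (a : R) N : 0 <= a <= 1 -> 1 - N%:R * a <= (1 - a) ^+ N.
  move=> /andP[h0 h1]; elim: N => [|N ih]; first by rewrite mul0r subr0.
  have := ler_wpM2l (_ : 0 <= 1 - a) ih; rewrite subr_ge0 => /(_ h1).
  rewrite exprS; apply: le_trans.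
  have : 0 <= N%:R * a * a by rewrite !mulr_ge0.
  by rewrite -[in N.+1%:R]addn1 natrD; lra.
have bern2 (a : R) N : 0 <= a <= 1 -> (1 - a) ^+ N * (1 + N%:R * a) <= 1.
  move=> /andP[h0 h1]; have N1 : 1 + N%:R * a <= (1 + a) ^+ N.
    elim: N => [|N ih]; first by rewrite mul0r addr0.
    have := ler_wpM2l (_ : 0 <= 1 + a) ih; rewrite addr_ge0// => /(_ isT).
    rewrite exprS; apply: le_trans.
    have : 0 <= N%:R * a * a by rewrite !mulr_ge0.
    by rewrite -[in N.+1%:R]addn1 natrD; lra.
  have h2 : 0 <= (1 - a) ^+ N by rewrite exprn_ge0// subr_ge0.
  apply: le_trans (ler_wpM2l h2 N1) _.
  rewrite -exprMn exprn_ile1//; first by rewrite mulr_ge0 ?subr_ge0 ?addr_ge0.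
  have : 0 <= a * a by rewrite mulr_ge0.
  by lra.
case: ifPn => [yh|].
  apply: (@squeeze_cvgr _ _ _ _ (fun n => 1 - n%:R * (2 * y) ^+ n) (cst 1)).
  - near=> n; rewrite exprn_ile1// ?andbT//.
    apply: le_trans (bern1 _ _ (yn n)).
    by rewrite natrM natrX exprMn mulrA.
  - rewrite -[X in _ --> X]subr0; apply: cvgB; first exact: cvg_cst.
    by apply: mulrn_exp_cvg0; rewrite mulr_ge0//=; lra.
  - exact: cvg_cst.
rewrite -leNgt => yh.
apply: (@squeeze_cvgr _ _ _ _ (cst 0) (@harmonic R)).
- near=> n; rewrite exprn_ge0//= /harmonic -[leRHS]mul1r ler_pdivlMr ?ltr0n//.
  apply: le_trans (bern2 _ _ (yn n)); apply: ler_wpM2l; first exact: exprn_ge0.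
  rewrite -addn1 natrD addrC lerD2l natrM natrX -mulrA -exprMn ler_peMr//.
  by apply: exprn_ege1; lra.
- exact: cvg_cst.
- exact: cvg_harmonic.
Unshelve. all: by end_near. Qed.

(** An affine map sends the range of [f] into [[0, 1]] and [c] to [1 / 2], where
    [power_threshold] cuts. *)
Lemma tame_sublevel f c : tame f -> tame_set [set x | f x < c].
Proof.
move=> tf; have [_ [M fM]] := tf.1.
pose K := `|M| + `|c| + 1.
have K0 : 0 < K by rewrite ltr_wpDl// addr_ge0.
have fcK x : `|f x - c| <= K.
  rewrite (le_trans (ler_normB _ _))// (le_trans (lerD (fM x) (lexx _)))//.
  by rewrite /K -addrA lerD ?ler_norm// lerDl.
pose y x := (f x - c) / (2 * K) + 2^-1.
have y01 x : 0 <= y x <= 1.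
  have := fcK x; rewrite ler_norml => /andP[h1 h2].
  have -> : y x = (f x - c + K) / (2 * K) by rewrite /y; field; lra.
  rewrite divr_ge0 ?ler_pdivrMr; lra.
have ty : tame y.
  rewrite /y; apply: tameD; last exact: tame_cst.
  by apply: tameM; [apply: tameD => //|]; exact: tame_cst.
apply: (@tame_lim (fun n x => (1 - y x ^+ n) ^+ (n * 2 ^ n)) _ 1).
- move=> n; apply: tameX; apply: tameD; first exact: tame_cst.
  by apply/tameN/tameX.
- move=> n x; have /andP[y0 y1] := y01 x.
  have h1 : 0 <= 1 - y x ^+ n by rewrite subr_ge0 exprn_ile1.
  rewrite ger0_norm ?exprn_ge0// exprn_ile1//.
  by rewrite gerBl exprn_ge0.
- move=> x; have := power_threshold (y01 x).
  have -> : (y x < 2^-1) = (f x < c).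
    by rewrite /y gtrDr pmulr_llt0 ?invr_gt0 ?mulr_gt0// subr_lt0.
  congr (_ --> _); rewrite indicE.
  case: ifPn => h; first by rewrite mem_set.
  by rewrite memNset//=; exact/negP.
Qed.

Import HBNNSimple.

Lemma adherent_sum (I : Type) (s : seq I) (F : I -> T -> R) :
  (forall i, adherent (F i)) -> adherent (fun x => \sum_(i <- s) F i x).
Proof.
move=> h; elim: s => [|i s ih].
  by under eq_fun do rewrite big_nil; exact: (tame_cst 0).2.
by under eq_fun do rewrite big_cons; exact: adherentD.
Qed.

(** Nonnegative functions are dominated limits of simple ones. *)
Lemma adherent_L2 f : (forall A : set T, measurable A -> tame_set A) ->
  L2 mu f -> adherent f.
Proof.
move=> tame_all.
have adherentZ c g : adherent g -> adherent (fun x => c * g x).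
  move=> ag; apply: adherent_closed; first exact: L2Z ag.1.
  move=> e e0; have c0 : 0 < `|c| + 1 by rewrite ltr_wpDl.
  have [p Pp gp] := ag.2 _ (divr_gt0 e0 c0).
  exists (fun x => c * p x); first by apply/adherentW/PM.
  have Lp := bdd_L2 (Pbd Pp); have LB := L2B ag.1 Lp.
  have -> : (fun x => c * g x - c * p x) = (fun x => c * (g x - p x)).
    by apply/funext => x; rewrite mulrBr.
  rewrite nrmZ// (le_trans (_ : _ <= (`|c| + 1) * nrm mu (fun x => g x - p x)))//.
    by rewrite ler_wpM2r ?nrm_ge0// lerDl.
  by rewrite mulrC -ler_pdivlMr.
have nneg g : L2 mu g -> (forall x, 0 <= g x) -> adherent g.
  move=> Lg g0; have mg := L2_measurable Lg.
  have mg' : measurable_fun setT (EFin \o g) by exact/measurable_EFinP.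
  have g0' x : setT x -> (0 <= (EFin \o g) x)%E by rewrite lee_fin.
  pose g_ := nnsfun_approx measurableT mg'.
  apply: (@adherent_lim (fun n => g_ n) g g) => //.
  - move=> n; rewrite (_ : (g_ n : T -> R) = fun x =>
        \sum_(y <- finmap.enum_fset (fset_set (range (g_ n)))) y * \1_(g_ n @^-1` [set y]) x).
      apply: adherent_sum => y; apply: adherentZ.
      exact: (tame_all _ _).2.
    by apply/funext => x; rewrite {1}fimfunE fsbig_finite.
  - move=> n x; rewrite ger0_norm; last by rewrite /g_.
    by rewrite -lee_fin /g_ nnsfun_approxE; exact: (le_approx _ g0').
  - move=> x; have h := cvg_nnsfun_approx measurableT mg' g0' (I : setT x).
    exact: (@fine_cvg _ _ _ _ (fun n => (g_ n x)%:E) (g x) h).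
move=> Lf.
have Lpart g : measurable_fun setT g -> (forall x, `|g x| <= `|f x|) -> L2 mu g.
  by move=> mg gf; exact: L2_le Lf gf.
have mf := L2_measurable Lf.
have Lpos : L2 mu f^\+.
  apply: Lpart; first exact: measurable_funrpos.
  move=> x; rewrite -[leRHS](congr1 (@^~ x) (funrposDneg f)).
  by rewrite ger0_norm ?funrpos_ge0//= lerDl funrneg_ge0.
have Lneg : L2 mu f^\-.
  apply: Lpart; first exact: measurable_funrneg.
  move=> x; rewrite -[leRHS](congr1 (@^~ x) (funrposDneg f)).
  by rewrite ger0_norm ?funrneg_ge0//= lerDr funrpos_ge0.
have -> : f = (fun x => f^\+ x + (-1) * f^\- x).
  by rewrite -[LHS]funrposBneg; apply/funext => x; rewrite mulN1r.
apply: adherentD; [apply: nneg => //|apply/adherentZ/nneg => //].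
Qed.

End algebra_density.

(** * Trigonometric polynomials *)

Section trigonometric_polynomials.
Variable R : realType.
Local Notation torus := (torus_measure R).
Local Notation X := (measurableTypeR R * measurableTypeR R * measurableTypeR R)%type.
Implicit Types (k l : wavevector) (s : seq (wavevector * (R * R))).
Implicit Types (p q : R * R * R -> R).

Definition trigpoly s (x : R * R * R) : R :=
  \sum_(t <- s) (t.2.1 * cosk t.1 x + t.2.2 * sink t.1 x).

Definition trigonometric p := exists s, p = trigpoly s.

Lemma phaseD k l (x : R * R * R) : phase (k + l) x = phase k x + phase l x.
Proof.
rewrite /phase -big_split; apply: eq_bigr => i _.
by rewrite ffunE rmorphD/= mulrDl.
Qed.

Lemma phaseN k (x : R * R * R) : phase (- k) x = - phase k x.
Proof.
rewrite /phase -sumrN; apply: eq_bigr => i _.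
by rewrite ffunE rmorphN/= mulNr.
Qed.

Lemma phase0 (x : R * R * R) : phase 0 x = 0.
Proof. by rewrite /phase big1// => i _; rewrite ffunE mul0r. Qed.

Lemma trigonometric_mono k a b : trigonometric (fun x => a * cosk k x + b * sink k x).
Proof. by exists [:: (k, (a, b))]; apply/funext => x; rewrite /trigpoly big_seq1. Qed.

Lemma trigonometricD p q : trigonometric p -> trigonometric q ->
  trigonometric (fun x => p x + q x).
Proof.
move=> [s ->] [s' ->]; exists (s ++ s'); apply/funext => x.
by rewrite /trigpoly big_cat.
Qed.

Lemma trigonometric_cst c : trigonometric (fun=> c).
Proof.
have := trigonometric_mono 0 c 0; congr trigonometric; apply/funext => x.
by rewrite /cosk /sink phase0 cos0 sin0 mulr1 mul0r addr0.
Qed.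

Lemma trigonometric_sum (I : Type) (r : seq I) (F : I -> R * R * R -> R) :
  (forall i, trigonometric (F i)) -> trigonometric (fun x => \sum_(i <- r) F i x).
Proof.
move=> h; elim: r => [|i r ih].
  by under eq_fun do rewrite big_nil; exact: trigonometric_cst.
by under eq_fun do rewrite big_cons; exact: trigonometricD.
Qed.

Lemma cosk_cosk k l x : cosk k x * cosk l x =
  2^-1 * @cosk R (k - l) x + 2^-1 * cosk (k + l) x.
Proof. by rewrite /cosk !phaseD phaseN cosB cosD; field. Qed.

Lemma sink_sink k l x : sink k x * sink l x =
  2^-1 * @cosk R (k - l) x - 2^-1 * cosk (k + l) x.
Proof. by rewrite /cosk /sink !phaseD phaseN cosB cosD; field. Qed.

Lemma sink_cosk k l x : sink k x * cosk l x =
  2^-1 * @sink R (k - l) x + 2^-1 * sink (k + l) x.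
Proof. by rewrite /cosk /sink !phaseD phaseN sinB sinD; field. Qed.

Lemma trigonometricM p q : trigonometric p -> trigonometric q ->
  trigonometric (fun x => p x * q x).
Proof.
move=> [s ->] [s' ->].
have -> : (fun x => trigpoly s x * trigpoly s' x) =
  (fun x => \sum_(t <- s) \sum_(u <- s')
     (t.2.1 * cosk t.1 x + t.2.2 * sink t.1 x) *
     (u.2.1 * cosk u.1 x + u.2.2 * sink u.1 x)).
  apply/funext => x; rewrite /trigpoly big_distrl; apply: eq_bigr => t _.
  by rewrite big_distrr.
apply: trigonometric_sum => -[k [a b]]; apply: trigonometric_sum => -[l [a' b']] /=.
have -> : (fun x => (a * cosk k x + b * sink k x) * (a' * cosk l x + b' * sink l x)) =
   (fun x => ((2^-1 * a * a' + 2^-1 * b * b') * @cosk R (k - l) x +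
     (2^-1 * b * a' - 2^-1 * a * b') * sink (k - l) x) +
     ((2^-1 * a * a' - 2^-1 * b * b') * cosk (k + l) x +
     (2^-1 * b * a' + 2^-1 * a * b') * sink (k + l) x)).
  by apply/funext => x; rewrite /cosk /sink !phaseD !phaseN cosB cosD sinB sinD; field.
by apply: trigonometricD; exact: trigonometric_mono.
Qed.

Lemma measurable_xcoord (i : 'I_3) : measurable_fun [set: X] (fun x => xcoord x i).
Proof.
case: i => [[|[|[|//]]] i3]; rewrite /xcoord/=.
- exact: measurableT_comp.
- exact: measurableT_comp.
- exact: measurable_snd.
Qed.

Lemma measurable_phase k : measurable_fun [set: X] (phase k).
Proof.
apply: measurable_sum => i; apply: measurable_funM => //.
exact: measurable_xcoord.
Qed.

Lemma bdd_trigonometric p : trigonometric p ->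
  measurable_fun [set: X] p /\ exists M, forall x, `|p x| <= M.
Proof.
move=> [s ->]; rewrite -/(bdd _); elim: s => [|[k [a b]] s ih].
  have -> : trigpoly [::] = fun=> 0 by apply/funext => x; rewrite /trigpoly big_nil.
  exact: bdd_cst.
have -> : trigpoly ((k, (a, b)) :: s) =
    fun x => (a * cosk k x + b * sink k x) + trigpoly s x.
  by apply/funext => x; rewrite /trigpoly big_cons.
apply: bddD => //; apply: bddD; apply: bddM; try exact: bdd_cst.
- split; last by exists 1 => x; exact: cos_max.
  apply: measurableT_comp (measurable_phase k).
  by apply: continuous_measurable_fun; exact: continuous_cos.
- split; last by exists 1 => x; exact: sin_max.
  apply: measurableT_comp (measurable_phase k).
  by apply: continuous_measurable_fun; exact: continuous_sin.
Qed.

Lemma torus_fin : (torus setT < +oo)%E.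
Proof. by rewrite torus_measureT ltry. Qed.

Lemma L2_trigonometric p : trigonometric p -> L2 torus p.
Proof. by move=> /bdd_trigonometric; exact: bdd_L2 torus_fin _. Qed.

Local Notation tame := (tame torus trigonometric).
Local Notation tame_set := (tame_set torus trigonometric).

Let tameZ c f : tame f -> tame (fun x => c * f x).
Proof.
move=> tf; apply: (tameM torus_fin trigonometricM bdd_trigonometric) tf.
exact: (tame_cst torus_fin trigonometric_cst bdd_trigonometric).
Qed.

Lemma tame_trigonometric p : trigonometric p -> tame p.
Proof.
move=> tp; split; first exact: bdd_trigonometric.
exact: (adherentW torus_fin bdd_trigonometric).
Qed.

Lemma eq_torus_integral (f g : X -> R) :
  measurable_fun setT f -> measurable_fun setT g ->
  (forall x, cell R x -> f x = g x) -> \int[torus]_x f x = \int[torus]_x g x.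
Proof.
move=> mf mg fg; rewrite /Rintegral !torus_integralE; try exact/measurable_EFinP.
by congr fine; apply: eq_integral => x /set_mem /fg ->.
Qed.

(** Functions that agree on the cell are equal almost everywhere on the torus, but a
    description in terms of sines and cosines can only hold on the cell. *)
Lemma tame_eq_cell (f g : X -> R) : tame f -> bdd g ->
  (forall x, cell R x -> f x = g x) -> tame g.
Proof.
move=> [bf [Lf af]] bg fg; split=> //.
split=> [|e /af[p tp fp]]; first exact: (bdd_L2 torus_fin bg).
exists p => //; rewrite (le_trans _ fp)// /nrm /ip.
have [mp _] := bdd_trigonometric tp.
rewrite le_eqVlt (@eq_torus_integral _ (fun x => (f x - p x) * (f x - p x))) ?eqxx//.
- by apply: measurable_funM; apply: measurable_funB => //; exact: bg.1.
- by apply: measurable_funM; apply: measurable_funB => //; exact: bf.1.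
- by move=> x /fg ->.
Qed.

Lemma bdd_indic (A : set X) : measurable A -> bdd (\1_A : X -> R).
Proof.
move=> mA; split; first exact: measurable_indic.
by exists 1 => x; rewrite indicE; case: (_ \in _); rewrite ?normr1 ?normr0.
Qed.

Lemma tame_set_eq_cell (A B : set X) : tame_set A -> measurable B ->
  A `&` cell R = B `&` cell R -> tame_set B.
Proof.
move=> tA mB AB; apply: tame_eq_cell tA _ _; first exact: bdd_indic.
move=> x cx; rewrite !indicE; congr (nat_of_bool _)%:R.
have [Ax|nAx] := pselect (A x).
  have [Bx _] : (B `&` cell R) x by rewrite -AB.
  by rewrite !mem_set.
have nBx : ~ B x by move=> Bx; have [] : (A `&` cell R) x by rewrite AB.
by rewrite !memNset.
Qed.

Lemma cell_xcoord (x : R * R * R) i : cell R x -> 0 <= xcoord x i < 2 * pi.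
Proof.
move=> [[]]; case: i => [[|[|[|//]]] i3]; rewrite /xcoord/= !in_itv//=.
Qed.

Definition unit_wave (i : 'I_3) : wavevector := [ffun j => (j == i)%:Z].

Lemma phase_unit_wave i (x : R * R * R) : phase (unit_wave i) x = xcoord x i.
Proof.
rewrite /phase (bigD1 i)//= ffunE eqxx mul1r big1 ?addr0// => j ji.
by rewrite ffunE (negbTE ji) mul0r.
Qed.

Lemma sin_lt0_period (y : R) : 0 <= y < 2 * pi -> (sin y < 0) = (pi < y).
Proof.
move=> /andP[y0 y2]; case: (ltP pi y) => yp.
  have -> : sin y = - sin (y - pi) by rewrite -(sinDpi (y - pi)) subrK.
  by rewrite oppr_lt0 sin_gt0_pi// subr_gt0 yp/=; lra.
by apply/negbTE; rewrite -leNgt sin_ge0_pi// y0.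
Qed.

Lemma cos_gt_upper (a y : R) : 0 <= a <= pi -> 0 <= y <= pi -> (cos a < cos y) = (y < a).
Proof. by move=> ha hy; rewrite ltr_cos// in_itv. Qed.

Lemma cos_lt_lower (a y : R) : pi <= a <= 2 * pi -> pi <= y <= 2 * pi ->
  (cos y < cos a) = (y < a).
Proof.
have c (z : R) : cos z = cos (2 * pi - z).
  by rewrite -cosN -(cosD2pi (- z)); congr cos; ring.
move=> ha hy; rewrite (c y) (c a) cos_gt_upper; [|lra..].
by rewrite ltrD2l ltrN2.
Qed.

(** A coordinate is not a continuous function on the torus.  On the cell, however, the
    sign of its sine tells in which half of the period it lies, and the cosine is
    monotone on either half. *)
Lemma tame_xcoord_lt i (a : R) : tame_set [set x | xcoord x i < a].
Proof.
have mA : measurable [set x : X | xcoord x i < a].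
  rewrite (_ : [set x : X | _] = (fun x => xcoord x i) @^-1` `]-oo, a[).
    by rewrite -[X in measurable X]setTI; exact: measurable_xcoord.
  by apply/seteqP; split=> x; rewrite /= in_itv.
have sl f c : tame f -> tame_set [set x | f x < c].
  exact: (tame_sublevel torus_fin trigonometric_cst trigonometricD trigonometricM
    bdd_trigonometric).
have tC A : tame_set A -> tame_set (~` A).
  exact: (tame_setC torus_fin trigonometric_cst trigonometricD trigonometricM
    bdd_trigonometric).
have tI A B : tame_set A -> tame_set B -> tame_set (A `&` B).
  exact: (tame_setI torus_fin trigonometricM bdd_trigonometric).
have tT : tame_set setT by exact: (tame_setT torus_fin trigonometric_cst bdd_trigonometric).
have tcos : tame (fun x => cos (xcoord x i)).
  have := tame_trigonometric (trigonometric_mono (unit_wave i) 1 0).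
  by congr tame; apply/funext => x; rewrite /cosk phase_unit_wave mul1r mul0r addr0.
have tsin : tame (fun x => sin (xcoord x i)).
  have := tame_trigonometric (trigonometric_mono (unit_wave i) 0 1).
  by congr tame; apply/funext => x; rewrite /sink phase_unit_wave mul1r mul0r add0r.
have tS := sl _ 0 tsin.
have pi0 : 0 < pi :> R := pi_gt0 R.
have [a0|a0] := leP a 0.
  apply: (tame_set_eq_cell (tC _ tT)) => //; apply/seteqP; split=> x /= [].
    by move=> /(_ I).
  by move=> xa /(@cell_xcoord _ i) /andP[x0 _]; lra.
have [a2|a2] := leP (2 * pi) a.
  apply: (tame_set_eq_cell tT) => //; apply/seteqP; split=> x /= [] // _ cx.
  by split=> //; have /andP[_ x2] := cell_xcoord i cx; lra.
have [ap|ap] := leP a pi.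
  have tneg := sl _ (- cos a) (tameZ (-1) tcos).
  apply: (tame_set_eq_cell (tI _ _ tneg (tC _ tS))) => //.
  apply/seteqP; split=> x /= [h cx]; split=> //;
    have xi := cell_xcoord i cx; have /andP[x0 x2] := xi; move: h;
    rewrite mulN1r ltrN2 (sin_lt0_period xi).
    by move=> [h /negP]; rewrite -leNgt => xp; rewrite -cos_gt_upper//; lra.
  by move=> xa; split; [rewrite cos_gt_upper//; lra|apply/negP; lra].
have tlt := sl _ (cos a) tcos.
apply: (tame_set_eq_cell (tC _ (tI _ _ tS (tC _ tlt)))) => //.
apply/seteqP; split=> x /= [h cx]; split=> //;
  have xi := cell_xcoord i cx; have /andP[x0 x2] := xi; move: h;
  rewrite (sin_lt0_period xi).
  move=> h; rewrite ltNge; apply/negP => ax; apply: h; split; first by lra.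
  by apply/negP; rewrite cos_lt_lower; lra.
by move=> xa [px]; apply; rewrite cos_lt_lower//; lra.
Qed.

Lemma sigma_algebra_preimage_class (T U : Type) (f : T -> U) (G : set (set T)) :
  sigma_algebra setT G -> sigma_algebra setT [set B | G (f @^-1` B)].
Proof.
move=> [G0 GC GU]; split => /=.
- by rewrite preimage_set0.
- by move=> B; rewrite setTD preimage_setC => /GC; rewrite setTD.
- by move=> B GB; rewrite preimage_bigcup; exact: GU.
Qed.

(** Half-spaces orthogonal to the axes generate the product sigma-algebra. *)
Lemma tame_measurable (A : set X) : measurable A -> tame_set A.
Proof.
have sT : sigma_algebra setT [set A | tame_set A].
  exact: (tame_sigma_algebra torus_fin trigonometric_cst trigonometricD trigonometricM
    bdd_trigonometric).
have tI A' B' : tame_set A' -> tame_set B' -> tame_set (A' `&` B').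
  exact: (tame_setI torus_fin trigonometricM bdd_trigonometric).
have ray i (B : set (measurableTypeR R)) : measurable B ->
    tame_set ((fun x => xcoord x i) @^-1` B).
  rewrite RGenInftyO.measurableE.
  suff /(_ B) : <<s @RGenInftyO.G R >> `<=`
      [set B | tame_set ((fun x => xcoord x i) @^-1` B)] by [].
  apply: smallest_sub; first exact: sigma_algebra_preimage_class.
  move=> _ [a ->] /=; have := tame_xcoord_lt i a.
  by congr tame_set; apply/seteqP; split => x; rewrite /= in_itv.
have two (B : set (measurableTypeR R * measurableTypeR R)%type) : measurable B ->
    tame_set (fst @^-1` B).
  rewrite measurable_prod_measurableType; set G := (G in <<s G >>).
  suff /(_ B) : <<s G >> `<=` [set B | tame_set (fst @^-1` B)] by [].
  apply: smallest_sub; first exact: sigma_algebra_preimage_class.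
  move=> _ [B1 mB1 [B2 mB2 <-]] /=.
  exact: (tI _ _ (ray (@Ordinal 3 0 isT) _ mB1) (ray (@Ordinal 3 1 isT) _ mB2)).
rewrite measurable_prod_measurableType; set G := (G in <<s G >>).
suff /(_ A) : <<s G >> `<=` [set A | tame_set A] by [].
apply: smallest_sub => //.
move=> _ [B1 mB1 [B2 mB2 <-]] /=.
exact: (tI _ _ (two _ mB1) (ray (@Ordinal 3 2 isT) _ mB2)).
Qed.

Theorem trigonometric_dense (f : X -> R) (e : R) : L2 torus f -> 0 < e ->
  exists2 p, trigonometric p & nrm torus (fun x => f x - p x) <= e.
Proof.
move=> Lf e0; have [_ h] := adherent_L2 torus_fin trigonometric_cst trigonometricD
  trigonometricM bdd_trigonometric tame_measurable Lf.
exact: h.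
Qed.

(** The source of all [L^2] bounds below: the functions to be bounded, such as a weak
    gradient or a limit of fields, are known through their integrals against
    trigonometric polynomials. *)
Lemma nrm_dual_le (f : X -> R) (B : R) : L2 torus f -> 0 <= B ->
  (forall p, trigonometric p -> ip torus f p <= B * nrm torus p) ->
  nrm torus f <= B.
Proof.
move=> Lf B0 fB; set n := nrm torus f.
have n0 : 0 <= n by exact: nrm_ge0.
have [->//|fn0] := eqVneq n 0.
have np : 0 < n by rewrite lt_neqAle eq_sym fn0.
rewrite -(ler_pM2r np) -expr2; apply/ler_addgt0Pr => e e0.
have Bn : 0 < B + n by rewrite ltr_wpDl.
(* For [p] close to [f] the pairing of [f] with [p] is close to the square of the norm
   of [f]; the error [d (B + n)] of the estimate is [e]. *)
have [p tp fp] := trigonometric_dense Lf (divr_gt0 e0 Bn).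
set d := e / _ in fp.
have Lp := L2_trigonometric tp.
have LB := L2B Lf Lp.
have pd : nrm torus p <= n + d.
  have -> : p = (fun x => f x - (f x - p x)) by apply/funext => x; ring.
  by rewrite (le_trans (nrmB_le _ _))// lerD.
have : n ^+ 2 = ip torus f p + ip torus f (fun x => f x - p x).
  rewrite -ipDr// nrm_sqr; congr ip; apply/funext => x; ring.
have h1 := fB _ tp.
have h2 := le_trans (ler_norm _) (Cauchy_Schwarz Lf LB).
have h3 := ler_wpM2l B0 pd.
have h4 := ler_wpM2l n0 fp.
have h5 : d * (B + n) = e by rewrite /d divfK// gt_eqF.
move: h1 h2 h3 h4 h5; rewrite -/n; lra.
Qed.

End trigonometric_polynomials.

(** * Littlewood-Paley blocks *)

Section littlewood_paley.
Variable R : realType.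
Local Notation torus := (torus_measure R).
Local Notation V := (volume R).
Local Notation X := (measurableTypeR R * measurableTypeR R * measurableTypeR R)%type.
Local Notation ip := (ip torus).
Local Notation nrm := (nrm torus).
Implicit Types (k l : wavevector).

Lemma L2_cosk k : L2 torus (cosk k).
Proof.
apply: L2_trigonometric; have := @trigonometric_mono R k 1 0.
by congr (trigonometric _); apply/funext => x; rewrite mul1r mul0r addr0.
Qed.

Lemma L2_sink k : L2 torus (sink k).
Proof.
apply: L2_trigonometric; have := @trigonometric_mono R k 0 1.
by congr (trigonometric _); apply/funext => x; rewrite mul1r mul0r add0r.
Qed.

Lemma L2_integrable (f : X -> R) : L2 torus f -> torus.-integrable setT (EFin \o f).
Proof.
move=> Lf; have := L2_mul Lf (L2_cst (torus_fin R) 1).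
by apply: eq_integrable => // x _ /=; rewrite mulr1.
Qed.

Lemma torus_integralD (a b : R) (f g : X -> R) : L2 torus f -> L2 torus g ->
  \int[torus]_x (a * f x + b * g x) = a * \int[torus]_x f x + b * \int[torus]_x g x.
Proof.
move=> Lf Lg; rewrite RintegralD//; [|exact/L2_integrable/L2Z..].
by rewrite !RintegralZl//; exact: L2_integrable.
Qed.

Lemma ip_cosk_cosk k l : ip (cosk k) (cosk l) = V / 2 * ((k == l)%:R + (k == - l)%:R).
Proof.
rewrite /ip; under eq_Rintegral do rewrite cosk_cosk.
rewrite torus_integralD; try exact: L2_cosk.
rewrite !(mean_cosk_sink _ _).1 subr_eq0 addr_eq0.
by do 2 case: ifP => _; rewrite /=; field.
Qed.

Lemma ip_sink_sink k l : ip (sink k) (sink l) = V / 2 * ((k == l)%:R - (k == - l)%:R).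
Proof.
rewrite /ip; under eq_Rintegral do rewrite sink_sink -mulNr.
rewrite torus_integralD; try exact: L2_cosk.
rewrite !(mean_cosk_sink _ _).1 subr_eq0 addr_eq0.
by do 2 case: ifP => _; rewrite /=; field.
Qed.

Lemma ip_sink_cosk k l : ip (sink k) (cosk l) = 0.
Proof.
rewrite /ip; under eq_Rintegral do rewrite sink_cosk.
rewrite torus_integralD; try exact: L2_sink.
by rewrite !(mean_cosk_sink _ _).2 !mulr0 addr0.
Qed.

Lemma ip_cosk_sink k l : ip (cosk k) (sink l) = 0.
Proof. by rewrite ipC ip_sink_cosk. Qed.

(** The wave vectors of a cube that contains the ball of radius [N]. *)
Definition modes (N : nat) : seq wavevector :=
  [seq ([ffun i => (f i : nat)%:Z - N%:Z] : wavevector) | f : {ffun 'I_3 -> 'I_(2 * N).+1}].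

Lemma uniq_modes N : uniq (modes N).
Proof.
rewrite map_inj_uniq ?enum_uniq// => f g fg; apply/ffunP => i.
move/ffunP/(_ i) : fg; rewrite !ffunE => /(addIr _) [] h; exact: val_inj.
Qed.

Lemma mem_modes N k : (forall i, `|k i| <= N%:Z) -> k \in modes N.
Proof.
move=> kN; apply/mapP.
have bd i : (absz (k i + N%:Z)%R < (2 * N).+1)%N.
  by have := kN i; lia.
exists [ffun i => Ordinal (bd i)]; first by rewrite mem_enum.
apply/ffunP => i; rewrite !ffunE /=; have := kN i; lia.
Qed.

Lemma wavenumber_ge0 k : 0 <= wavenumber R k.
Proof. exact: sqrtr_ge0. Qed.

Lemma wavenumberN k : wavenumber R (- k) = wavenumber R k.
Proof.
by rewrite /wavenumber; congr Num.sqrt; apply: eq_bigr => i _; rewrite ffunE rmorphN/= sqrrN.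
Qed.

Lemma le_wavenumber k i : `|(k i)%:~R| <= wavenumber R k.
Proof.
rewrite -sqrtr_sqr ler_wsqrtr// (bigD1 i)//= lerDl sumr_ge0// => j _.
exact: sqr_ge0.
Qed.

Lemma wavenumber_modes N k : wavenumber R k <= N%:R -> k \in modes N.
Proof.
move=> kN; apply: mem_modes => i; have := le_trans (le_wavenumber k i) kN.
by rewrite -intr_norm -[X in _ <= X]/((N%:Z)%:~R) ler_int.
Qed.

Definition synth N (a b : wavevector -> R) (x : R * R * R) : R :=
  \sum_(l <- modes N) (a l * cosk l x + b l * sink l x).

Lemma trigonometric_synth N a b : trigonometric (synth N a b).
Proof. by apply: trigonometric_sum => k; exact: trigonometric_mono. Qed.

Lemma sum_modes_delta N (F : wavevector -> R) k : (k \notin modes N -> F k = 0) ->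
  \sum_(l <- modes N) F l * (l == k)%:R = F k.
Proof.
move=> Fk; have [kN|kN] := boolP (k \in modes N).
  rewrite (bigD1_seq k)//= ?uniq_modes// eqxx mulr1 big1 ?addr0// => l /negbTE ->.
  by rewrite mulr0.
rewrite Fk// big1_seq// => l /andP[_ lN]; case: eqP => [lk|_]; last by rewrite mulr0.
by rewrite -lk lN in kN.
Qed.

(** The parities say that the coefficients are those of a real function.  Each wave is
    then listed twice, as [k] and [- k], which turns the constant [V / 2] of
    [ip_cosk_cosk] into [V]. *)
Section synth.
Variables (N : nat) (a b : wavevector -> R).
Hypothesis a_even : forall k, a (- k) = a k.
Hypothesis b_odd : forall k, b (- k) = - b k.
Hypothesis aN : forall k, k \notin modes N -> a k = 0.
Hypothesis bN : forall k, k \notin modes N -> b k = 0.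

Let L2_term l : L2 torus (fun x => a l * cosk l x + b l * sink l x).
Proof. by apply: L2D; apply: L2Z; [exact: L2_cosk|exact: L2_sink]. Qed.

Lemma ip_synth f : L2 torus f -> ip (synth N a b) f =
  \sum_(l <- modes N) (a l * ip (cosk l) f + b l * ip (sink l) f).
Proof.
move=> Lf; rewrite ip_suml//; apply: eq_bigr => l _.
rewrite ipDl//; try by apply: L2Z; [exact: L2_cosk||exact: L2_sink].
by rewrite !ipZl//; [exact: L2_sink|exact: L2_cosk].
Qed.

Lemma ip_synth_cosk k : ip (synth N a b) (cosk k) = V * a k.
Proof.
rewrite ip_synth; last exact: L2_cosk.
transitivity (V / 2 * (\sum_(l <- modes N) a l * (l == k)%:R +
  \sum_(l <- modes N) a l * (l == - k)%:R)).
  rewrite -big_split/= big_distrr/=; apply: eq_bigr => l _.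
  by rewrite ip_cosk_cosk ip_sink_cosk; ring.
rewrite !sum_modes_delta; [|exact: aN..].
by rewrite a_even; field.
Qed.

Lemma ip_synth_sink k : ip (synth N a b) (sink k) = V * b k.
Proof.
rewrite ip_synth; last exact: L2_sink.
transitivity (V / 2 * (\sum_(l <- modes N) b l * (l == k)%:R -
  \sum_(l <- modes N) b l * (l == - k)%:R)).
  rewrite -sumrB big_distrr/=; apply: eq_bigr => l _.
  by rewrite ip_sink_sink ip_cosk_sink; ring.
rewrite !sum_modes_delta; [|exact: bN..].
by rewrite b_odd; field.
Qed.

Lemma nrm_synth_sqr : nrm (synth N a b) ^+ 2 =
  V * \sum_(l <- modes N) (a l ^+ 2 + b l ^+ 2).
Proof.
have LS : L2 torus (synth N a b) by apply: L2_sum => l; exact: L2_term.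
rewrite nrm_sqr ip_synth// big_distrr/=; apply: eq_bigr => l _.
rewrite (ipC torus (cosk l)) (ipC torus (sink l)).
by rewrite ip_synth_cosk ip_synth_sink; ring.
Qed.

End synth.

Lemma ip_trigpolyr f s : L2 torus f -> ip f (trigpoly s) =
  \sum_(t <- s) (t.2.1 * ip f (cosk t.1) + t.2.2 * ip f (sink t.1)).
Proof.
move=> Lf; rewrite ipC ip_suml//; last first.
  by move=> t; apply: L2D; apply: L2Z; [exact: L2_cosk|exact: L2_sink].
apply: eq_bigr => t _.
rewrite ipDl//; try by apply: L2Z; [exact: L2_cosk||exact: L2_sink].
rewrite !ipZl//; [|exact: L2_sink|exact: L2_cosk].
by rewrite !(ipC torus f).
Qed.

Lemma coskN k x : cosk (- k) x = @cosk R k x.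
Proof. by rewrite /cosk phaseN cosN. Qed.

Lemma sinkN k x : sink (- k) x = - @sink R k x.
Proof. by rewrite /sink phaseN sinN. Qed.

Lemma fourier_cosE (f : X -> R) k : fourier_cos f k = V^-1 * ip f (cosk k).
Proof. by []. Qed.

Lemma fourier_sinE (f : X -> R) k : fourier_sin f k = V^-1 * ip f (sink k).
Proof. by []. Qed.

Lemma lp_lambda_gt0 q : 0 < lp_lambda R q.
Proof. by rewrite exprn_gt0. Qed.

Lemma lp_lambda_le m n : (m <= n)%N -> lp_lambda R m <= lp_lambda R n.
Proof. by move=> mn; rewrite ler_weXn2l// ler1n. Qed.

Definition bandlimited n (s : seq (wavevector * (R * R))) :=
  forall t, t \in s -> wavenumber R t.1 <= lp_lambda R n.

Lemma bandlimited_le m n s : (m <= n)%N -> bandlimited m s -> bandlimited n s.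
Proof. by move=> mn h t /h /le_trans; apply; exact: lp_lambda_le. Qed.

Lemma trigpoly_bandlimited s : exists n, bandlimited n s.
Proof.
elim: s => [|t s [m hm]]; first by exists 0%N.
exists (maxn m (Num.bound (wavenumber R t.1))) => u.
rewrite inE => /orP[/eqP ->|]; last by apply: bandlimited_le hm _; exact: leq_maxl.
have h1 : wavenumber R t.1 <= lp_lambda R (Num.bound (wavenumber R t.1)).
  rewrite (le_trans (ltW (archi_boundP (wavenumber_ge0 _))))//.
  by rewrite /lp_lambda -natrX ler_nat ltnW// ltn_expl.
by rewrite (le_trans h1)// lp_lambda_le// leq_maxr.
Qed.

Section blocks.
Variables (rho : R -> R) (rho_cutoff : lp_cutoff rho).
Variables (f : X -> R) (Lf : L2 torus f).

Definition block q (x : R * R * R) : R := \sum_(k \in [set: wavevector])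
    lp_symbol rho q (wavenumber R k) *
    (fourier_cos f k * cos (phase k x) + fourier_sin f k * sin (phase k x)).

Local Notation symbol q k := (lp_symbol rho q (wavenumber R k)).

Lemma lp_symbol_eq0 q r : lp_lambda R q.+1 <= r -> lp_symbol rho q r = 0.
Proof.
have [_ _ _ rho0] := rho_cutoff.
case: q => [|q] qr /=; first by apply: rho0; rewrite ler_pdivlMr ?lp_lambda_gt0// mul1r.
rewrite !rho0 ?subrr//; rewrite ler_pdivlMr ?lp_lambda_gt0// mul1r//.
by rewrite (le_trans _ qr)// lp_lambda_le.
Qed.

Lemma lp_symbol_modes q k : k \notin modes (2 ^ q.+1) -> symbol q k = 0.
Proof.
move=> kN; apply: lp_symbol_eq0; rewrite leNgt; apply: contra kN => /ltW h.
by apply: wavenumber_modes; rewrite natrX.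
Qed.

(** The sum telescopes to the low frequency cutoff at the scale of [n.+1]. *)
Lemma sum_lp_symbol n r : r <= lp_lambda R n -> \sum_(q < n.+1) lp_symbol rho q r = 1.
Proof.
have [_ _ rho1 _] := rho_cutoff.
move=> rn; transitivity (rho (r / lp_lambda R n.+1)); last first.
  apply: rho1; rewrite ler_pdivrMr ?lp_lambda_gt0//.
  by rewrite /lp_lambda exprS mulrA mulVf ?mul1r ?pnatr_eq0.
elim: n {rn} => [|n ih]; first by rewrite big_ord_recl big_ord0 addr0.
by rewrite big_ord_recr/= ih addrC subrK.
Qed.

Definition block_cos q k := symbol q k * fourier_cos f k.
Definition block_sin q k := symbol q k * fourier_sin f k.

Let block_cosN q k : block_cos q (- k) = block_cos q k.
Proof.
rewrite /block_cos wavenumberN !fourier_cosE /ip; congr (_ * (_ * _)).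
by apply: eq_Rintegral => x _; rewrite coskN.
Qed.

Let block_sinN q k : block_sin q (- k) = - block_sin q k.
Proof.
rewrite /block_sin wavenumberN !fourier_sinE -!mulrN; congr (_ * (_ * _)).
rewrite -[RHS]mulN1r -ipZr//; last exact: L2_sink.
by apply: eq_Rintegral => x _; rewrite sinkN mulN1r.
Qed.

Let block_cos_modes q k : k \notin modes (2 ^ q.+1) -> block_cos q k = 0.
Proof. by move=> h; rewrite /block_cos lp_symbol_modes// mul0r. Qed.

Let block_sin_modes q k : k \notin modes (2 ^ q.+1) -> block_sin q k = 0.
Proof. by move=> h; rewrite /block_sin lp_symbol_modes// mul0r. Qed.

Lemma blockE q : block q = synth (2 ^ q.+1) (block_cos q) (block_sin q).
Proof.
apply/funext => x; rewrite /block -(@fsbig_widen _ _ _ _ [set` modes (2 ^ q.+1)])//.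
  rewrite -fsbig_seq ?uniq_modes//; apply: eq_bigr => k _.
  by rewrite /block_cos /block_sin mulrDr !mulrA.
move=> k /= [_ /negP kN]; rewrite lp_symbol_modes// mul0r//.
Qed.

Lemma trigonometric_block q : trigonometric (block q).
Proof. by rewrite blockE; exact: trigonometric_synth. Qed.

Lemma L2_block q : L2 torus (block q).
Proof. exact/L2_trigonometric/trigonometric_block. Qed.

Lemma ip_block_cosk q k : ip (block q) (cosk k) = symbol q k * ip f (cosk k).
Proof.
rewrite blockE ip_synth_cosk//; last exact: block_cos_modes.
by rewrite /block_cos fourier_cosE mulrCA mulVKf// gt_eqF// volume_gt0.
Qed.

Lemma ip_block_sink q k : ip (block q) (sink k) = symbol q k * ip f (sink k).
Proof.
rewrite blockE ip_synth_sink//; last exact: block_sin_modes.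
by rewrite /block_sin fourier_sinE mulrCA mulVKf// gt_eqF// volume_gt0.
Qed.

(** A band-limited polynomial meets only the blocks of low frequency, so that against it
    the decomposition of [f] into blocks is a finite sum. *)
Lemma ip_sum_block s n : bandlimited n s ->
  ip f (trigpoly s) = \sum_(q < n.+1) ip (block q) (trigpoly s).
Proof.
move=> sn.
transitivity (\sum_(q < n.+1) \sum_(t <- s) (t.2.1 * (symbol q t.1 * ip f (cosk t.1))
    + t.2.2 * (symbol q t.1 * ip f (sink t.1)))); last first.
  apply: eq_bigr => q _; rewrite ip_trigpolyr; last exact: L2_block.
  by apply: eq_bigr => t _; rewrite ip_block_cosk ip_block_sink.
rewrite ip_trigpolyr// exchange_big/=; apply: eq_big_seq => t ts.
rewrite big_split/=.
have h : \sum_(q < n.+1) symbol q t.1 = 1.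
  by apply: sum_lp_symbol; exact: sn.
have e c z : c * z = \sum_(q < n.+1) c * (symbol q t.1 * z).
  by rewrite -big_distrr/= -big_distrl/= h mul1r.
by rewrite -!e.
Qed.

(** [trigpoly (deriv_terms j s)] is the derivative of [trigpoly s] in the direction [j]. *)
Definition deriv_terms (j : 'I_3) (s : seq (wavevector * (R * R))) :=
  [seq (t.1, ((t.1 j)%:~R * t.2.2, - ((t.1 j)%:~R * t.2.1))) |
    t : wavevector * (R * R) <- s].

(** The derivative of [block q] in the direction [j], in terms of coefficients. *)
Definition dblock j q := synth (2 ^ q.+1)
  (fun k => (k j)%:~R * block_sin q k) (fun k => - ((k j)%:~R * block_cos q k)).

Let dcosN j q k : (((- k) j)%:~R * block_sin q (- k)) = (k j)%:~R * block_sin q k.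
Proof. by rewrite ffunE block_sinN rmorphN/= mulrNN. Qed.

Let dsinN j q k : - (((- k) j)%:~R * block_cos q (- k)) = - - ((k j)%:~R * block_cos q k).
Proof. by rewrite ffunE block_cosN rmorphN/= mulNr. Qed.

Let dcos_modes j q k : k \notin modes (2 ^ q.+1) -> (k j)%:~R * block_sin q k = 0.
Proof. by move=> h; rewrite block_sin_modes// mulr0. Qed.

Let dsin_modes j q k : k \notin modes (2 ^ q.+1) -> - ((k j)%:~R * block_cos q k) = 0.
Proof. by move=> h; rewrite block_cos_modes// mulr0 oppr0. Qed.

Lemma L2_dblock j q : L2 torus (dblock j q).
Proof. exact/L2_trigonometric/trigonometric_synth. Qed.

Lemma ip_block_deriv j q s :
  ip (block q) (trigpoly (deriv_terms j s)) = - ip (dblock j q) (trigpoly s).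
Proof.
have bc k : ip (block q) (cosk k) = V * block_cos q k.
  by rewrite blockE (ip_synth_cosk _ (block_cosN q) (@block_cos_modes q)).
have bs k : ip (block q) (sink k) = V * block_sin q k.
  by rewrite blockE (ip_synth_sink _ (block_sinN q) (@block_sin_modes q)).
have dc k : ip (dblock j q) (cosk k) = V * ((k j)%:~R * block_sin q k).
  by rewrite (ip_synth_cosk _ (dcosN j q) (@dcos_modes j q)).
have ds k : ip (dblock j q) (sink k) = V * (- ((k j)%:~R * block_cos q k)).
  by rewrite (ip_synth_sink _ (dsinN j q) (@dsin_modes j q)).
rewrite !ip_trigpolyr; [|exact: L2_dblock|exact: L2_block].
rewrite big_map -sumrN; apply: eq_bigr => t _ /=.
by rewrite bc bs dc ds; ring.
Qed.

Lemma nrm_block_sqr q : nrm (block q) ^+ 2 =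
  V * \sum_(k <- modes (2 ^ q.+1)) (block_cos q k ^+ 2 + block_sin q k ^+ 2).
Proof.
by rewrite blockE (nrm_synth_sqr (block_cosN q) (block_sinN q)
  (@block_cos_modes q) (@block_sin_modes q)).
Qed.

(** The wave vectors that contribute satisfy [|k j| <= |k| <= lp_lambda q.+1]. *)
Lemma Bernstein j q : nrm (dblock j q) <= lp_lambda R q.+1 * nrm (block q).
Proof.
have L0 := ltW (lp_lambda_gt0 q.+1).
rewrite -(@ler_pXn2r _ 2)// ?nnegrE ?mulr_ge0 ?nrm_ge0//.
rewrite exprMn nrm_block_sqr
  (nrm_synth_sqr (dcosN j q) (dsinN j q) (@dcos_modes j q) (@dsin_modes j q)).
rewrite mulrCA ler_wpM2l ?(ltW (volume_gt0 R))//.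
rewrite big_distrr/= ler_sum// => k _.
have -> : ((k j)%:~R * block_sin q k) ^+ 2 + (- ((k j)%:~R * block_cos q k)) ^+ 2 =
  `|(k j)%:~R| ^+ 2 * (block_cos q k ^+ 2 + block_sin q k ^+ 2).
  by rewrite real_normK ?num_real//; ring.
have [kq|kq] := leP (lp_lambda R q.+1) (wavenumber R k).
  by rewrite /block_cos /block_sin lp_symbol_eq0// !mul0r expr0n/= addr0 !mulr0.
rewrite ler_wpM2r ?addr_ge0 ?sqr_ge0// lerXn2r ?nnegrE//.
by rewrite (le_trans (le_wavenumber k j))// ltW.
Qed.

(** Integration by parts, followed by Bernstein's inequality. *)
Lemma ip_block_deriv_le j q s :
  - ip (block q) (trigpoly (deriv_terms j s)) <=
  lp_lambda R q.+1 * nrm (block q) * nrm (trigpoly s).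
Proof.
rewrite ip_block_deriv opprK.
have Lp : L2 torus (trigpoly s) by apply: L2_trigonometric; exists s.
apply: le_trans (ler_norm _) _.
apply: le_trans (Cauchy_Schwarz (L2_dblock j q) Lp) _.
by rewrite ler_wpM2r ?nrm_ge0// Bernstein.
Qed.

End blocks.

End littlewood_paley.

(** * Weak gradients against trigonometric polynomials *)

Section smooth_trigonometric.
Variable R : realType.
Local Notation torus := (torus_measure R).
Local Notation X := (measurableTypeR R * measurableTypeR R * measurableTypeR R)%type.
Implicit Types (k : wavevector) (x v : R * R * R).
Implicit Types s : seq (wavevector * (R * R)).

(** A directional derivative is a derivative along a line, which makes the rules of
    calculus in one variable applicable. *)
Lemma is_derive_line (V : normedModType R) (f : V -> R) (x v : V) (df : R) :
  is_derive (0 : R) (1 : R) (fun h : R => f (h *: v + x)) df -> is_derive x v f df.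
Proof.
have E : (fun h : R => h^-1 *: ((f \o shift x) (h *: v) - f x)) =
  (fun h : R => h^-1 *: (((fun h : R => f (h *: v + x)) \o shift 0) (h *: (1 : R))
     - (fun h : R => f (h *: v + x)) 0)).
  by apply/funext => h /=; rewrite addr0 scale0r add0r /GRing.scale/= mulr1.
by move=> [d1 d2]; split; rewrite ?/derivable ?/derive E.
Qed.

Lemma phase_line k x v (h : R) : phase k (h *: v + x) = h * phase k v + phase k x.
Proof.
rewrite !phaseE /= /GRing.scale/=; ring.
Qed.

Lemma is_derive_cosk k x v : is_derive x v (@cosk R k) (- phase k v * sink k x).
Proof.
apply: is_derive_line; rewrite /cosk; under eq_fun do rewrite phase_line.
by apply: is_derive_eq; rewrite /GRing.scale/= /sink; rewrite !(mul0r, add0r); ring.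
Qed.

Lemma is_derive_sink k x v : is_derive x v (@sink R k) (phase k v * cosk k x).
Proof.
apply: is_derive_line; rewrite /sink; under eq_fun do rewrite phase_line.
by apply: is_derive_eq; rewrite /GRing.scale/= /cosk; rewrite !(mul0r, add0r); ring.
Qed.

Definition directional_terms v s :=
  [seq (t.1, (phase t.1 v * t.2.2, - (phase t.1 v * t.2.1))) |
    t : wavevector * (R * R) <- s].

Lemma is_derive_trigpoly s x v :
  is_derive x v (trigpoly s) (trigpoly (directional_terms v s) x).
Proof.
elim: s => [|[k [a b]] s ih].
  have -> : trigpoly [::] = cst (0 : R) :> (R * R * R -> R).
    by apply/funext => y; rewrite /trigpoly big_nil.
  by rewrite /=; exact: is_derive_cst.
have -> : trigpoly ((k, (a, b)) :: s) = (a \*: cosk k + b \*: sink k) + trigpoly s.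
  by apply/funext => y; rewrite /trigpoly big_cons.
have hc := is_derive_cosk k x v; have hs := is_derive_sink k x v.
apply: is_derive_eq; rewrite /trigpoly big_cons /GRing.scale/=; ring.
Qed.

Lemma continuous_phase k : continuous (phase k : R * R * R -> R).
Proof.
have -> : phase k = fun y : R * R * R => (k (@Ordinal 3 0 isT))%:~R * y.1.1 +
    (k (@Ordinal 3 1 isT))%:~R * y.1.2 + (k (@Ordinal 3 2 isT))%:~R * y.2.
  by apply/funext => y; exact: phaseE.
move=> x.
have c1 : (fun y : R * R * R => y.1.1) @ x --> x.1.1.
  by apply: (@continuous_comp _ _ _ fst fst x); exact: cvg_fst.
have c2 : (fun y : R * R * R => y.1.2) @ x --> x.1.2.
  by apply: (@continuous_comp _ _ _ fst snd x); [exact: cvg_fst|exact: cvg_snd].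
have c3 : (fun y : R * R * R => y.2) @ x --> x.2 by exact: cvg_snd.
by apply: cvgD; [apply: cvgD|]; apply: cvgMl_tmp.
Qed.

Lemma continuous_trigpoly s : continuous (trigpoly s : R * R * R -> R).
Proof.
elim: s => [|[k [a b]] s ih].
  have -> : trigpoly [::] = cst (0 : R) :> (R * R * R -> R).
    by apply/funext => y; rewrite /trigpoly big_nil.
  exact: cst_continuous.
have -> : trigpoly ((k, (a, b)) :: s) =
   fun x => (a * cosk k x + b * sink k x) + trigpoly s x.
  by apply/funext => y; rewrite /trigpoly big_cons.
move=> x; apply: cvgD; last exact: ih.
apply: cvgD; apply: cvgMl_tmp.
- by apply: (continuous_comp (@continuous_phase k x)); exact: continuous_cos.
- by apply: (continuous_comp (@continuous_phase k x)); exact: continuous_sin.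
Qed.

Lemma smooth_trigpoly s : smooth (trigpoly s : R * R * R -> R).
Proof.
move=> n; elim: n s => [|n ih] s /=; split => //; try exact: continuous_trigpoly.
move=> v; split=> [x|]; first by have [] := is_derive_trigpoly s x v.
have -> : 'D_v (trigpoly s) = trigpoly (directional_terms v s); last exact: ih.
by apply/funext => x; have [] := is_derive_trigpoly s x v.
Qed.

Lemma phase_unit_vector k j : phase k (unit_vector R j) = (k j)%:~R.
Proof.
rewrite /phase (bigD1 j)//= big1 => [|i ij]; last first.
  rewrite (_ : xcoord _ i = 0) ?mulr0//; move: ij.
  by case: i => [[|[|[|//]]] i3]; case: j => [[|[|[|//]]] j3].
rewrite addr0 (_ : xcoord _ j = 1) ?mulr1//.
by case: j => [[|[|[|//]]] j3].
Qed.

Lemma partial_trigpoly j s : partial j (trigpoly s : R * R * R -> R) =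
  trigpoly (deriv_terms j s).
Proof.
apply/funext => x; have [_] := is_derive_trigpoly s x (unit_vector R j).
rewrite /partial => ->; congr (trigpoly _ x).
by apply: eq_map => t; rewrite phase_unit_vector.
Qed.

Lemma periodic_trigpoly s : Defs.periodic (trigpoly s : R * R * R -> R).
Proof.
move=> x j; apply: eq_bigr => -[k [a b]] _ /=.
rewrite /cosk /sink (addrC x) phase_line phase_unit_vector.
have [c1 s1] := cos_sin_2piZ R (k j).
by rewrite (mulrC (2 * pi)) cosD sinD c1 s1 !mul1r !mul0r subr0 add0r.
Qed.

(** Trigonometric polynomials are admissible test functions for the weak gradient and
    determine its norm.  Against them the derivative moves onto the blocks of [v i], at
    the price of one factor [lp_lambda q.+1] each. *)
Lemma gradient_nrm_le (rho : R -> R) (v : torus_field R 'I_3)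
    (G : torus_field R ('I_3 * 'I_3)%type) (i j : 'I_3) (c : nat -> R) (B : R) :
  lp_cutoff rho -> L2 torus (v i) -> is_weak_gradient v G ->
  (forall q, nrm torus (block rho (v i) q) <= c q) ->
  (forall n, \sum_(q < n) lp_lambda R q.+1 * c q <= B) ->
  nrm torus (G (i, j)) <= B.
Proof.
move=> rhoc Lv [LG wG] vc cB.
have B0 : 0 <= B by have := cB 0%N; rewrite big_ord0.
apply: nrm_dual_le => //; first exact: LG.
move=> p [s ->].
have := wG i j _ (@smooth_trigpoly s) (@periodic_trigpoly s).
rewrite -/(ip torus (v i) _) -/(ip torus (G (i, j)) _) partial_trigpoly => /eqP.
rewrite -eqr_oppLR => /eqP <-.
have [n /(ip_sum_block rhoc Lv) ->] := trigpoly_bandlimited (deriv_terms j s).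
rewrite -sumrN.
apply: (@le_trans _ _ (\sum_(q < n.+1) lp_lambda R q.+1 * c q * nrm torus (trigpoly s))).
  apply: ler_sum => q _; apply: le_trans (ip_block_deriv_le rhoc Lv j q s) _.
  by rewrite ler_wpM2r ?nrm_ge0// ler_wpM2l ?vc// ltW// lp_lambda_gt0.
by rewrite -big_distrl/= ler_wpM2r ?nrm_ge0 ?cB.
Qed.

End smooth_trigonometric.

(** * Consequences of localization in frequency *)

Section localized_fields.
Variable R : realType.
Variables (rho : R -> R) (rho_cutoff : lp_cutoff rho).
Local Notation torus := (torus_measure R).
Local Notation X := (measurableTypeR R * measurableTypeR R * measurableTypeR R)%type.
Local Notation ip := (ip torus).
Local Notation nrm := (nrm torus).
Local Notation L2 := (L2 torus).
Local Notation block f q := (block rho f q).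
Implicit Types (f g : X -> R).

Lemma block_suml f g q x : L2 f -> L2 g ->
  block (fun x => f x - g x) q x = block f q x - block g q x.
Proof.
move=> Lf Lg; rewrite !blockE // /synth -sumrB; apply: eq_bigr => k _.
rewrite /block_cos /block_sin !fourier_cosE !fourier_sinE.
rewrite !(ipBl Lf Lg); [|exact: L2_sink|exact: L2_cosk].
ring.
Qed.

(** A block depends on finitely many Fourier coefficients, each of which is a pairing
    with a fixed function. *)
Lemma nrm_block_cvg0 (w : nat -> X -> R) q : (forall n, L2 (w n)) ->
  (forall p, L2 p -> ip (w n) p @[n --> \oo] --> (0 : R)) ->
  nrm (block (w n) q) @[n --> \oo] --> (0 : R).
Proof.
move=> Lw w0.
have -> : (fun n => nrm (block (w n) q)) = (fun n => Num.sqrt (nrm (block (w n) q) ^+ 2)).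
  by apply/funext => n; rewrite sqrtr_sqr ger0_norm// nrm_ge0.
rewrite -[X in _ --> X]sqrtr0; apply: continuous_cvg; first exact: sqrt_continuous.
under eq_fun do rewrite nrm_block_sqr//.
apply: cvg0Ml.
apply: cvg_sum0 => k.
have c0 (a : R) (z : nat -> R) : z @ \oo --> (0 : R) ->
    (a * ((volume R)^-1 * z n)) ^+ 2 @[n --> \oo] --> (0 : R).
  move=> z0; have h : a * ((volume R)^-1 * z n) @[n --> \oo] --> (0 : R).
    by do 2 apply: cvg0Ml.
  by rewrite -[X in _ --> X](mulr0 (0 : R)); exact: (cvgM h h).
rewrite -[X in _ --> X](addr0 (0 : R)); apply: cvgD; apply: c0; apply: w0.
  exact: L2_cosk.
exact: L2_sink.
Qed.

Section decay.
Variables (r : R) (r_gt0 : 0 < r) (r_lt : r < 2^-1).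

Let r0 : 0 <= r. Proof. exact: ltW. Qed.
Let r1 : r < 1. Proof. by apply: lt_trans r_lt _; rewrite invf_lt1// ltr1n. Qed.

Lemma sum_geometric_le (z : R) n : 0 <= z < 1 -> \sum_(q < n) z ^+ q <= (1 - z)^-1.
Proof.
move=> /andP[z0 z1]; have z1' : 0 < 1 - z by rewrite subr_gt0.
rewrite -[leRHS]mul1r ler_pdivlMr//.
have -> : (\sum_(q < n) z ^+ q) * (1 - z) = 1 - z ^+ n.
  elim: n => [|n ih]; first by rewrite big_ord0 mul0r expr0 subrr.
  by rewrite big_ord_recr/= mulrDl ih exprS; ring.
by rewrite gerBl exprn_ge0.
Qed.

Lemma expr_dist_le (q k Q : nat) : (k <= Q)%N -> r ^+ `|q - k|%N <= r^-1 ^+ Q * r ^+ q.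
Proof.
move=> kQ; rewrite exprVn mulrC ler_pdivlMr ?exprn_gt0// -exprD.
apply: ler_wiXn2l => //; first exact: ltW.
lia.
Qed.

(** If [k] were far above the band of [s], all blocks that [s] meets would be small, and
    so would be its pairing with [f]. *)
Lemma frequency_le (s : seq (wavevector * (R * R))) n (c kappa : R) :
  bandlimited n s -> 0 <= c -> 0 < kappa ->
  exists Q : nat, forall f (k : nat), L2 f ->
    (forall q, nrm (block f q) <= c * r ^+ `|q - k|%N) ->
    kappa <= `|ip f (trigpoly s)| -> (k <= Q)%N.
Proof.
move=> sn c0 k0.
pose C := n.+1%:R * c * nrm (trigpoly s) + 1.
have C0 : 0 < C by rewrite ltr_wpDl// mulr_ge0 ?nrm_ge0// mulr_ge0.
have [m hm] : exists m, r ^+ m < kappa / C.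
  have := @cvg_expr R r; rewrite ger0_norm// => /(_ r1) /cvgr0_norm_lt.
  move=> /(_ _ (divr_gt0 k0 C0)) [m _ /(_ m (leqnn _))].
  by rewrite ger0_norm ?exprn_ge0//; exists m.
exists (n + m)%N => f k Lf fk kf; rewrite leqNgt; apply/negP => nmk.
suff : kappa < kappa by rewrite ltxx.
have Ls : L2 (trigpoly s) by apply: L2_trigonometric; exists s.
apply: le_lt_trans kf _; rewrite (ip_sum_block rho_cutoff Lf sn).
apply: le_lt_trans (ler_norm_sum _ _ _) _.
apply: (@le_lt_trans _ _ (\sum_(q < n.+1) (c * r ^+ m * nrm (trigpoly s)))).
  apply: ler_sum => q _; apply: le_trans (Cauchy_Schwarz (L2_block _ _ _) Ls) _ => //.
  rewrite ler_wpM2r ?nrm_ge0// (le_trans (fk q))// ler_wpM2l//.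
  apply: ler_wiXn2l => //; first exact: ltW.
  have := ltn_ord q; lia.
rewrite sumr_const card_ord -[_ *+ _]mulr_natr.
apply: (@le_lt_trans _ _ (C * r ^+ m)).
  have -> : c * r ^+ m * nrm (trigpoly s) * n.+1%:R = (C - 1) * r ^+ m by rewrite /C; ring.
  by rewrite ler_wpM2r ?exprn_ge0// gerBl.
by rewrite mulrC -ltr_pdivlMr.
Qed.

(** Low blocks converge because they depend on finitely many coefficients, and high
    blocks are uniformly small; the weak limit inherits the decay. *)
Lemma localized_cvg (v : nat -> X -> R) (u : X -> R) (K : R) :
  (forall n, L2 (v n)) -> L2 u -> 0 <= K ->
  (forall p, L2 p -> ip (v n) p @[n --> \oo] --> ip u p) ->
  (\forall n \near \oo, forall q, nrm (block (v n) q) <= K * r ^+ q) ->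
  nrm (fun x => v n x - u x) @[n --> \oo] --> (0 : R).
Proof.
move=> Lv Lu K0 vu vK.
pose w n x := v n x - u x.
have Lw n : L2 (w n) by exact: L2B.
have w0 q : nrm (block (w n) q) @[n --> \oo] --> (0 : R).
  apply: nrm_block_cvg0 => // p Lp.
  have -> : (fun n => ip (w n) p) = (fun n => ip (v n) p - ip u p).
    by apply/funext => n; rewrite ipBl.
  by rewrite -[X in _ --> X](subrr (ip u p)); apply: cvgB; [exact: vu|exact: cvg_cst].
have Lb f q : L2 f -> L2 (block f q) by move=> _; exact: L2_block.
have uK q : nrm (block u q) <= K * r ^+ q.
  apply/ler_addgt0Pr => e e0.
  have /cvgr0_norm_le/(_ _ e0) we := w0 q.
  near \oo => n.
  have -> : block u q = (fun x => block (v n) q x - block (w n) q x).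
    by apply/funext => x; rewrite block_suml// opprB addrC subrK.
  apply: le_trans (nrmB_le (Lb _ _ (Lv n)) (Lb _ _ (Lw n))) _.
  apply: lerD; first by near: n; apply: filterS vK => n; exact.
  by rewrite -[leLHS]ger0_norm ?nrm_ge0//; near: n.
have wK : \forall n \near \oo, forall q, nrm (block (w n) q) <= 2 * K * r ^+ q.
  apply: filterS vK => n vnK q.
  have -> : block (w n) q = (fun x => block (v n) q x - block u q x).
    by apply/funext => x; rewrite block_suml.
  apply: le_trans (nrmB_le (Lb _ _ (Lv n)) (Lb _ _ Lu)) _.
  by rewrite -mulrA mulr_natl mulr2n; exact: lerD (vnK q) (uK q).
have w_le M : \forall n \near \oo,
    nrm (w n) <= \sum_(q < M) nrm (block (w n) q) + 2 * K * r ^+ M * (1 - r)^-1.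
  apply: filterS wK => n wnK.
  have tail0 : 0 <= 2 * K * r ^+ M * (1 - r)^-1.
    by rewrite !mulr_ge0 ?exprn_ge0 ?invr_ge0 ?subr_ge0 ?(ltW r1).
  apply: nrm_dual_le => //.
    by rewrite addr_ge0// sumr_ge0// => q _; exact: nrm_ge0.
  move=> p [s ->]; have [N sN] := trigpoly_bandlimited s.
  have sMN : bandlimited (M + N) s by apply: bandlimited_le sN; exact: leq_addl.
  have Ls : L2 (trigpoly s) by apply: L2_trigonometric; exists s.
  rewrite (ip_sum_block rho_cutoff (Lw n) sMN).
  apply: (@le_trans _ _ (\sum_(q < (M + N).+1) nrm (block (w n) q) * nrm (trigpoly s))).
    apply: ler_sum => q _; apply: le_trans (ler_norm _) _.
    exact: Cauchy_Schwarz (Lb _ _ (Lw n)) Ls.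
  rewrite -big_distrl/= ler_wpM2r ?nrm_ge0// -addnS big_split_ord/= lerD2l.
  apply: (@le_trans _ _ (\sum_(q < N.+1) 2 * K * r ^+ M * r ^+ q)).
    by apply: ler_sum => q _; apply: le_trans (wnK _) _; rewrite exprD mulrA.
  rewrite -big_distrr/= ler_wpM2l ?mulr_ge0 ?exprn_ge0//.
  by apply: sum_geometric_le; rewrite r0.
apply/cvgr0Pnorm_le => e e0.
have e20 : 0 < e / 2 by rewrite divr_gt0.
have [M hM] : exists M, 2 * K * r ^+ M * (1 - r)^-1 <= e / 2.
  have C0 : 0 < 2 * K * (1 - r)^-1 + 1.
    by rewrite ltr_wpDl// !mulr_ge0// invr_ge0 subr_ge0 ltW.
  have := @cvg_expr R r; rewrite ger0_norm// => /(_ r1) /cvgr0_norm_le.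
  move=> /(_ _ (divr_gt0 e20 C0)) [m _ /(_ m (leqnn _))].
  rewrite ger0_norm ?exprn_ge0// => h; exists m.
  rewrite ler_pdivlMr// in h; apply: le_trans h.
  have := exprn_ge0 m r0; lra.
have sM : \sum_(q < M) nrm (block (w n) q) @[n --> \oo] --> (0 : R).
  exact: cvg_sum0.
have /cvgr0_norm_le/(_ _ e20) sMe := sM.
near=> n; rewrite ger0_norm ?nrm_ge0//.
rewrite (le_trans (_ : _ <= \sum_(q < M) nrm (block (w n) q) + 2 * K * r ^+ M * (1 - r)^-1))//.
  by near: n; exact: w_le.
rewrite (le_trans (lerD _ hM) (_ : e / 2 + e / 2 <= e))// -?splitr//.
by apply: le_trans (ler_norm _) _; near: n.
Unshelve. all: by end_near. Qed.

End decay.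

End localized_fields.

(** * Square integrable vector fields *)

Section vector_fields.
Variables (R : realType) (I : finType).
Local Notation torus := (torus_measure R).
Local Notation X := (measurableTypeR R * measurableTypeR R * measurableTypeR R)%type.
Local Notation ip := (ip torus).
Local Notation nrm := (nrm torus).
Local Notation L2 := (L2 torus).
Implicit Types v w : torus_field R I.

(** The norm of [l2norm] as a real number; both agree on square integrable fields by
    [l2norm_fin]. *)
Definition vnrm v : R := Num.sqrt (inner v v).

Lemma integrable_inner v w : inL2 v -> inL2 w ->
  torus.-integrable setT (fun x => (\sum_i v i x * w i x)%:E).
Proof.
move=> Lv Lw; rewrite (_ : (fun x => _) = fun x => (\sum_i (v i x * w i x)%:E)%E).
  by apply: integrable_sum => // j _; exact: L2_mul (Lv j) (Lw j).
by apply/funext => x /=; rewrite sumEFin.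
Qed.

Lemma innerE v w : inL2 v -> inL2 w -> inner v w = \sum_i ip (v i) (w i).
Proof.
move=> Lv Lw; rewrite /inner /ip.
elim: (index_enum I) => [|i s ih].
  rewrite big_nil; under eq_Rintegral do rewrite big_nil.
  by rewrite Rintegral_cst// mul0r.
rewrite big_cons -ih -RintegralD//.
- by apply: eq_Rintegral => x _; rewrite big_cons.
- exact: L2_mul (Lv i) (Lw i).
- rewrite (_ : _ \o _ = fun x => (\sum_(j <- s) (v j x * w j x)%:E)%E); last first.
    by apply/funext => x /=; rewrite sumEFin.
  by apply: integrable_sum => // j _; exact: L2_mul (Lv j) (Lw j).
Qed.

Lemma innerC v w : inner v w = inner w v.
Proof. by apply: eq_Rintegral => x _; apply: eq_bigr => i _; rewrite mulrC. Qed.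

Lemma inL2D v w : inL2 v -> inL2 w -> inL2 (v + w).
Proof. by move=> Lv Lw i; exact: L2D (Lv i) (Lw i). Qed.

Lemma inL2B v w : inL2 v -> inL2 w -> inL2 (v - w).
Proof. by move=> Lv Lw i; exact: L2B (Lv i) (Lw i). Qed.

Lemma innerDl u v w : inL2 u -> inL2 v -> inL2 w ->
  inner (u + v) w = inner u w + inner v w.
Proof.
move=> Lu Lv Lw; rewrite !innerE//; last exact: inL2D.
by rewrite -big_split; apply: eq_bigr => i _; exact: ipDl (Lu i) (Lv i) (Lw i).
Qed.

Lemma innerBl u v w : inL2 u -> inL2 v -> inL2 w ->
  inner (u - v) w = inner u w - inner v w.
Proof.
move=> Lu Lv Lw; rewrite !innerE//; last exact: inL2B.
by rewrite -sumrB; apply: eq_bigr => i _; exact: ipBl (Lu i) (Lv i) (Lw i).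
Qed.

Lemma innerBr u v w : inL2 u -> inL2 v -> inL2 w ->
  inner u (v - w) = inner u v - inner u w.
Proof. by move=> Lu Lv Lw; rewrite innerC innerBl// !(innerC u). Qed.

Lemma inner_sqr v : inL2 v -> inner v v = \sum_i nrm (v i) ^+ 2.
Proof. by move=> Lv; rewrite innerE//; apply: eq_bigr => i _; rewrite nrm_sqr. Qed.

Lemma inner_ge0 v : 0 <= inner v v.
Proof. by apply: Rintegral_ge0 => x _; rewrite sumr_ge0// => i _; rewrite -expr2 sqr_ge0. Qed.

Lemma vnrm_ge0 v : 0 <= vnrm v.
Proof. exact: sqrtr_ge0. Qed.

Lemma vnrm_sqr v : vnrm v ^+ 2 = inner v v.
Proof. by rewrite sqr_sqrtr// inner_ge0. Qed.

Lemma inner_le v w : inL2 v -> inL2 w -> `|inner v w| <= vnrm v * vnrm w.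
Proof.
move=> Lv Lw; rewrite -sqrtr_sqr -sqrtrM ?inner_ge0// ler_wsqrtr//.
apply: discriminant_le; first exact: inner_ge0.
move=> t.
pose z : torus_field R I := fun i x => t * w i x.
have LZ : inL2 z by move=> i; exact: L2Z (Lw i).
have zw u : inL2 u -> inner z u = t * inner w u.
  by move=> Lu; rewrite !innerE// big_distrr; apply: eq_bigr => i _; exact: ipZl (Lw i) (Lu i).
have := inner_ge0 (v + z); congr (_ <= _).
rewrite innerDl//; last exact: inL2D.
rewrite (innerC v (v + z)) (innerC z (v + z)) !innerDl// (innerC v z) !zw//.
rewrite (innerC w z) zw// (innerC w v); ring.
Qed.

Lemma vnrmD_le v w : inL2 v -> inL2 w -> vnrm (v + w) <= vnrm v + vnrm w.
Proof.
move=> Lv Lw; rewrite -(@ler_pXn2r _ 2)// ?nnegrE ?vnrm_ge0 ?addr_ge0 ?vnrm_ge0//.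
have LD := inL2D Lv Lw.
rewrite vnrm_sqr innerDl// !(innerC _ (v + w)) !innerDl// sqrrD !vnrm_sqr (innerC w v).
have := le_trans (ler_norm _) (inner_le Lv Lw); lra.
Qed.

Lemma vnrmBC v w : vnrm (v - w) = vnrm (w - v).
Proof.
congr Num.sqrt; apply: eq_Rintegral => x _; apply: eq_bigr => i _.
by rewrite -[v - w]opprB mulrNN.
Qed.

Lemma vnrm_dist_le v w : inL2 v -> inL2 w -> `|vnrm v - vnrm w| <= vnrm (v - w).
Proof.
move=> Lv Lw; rewrite ler_norml; apply/andP; split.
  rewrite lerBrDr addrC -lerBrDr opprK vnrmBC addrC.
  by have := vnrmD_le (inL2B Lw Lv) Lv; rewrite subrK.
by rewrite lerBlDr; have := vnrmD_le (inL2B Lv Lw) Lw; rewrite subrK.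
Qed.

Lemma nrm_le_vnrm v i : inL2 v -> nrm (v i) <= vnrm v.
Proof.
move=> Lv; rewrite -(@ler_pXn2r _ 2)// ?nnegrE ?vnrm_ge0 ?nrm_ge0//.
rewrite vnrm_sqr inner_sqr// (bigD1 i)//= lerDl sumr_ge0// => j _.
exact: sqr_ge0.
Qed.

Definition measurable_field v := forall i, measurable_fun [set: X] (v i).

Lemma measurable_sqr_field v : measurable_field v ->
  measurable_fun [set: X] (fun x => \sum_i v i x ^+ 2).
Proof. by move=> mv; apply: measurable_sum => i; exact: measurable_funX. Qed.

Lemma l2normE v : l2norm v = ((\int[torus]_x (\sum_i v i x ^+ 2)%:E) `^ 2^-1)%E.
Proof.
rewrite /l2norm unlock; congr (_ `^ _)%E; apply: eq_integral => x _ /=.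
rewrite /euclid ger0_norm ?sqrtr_ge0// powR_mulrn ?sqrtr_ge0// sqr_sqrtr//.
by rewrite sumr_ge0// => i _; exact: sqr_ge0.
Qed.

Lemma l2norm_ge0 v : (0 <= l2norm v)%E.
Proof. by rewrite l2normE poweR_ge0. Qed.

Lemma l2norm_fin v : inL2 v -> l2norm v = (vnrm v)%:E.
Proof.
move=> Lv; rewrite l2normE.
have -> : (\int[torus]_x (\sum_i v i x ^+ 2)%:E)%E = (inner v v)%:E.
  have := integrable_fin_num measurableT (integrable_inner Lv Lv).
  move=> /fineK; rewrite /inner /Rintegral => ->.
  by apply: eq_integral => x _; congr EFin; apply: eq_bigr => i _; rewrite expr2.
by rewrite poweR_EFin powR12_sqrt// inner_ge0.
Qed.

Lemma l2norm_lty v : measurable_field v -> (l2norm v < +oo)%E -> inL2 v.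
Proof.
move=> mv; rewrite l2normE => /lty_poweRy vy i; apply/L2P; split=> //.
apply/integrableP; split; first by apply/measurable_EFinP; exact: measurable_funX.
have {}vy : (\int[torus]_x (\sum_i v i x ^+ 2)%:E < +oo)%E.
  by apply: vy; rewrite invr_eq0 pnatr_eq0.
apply: le_lt_trans vy; apply: ge0_le_integral => //.
- by apply: measurableT_comp => //; apply/measurable_EFinP; exact: measurable_funX.
- by apply/measurable_EFinP; exact: measurable_sqr_field.
- move=> x _; rewrite lee_fin ger0_norm ?sqr_ge0// (bigD1 i)//= lerDl.
  by rewrite sumr_ge0// => j _; exact: sqr_ge0.
Qed.

End vector_fields.

(** * Energy balances on an interval *)

Section interval_induction.
Variable R : realType.

(** The supremum of the endpoints reached from [x] is reached itself, and cannot be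
    less than [y]. *)
Lemma interval_induction (P : R -> R -> Prop) (x y : R) : x <= y ->
  (forall a b c, x <= a -> a <= b -> b <= c -> c <= y -> P a b -> P b c -> P a c) ->
  (forall t, x <= t <= y -> exists2 e, 0 < e & forall a b,
     x <= a -> t - e < a -> a <= t -> t <= b -> b < t + e -> b <= y -> P a b) ->
  P x y.
Proof.
move=> xy Padd Ploc.
pose S := [set s | x <= s <= y /\ P x s].
have Sx : S x.
  split; first by rewrite lexx xy.
  have [e e0 He] := Ploc x (introT andP (conj (lexx x) xy)).
  by apply: He => //; lra.
have S0 : S !=set0 by exists x.
have Sub : ubound S y by move=> s [/andP[]].
have hS : has_sup S by split=> //; exists y.
pose t := sup S.
have xt : x <= t by exact: (ub_le_sup hS.2 Sx).
have ty : t <= y by exact: ge_sup.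
have [e e0 He] := Ploc t (introT andP (conj xt ty)).
have [s [/andP[xs sy] Pxs] ts] := sup_adherent e0 hS.
have st : s <= t by apply: (ub_le_sup hS.2); split=> //; rewrite xs.
have key b : t <= b -> b < t + e -> b <= y -> P x b.
  move=> tb be yb; apply: (Padd x s b) => //; first exact: le_trans tb.
  exact: He.
have [ty'|yt] := ltP t y; last by apply: key => //; lra.
pose b := Num.min y (t + e / 2).
have tb : t < b by rewrite /b lt_min ty'/=; lra.
have be : b < t + e by rewrite /b gt_min; apply/orP; right; lra.
have bY : b <= y by rewrite /b ge_min lexx.
have Sb : S b by split; [rewrite bY andbT; lra|apply: key => //; exact: ltW].
by have := ub_le_sup hS.2 Sb; rewrite -/t; lra.
Qed.

(** Here [h t] is the norm of [u(t)], [G a b] the work of the force on [[a, b]] and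
    [Phi a b] the integral of the norm of the force.  The local balances hold where [h]
    is positive.  There, [|h b - h a| (h b + h a) <= 2 (max h) Phi], and [h] is
    continuous, so [h] is Lipschitz with respect to [2 Phi]; this extends to the zeros of
    [h] by truncation.  Consequently the increments of [h ^ 2] are small multiples of
    [Phi] where [h] is small, just as those of [G]. *)
Lemma energy_balance (h : R -> R) (G Phi : R -> R -> R) :
  (forall t, 0 <= t <= 1 -> 0 <= h t) ->
  (forall t, 0 <= t <= 1 -> forall e, 0 < e -> exists2 d, 0 < d &
     forall s, 0 <= s <= 1 -> `|s - t| < d -> `|h s - h t| <= e) ->
  (forall a b, 0 <= a -> a <= b -> b <= 1 -> 0 <= Phi a b) ->
  (forall a b c, 0 <= a -> a <= b -> b <= c -> c <= 1 -> Phi a c = Phi a b + Phi b c) ->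
  (forall a b c, 0 <= a -> a <= b -> b <= c -> c <= 1 -> G a c = G a b + G b c) ->
  (forall a b M, 0 <= a -> a <= b -> b <= 1 -> (forall s, a <= s <= b -> h s <= M) ->
     `|G a b| <= M * Phi a b) ->
  (forall t, 0 <= t <= 1 -> 0 < h t -> exists2 d, 0 < d & forall a b,
     0 <= a -> t - d < a -> a <= t -> t <= b -> b < t + d -> b <= 1 ->
     h b ^+ 2 - h a ^+ 2 = 2 * G a b) ->
  h 1 ^+ 2 - h 0 ^+ 2 = 2 * G 0 1.
Proof.
move=> h0 hc Phi0 PhiD GD Gle hloc.
have near t e : 0 <= t <= 1 -> 0 < e -> exists2 d, 0 < d & forall s,
    0 <= s <= 1 -> t - d < s -> s < t + d -> h t - e <= h s <= h t + e.
  move=> t01 e0; have [d d0 hd] := hc t t01 e e0; exists d => // s s01 s1 s2.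
  have := hd s s01; rewrite ltr_norml ler_norml => H.
  have /andP[] : - e <= h s - h t <= e by apply: H; lra.
  by lra.
have max_lip (u v w : R) : `|Num.max u w - Num.max v w| <= `|u - v|.
  have [|] := leP u w; have [|] := leP v w => *; rewrite ?subrr ?normr0//;
  rewrite ler_norml; have := ler_norm (u - v); have := ler_norm (v - u);
  rewrite (distrC v u); lra.
(* The truncation [Num.max h d] is constant where [h < d], and [h] obeys a local
   balance where [h > 3 d / 4]; by continuity each time has a neighbourhood of one of
   the two kinds. *)
have lip_max d x y : 0 < d -> 0 <= x -> x <= y -> y <= 1 ->
    `|Num.max (h y) d - Num.max (h x) d| <= 2 * Phi x y.
  move=> d0 x0 xy y1.
  apply: (@interval_induction (fun a b =>
    `|Num.max (h b) d - Num.max (h a) d| <= 2 * Phi a b)) => //.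
    move=> a b c xa ab bc cy h1 h2.
    rewrite (PhiD a b c)//; [|lra..].
    rewrite (_ : Num.max (h c) d - _ = (Num.max (h c) d - Num.max (h b) d) +
      (Num.max (h b) d - Num.max (h a) d)); last by ring.
    by rewrite (le_trans (ler_normD _ _))//; lra.
  move=> t /andP[xt ty]; have t01 : 0 <= t <= 1 by lra.
  have d8 : 0 < d / 8 by lra.
  have [e1 e10 He1] := near t _ t01 d8.
  have [ht|ht] := ltP (h t) (3 / 4 * d).
    exists e1 => // a b xa ta a_t tb bt by_.
    have /andP[_ ha] := He1 a (ltac:(lra)) ta (ltac:(lra)).
    have /andP[_ hb] := He1 b (ltac:(lra)) (ltac:(lra)) bt.
    rewrite !max_r; [|lra..]; rewrite subrr normr0 mulr_ge0//.
    by apply: Phi0; lra.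
  have [e2 e20 He2] := hloc t t01 (ltac:(lra)).
  exists (Num.min e1 e2); first by rewrite lt_min e10.
  move=> a b xa ta a_t tb bt by_.
  have m1 : Num.min e1 e2 <= e1 by rewrite ge_min lexx.
  have m2 : Num.min e1 e2 <= e2 by rewrite ge_min lexx orbT.
  have eq := He2 a b (ltac:(lra)) (ltac:(lra)) a_t tb (ltac:(lra)) (ltac:(lra)).
  have bd s : a <= s <= b -> h t - d / 8 <= h s <= h t + d / 8.
    by move=> /andP[as_ sb]; apply: He1; lra.
  have GM : `|G a b| <= (h t + d / 8) * Phi a b.
    by apply: Gle; [lra|lra|lra|move=> s /bd /andP[]].
  have /andP[ha1 ha2] := bd a (ltac:(lra)); have /andP[hb1 hb2] := bd b (ltac:(lra)).
  (* As [h t >= 3 d / 4], one has [h t + d / 8 <= 2 (h t - d / 8) <= h b + h a]: dividing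
     the local balance by [h b + h a] leaves the constant [2]. *)
  apply: le_trans (max_lip _ _ _) _.
  have s0 : 0 < h b + h a by lra.
  rewrite -(ler_pM2r s0) -{1}(ger0_norm (ltW s0)) -normrM -subr_sqr eq normrM ger0_norm//.
  rewrite -mulrA ler_pM2l// (le_trans GM)// mulrC ler_wpM2l//; last by lra.
  by apply: Phi0; lra.
have lip x y : 0 <= x -> x <= y -> y <= 1 -> `|h y - h x| <= 2 * Phi x y.
  move=> x0 xy y1; apply/ler_addgt0Pr => d d0.
  have := lip_max d x y d0 x0 xy y1.
  have mx (u : R) : 0 <= u -> u <= Num.max u d <= u + d.
    by move=> u0; rewrite le_max lexx/= ge_max; lra.
  have /andP[] := mx _ (h0 y (ltac:(lra))); have /andP[] := mx _ (h0 x (ltac:(lra))).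
  rewrite !ler_norml; lra.
(* Where [h <= d] the increment of [h ^ 2] is at most [2 d] times that of [h], which is
   at most [2 Phi], and [2 G] is at most [2 d Phi]. *)
suff key d : 0 < d -> `|h 1 ^+ 2 - h 0 ^+ 2 - 2 * G 0 1| <= 6 * d * Phi 0 1.
  apply/eqP; rewrite -subr_eq0 -normr_eq0 eq_le normr_ge0 andbT.
  apply/ler_addgt0Pr => e e0; rewrite add0r.
  have P0 : 0 <= Phi 0 1 by exact: Phi0.
  have c0 : 0 < 6 * Phi 0 1 + 1 by lra.
  apply: le_trans (key _ (divr_gt0 e0 c0)) _.
  rewrite mulrAC mulrA ler_pdivrMr// mulrC ler_pM2l//; lra.
move=> d0.
apply: (@interval_induction (fun a b =>
  `|h b ^+ 2 - h a ^+ 2 - 2 * G a b| <= 6 * d * Phi a b)) => //.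
  move=> a b c xa ab bc cy h1 h2.
  rewrite (PhiD a b c)// (GD a b c)//.
  rewrite (_ : h c ^+ 2 - _ - _ = (h c ^+ 2 - h b ^+ 2 - 2 * G b c) +
     (h b ^+ 2 - h a ^+ 2 - 2 * G a b)); last by ring.
  by rewrite (le_trans (ler_normD _ _))//; lra.
move=> t t01; have d2 : 0 < d / 2 by lra.
have [ht|ht] := ltP (h t) (d / 2); last first.
  have [e2 e20 He2] := hloc t t01 (ltac:(lra)).
  exists e2 => // a b xa ta a_t tb bt by_.
  rewrite (He2 a b)// subrr normr0 !mulr_ge0//; [lra|apply: Phi0; lra].
have [e1 e10 He1] := near t _ t01 d2.
exists e1 => // a b xa ta a_t tb bt by_.
have ab : a <= b by lra.
have bd s : a <= s <= b -> h s <= d.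
  move=> /andP[as_ sb]; have /andP[_] := He1 s (ltac:(lra)) (ltac:(lra)) (ltac:(lra)).
  lra.
have GM := Gle a b d xa ab by_ bd.
have L := lip a b xa ab by_.
have ha := bd a (ltac:(lra)); have hb := bd b (ltac:(lra)).
have ha0 := h0 a (ltac:(lra)); have hb0 := h0 b (ltac:(lra)).
rewrite subr_sqr (le_trans (ler_normB _ _))// !normrM (ger0_norm (addr_ge0 hb0 ha0)).
rewrite (@ger0_norm _ 2)//.
have P0 := Phi0 a b xa ab by_.
have : `|h b - h a| * (h b + h a) <= 2 * Phi a b * (2 * d).
  by apply: ler_pM => //; [exact: addr_ge0|lra].
by lra.
Qed.

End interval_induction.

(** * Time integrals and the a priori bound *)

Section time_integrals.
Variable R : realType.
Local Notation torus := (torus_measure R).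
Local Notation leb := (@lebesgue_measure R).
Local Notation X := (measurableTypeR R * measurableTypeR R * measurableTypeR R)%type.
Local Notation D := (unit_itv R : set (measurableTypeR R)).
Implicit Types f u : R -> torus_field R 'I_3.

Lemma measurable_unit_itv : measurable D.
Proof. exact: measurable_itv. Qed.

Let mDX : measurable (D `*` [set: X]).
Proof. by apply: measurableX => //; exact: measurable_unit_itv. Qed.

(** Extended by zero in time, a field is measurable on the whole product, as theorems on
    sections and partial integrals require. *)
Definition slab f (i : 'I_3) : measurableTypeR R * X -> R :=
  (fun p => f p.1 i p.2) \_ (D `*` setT).

Lemma slabE f i s x : D s -> slab f i (s, x) = f s i x.
Proof. by move=> Ds; rewrite /slab patchE mem_set. Qed.

Lemma measurable_slab f i : spacetime_measurable f ->
  measurable_fun [set: measurableTypeR R * X] (slab f i).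
Proof.
by move=> mf; exact: (iffLR (measurable_restrictT _ mDX) (mf i)).
Qed.

Lemma spacetime_measurable_field f s : spacetime_measurable f -> D s ->
  measurable_field (f s).
Proof.
move=> mf Ds i; have := measurable_fun_pair2 s (measurable_slab i mf).
by congr measurable_fun; apply/funext => x; rewrite slabE.
Qed.

Lemma spacetime_measurableB f u : spacetime_measurable f -> spacetime_measurable u ->
  spacetime_measurable (fun s => f s - u s).
Proof. by move=> mf mu i; apply: measurable_funB; [exact: mf|exact: mu]. Qed.

Lemma measurable_partial_integral (F : measurableTypeR R * X -> R) :
  measurable_fun setT F ->
  measurable_fun setT (fun s => \int[torus]_x (F (s, x))%:E)%E.
Proof.
move=> mF; have mF' : measurable_fun setT (EFin \o F) by exact/measurable_EFinP.
have -> : (fun s => \int[torus]_x (F (s, x))%:E)%E = (fun s =>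
  fubini_F (finite_torus_measure R) (EFin \o F)^\+%E s -
  fubini_F (finite_torus_measure R) (EFin \o F)^\-%E s)%E.
  apply/funext => s; rewrite [LHS]integralE; congr (_ - _)%E;
    by apply: eq_integral => x _; rewrite ?funeposE ?funenegE.
apply: emeasurable_funB; apply: measurable_fun_fubini_tonelli_F => //.
- exact: measurable_funepos.
- exact: measurable_funeneg.
Qed.

Lemma measurable_inner f u : spacetime_measurable f -> spacetime_measurable u ->
  measurable_fun D (fun s => inner (f s) (u s)).
Proof.
move=> mf mu.
have mF : measurable_fun setT (fun p : measurableTypeR R * X =>
    \sum_i slab f i p * slab u i p).
  by apply: measurable_sum => i; apply: measurable_funM; exact: measurable_slab.
have := measurable_partial_integral mF.
move=> /(measurableT_comp (fine_measurable (D := setT) measurableT)) h.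
apply: (eq_measurable_fun _ _ (measurable_funTS h)).
move=> s /set_mem Ds /=; congr fine; apply: eq_integral => x _; congr EFin.
by apply: eq_bigr => i _; rewrite !slabE.
Qed.

Lemma measurable_l2norm f : spacetime_measurable f ->
  measurable_fun D (fun s => l2norm (f s)).
Proof.
move=> mf.
have mF : measurable_fun setT (fun p : measurableTypeR R * X => \sum_i slab f i p ^+ 2).
  by apply: measurable_sum => i; apply: measurable_funX; exact: measurable_slab.
have := measurable_partial_integral mF.
move=> /(measurableT_comp (@measurable_poweR R 2^-1)) h.
apply: (eq_measurable_fun _ _ (measurable_funTS h)).
move=> s /set_mem Ds /=; rewrite l2normE; congr (_ `^ _)%E.
apply: eq_integral => x _; congr EFin.
by apply: eq_bigr => i _; rewrite slabE.
Qed.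

(** With [0 < B] the bound is meaningful also at the times when the norm of [f s] is
    infinite. *)
Lemma le_inner_l2norm f u s B : spacetime_measurable f -> D s -> inL2 (u s) ->
  vnrm (u s) <= B -> 0 < B ->
  (`|(inner (f s) (u s))%:E| <= B%:E * l2norm (f s))%E.
Proof.
move=> mf Ds Lu uB B0.
have [fy|] := boolP (l2norm (f s) < +oo)%E; last first.
  by rewrite -leNgt leye_eq => /eqP ->; rewrite mulry gtr0_sg// mul1e leey.
have Lf := l2norm_lty (spacetime_measurable_field mf Ds) fy.
rewrite l2norm_fin// lee_fin (le_trans (inner_le Lf Lu))// mulrC.
by rewrite ler_wpM2r ?vnrm_ge0.
Qed.

Section bounds.
Variables (f u : R -> torus_field R 'I_3) (B : R) (A : set (measurableTypeR R)).
Hypotheses (fL : inL1L2 f) (mu : spacetime_measurable u) (mA : measurable A)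
  (AD : A `<=` D) (Lu : forall s, A s -> inL2 (u s))
  (uB : forall s, A s -> vnrm (u s) <= B).

Lemma integrable_l2norm : leb.-integrable A (fun s => l2norm (f s)).
Proof.
apply: (integrableS measurable_unit_itv) => //.
apply/integrableP; split; first exact: measurable_l2norm fL.1.
by under eq_integral do rewrite gee0_abs ?l2norm_ge0//; exact: fL.2.
Qed.

Lemma integral_l2norm_fin : (\int[leb]_(s in A) l2norm (f s))%E \is a fin_num.
Proof. exact: integrable_fin_num integrable_l2norm. Qed.

Let mfu : measurable_fun A (fun s => inner (f s) (u s)).
Proof.
by apply: measurable_funS (measurable_inner fL.1 mu) => //; exact: measurable_unit_itv.
Qed.

Lemma integral_inner_le : (0 <= B) ->
  leb.-integrable A (fun s => (inner (f s) (u s))%:E) /\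
  `|\int[leb]_(s in A) inner (f s) (u s)| <= B * fine (\int[leb]_(s in A) l2norm (f s)).
Proof.
move=> B0.
have pos C : B < C -> (\int[leb]_(s in A) `|(inner (f s) (u s))%:E| <=
    C%:E * \int[leb]_(s in A) l2norm (f s))%E.
  move=> BC; have C0 : 0 < C by exact: le_lt_trans BC.
  have ml : measurable_fun A (fun s => l2norm (f s)).
    exact: measurable_int integrable_l2norm.
  rewrite -ge0_integralZl//; [|by move=> *; exact: l2norm_ge0|by rewrite lee_fin ltW].
  apply: ge0_le_integral => //.
  - by apply: measurableT_comp => //; exact/measurable_EFinP.
  - exact: measurable_funeM.
  - move=> s As; apply: le_inner_l2norm; [exact: fL.1|exact: AD|exact: Lu| |by []].
    by rewrite (le_trans (uB As))// ltW.
have fin := fineK integral_l2norm_fin.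
have int : leb.-integrable A (fun s => (inner (f s) (u s))%:E).
  apply/integrableP; split; first exact/measurable_EFinP.
  apply: le_lt_trans (pos (B + 1) _) _; first by rewrite ltrDl.
  by rewrite -fin -EFinM ltry.
split=> //; apply/ler_addgt0Pr => e e0.
move: fin; set I := fine (\int[leb]_(s in A) l2norm (f s))%E => fin.
have I0 : 0 <= I by rewrite fine_ge0// integral_ge0// => s _; exact: l2norm_ge0.
have c0 : 0 < I + 1 by rewrite ltr_wpDl.
rewrite -lee_fin EFin_normr_Rintegral//.
apply: le_trans (le_abse_integral _ _ _) _ => //; first exact/measurable_EFinP.
apply: le_trans (pos (B + e / (I + 1)) _) _; first by rewrite ltrDl divr_gt0.
rewrite -fin -EFinM lee_fin mulrDl lerD2l mulrAC ler_pdivrMr// ler_pM2l//; lra.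
Qed.

End bounds.

Lemma sub_unit_itv (t : R) : D t -> (`[0, t]%classic : set (measurableTypeR R)) `<=` D.
Proof.
by rewrite /unit_itv/= in_itv/= => /andP[_ t1]; apply: subset_itvl; rewrite bnd_simp.
Qed.

Lemma energy_le nu f u t : 0 <= nu -> (forall s, D s -> inL2 (u s)) ->
  energy_equality nu f u -> D t ->
  vnrm (u t) ^+ 2 <= vnrm (u 0) ^+ 2 + 2 * \int[leb]_(s in `[0, t]) inner (f s) (u s).
Proof.
move=> nu0 Lu E Dt.
have D0 : D 0 by rewrite /unit_itv/= in_itv/= lexx ler01.
have := E t Dt; rewrite !l2norm_fin//; [|exact: Lu..].
set I := (\int[_]_(s in _) _)%E; set F := \int[_]_(s in _) _.
have I0 : (0 <= (2 * nu)%:E * I)%E.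
  rewrite mule_ge0 ?lee_fin ?mulr_ge0// integral_ge0// => s _.
  by rewrite expe_ge0 ?l2norm_ge0.
move=> e; rewrite -lee_fin EFinD !EFin_expe e leeD2r//.
by rewrite -[leRHS]sube0 leeB.
Qed.

(** The supremum [S] of the norms up to time [t] satisfies [S ^ 2 <= h0 ^ 2 + 2 M S],
    hence [S <= h0 + 2 M], provided that it is finite.  Finiteness follows from the energy
    inequality itself: if the power of the force is integrable its integral bounds the
    norms, and if not, the integral is [0] by convention. *)
Lemma energy_bound nu f u t : 0 <= nu -> inL1L2 f -> inCwL2 u ->
  energy_equality nu f u -> D t ->
  vnrm (u t) <= vnrm (u 0) + 2 * fine (\int[leb]_(s in D) l2norm (f s)).
Proof.
move=> nu0 fL [mu Lu _] E Dt.
set M := fine _; set h0 := vnrm (u 0).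
have h00 : 0 <= h0 by exact: vnrm_ge0.
have M0 : 0 <= M by rewrite fine_ge0// integral_ge0// => s _; exact: l2norm_ge0.
have mDt : measurable (`[0, t]%classic : set (measurableTypeR R)) by exact: measurable_itv.
have sD := sub_unit_itv Dt.
have mphi : measurable_fun `[0, t] (fun s => inner (f s) (u s)).
  by apply: measurable_funS (measurable_inner fL.1 mu) => //; exact: measurable_unit_itv.
have [int|nint] := boolP (leb.-integrable `[0, t]
  (EFin \o (fun s => inner (f s) (u s)))); last first.
  have F0 : \int[leb]_(s in `[0, t]) inner (f s) (u s) = 0.
    have : (\int[leb]_(s in `[0%R, t]) (inner (f s) (u s))%:E)%E \isn't a fin_num.
      apply: contra nint; rewrite -integral_fin_num_abs// => h.
      by apply/integrableP; split => //; exact/measurable_EFinP.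
    by rewrite /Rintegral fin_numE negb_and !negbK => /orP[] /eqP ->.
  have := energy_le nu0 Lu E Dt; rewrite F0 mulr0 addr0 -/h0.
  rewrite ler_pXn2r ?nnegrE ?vnrm_ge0// => /le_trans; apply.
  by rewrite lerDl mulr_ge0.
pose S := [set vnrm (u s) | s in `[0, t]%classic].
pose Psi := \int[leb]_(s in `[0, t]) `|inner (f s) (u s)|.
have in0t s : (`[0, t]%classic : set R) s ->
    (`[0, s]%classic : set (measurableTypeR R)) `<=` `[0, t]%classic.
  by rewrite /= in_itv/= => /andP[_ st]; apply: subset_itvl; rewrite bnd_simp.
have Sub : ubound S (Num.sqrt (h0 ^+ 2 + 2 * Psi)).
  move=> _ [s st <-].
  rewrite -(ger0_norm (vnrm_ge0 (u s))) -sqrtr_sqr ler_wsqrtr//.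
  apply: le_trans (energy_le nu0 Lu E (sD _ st)) _; rewrite lerD2l ler_pM2l//.
  apply: le_trans (ler_norm _) _.
  have ints : leb.-integrable `[0, s] (EFin \o (fun s => inner (f s) (u s))).
    by apply: (integrableS mDt _ _ int); [exact: measurable_itv|exact: in0t].
  apply: le_trans (le_normr_Rintegral _ ints) _; first exact: measurable_itv.
  have intabs (A : set (measurableTypeR R)) :
      leb.-integrable A (EFin \o (fun s => inner (f s) (u s))) ->
      (\int[leb]_(s in A) `|inner (f s) (u s)|%:E)%E \is a fin_num.
    move=> /integrableP[_ fin]; rewrite ge0_fin_numE//.
    by apply: integral_ge0 => x _; rewrite lee_fin.
  rewrite /Psi fine_le ?intabs//.
  apply: ge0_subset_integral => //; last exact: in0t.
  by apply/measurable_EFinP; exact: measurableT_comp.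
have t0 : 0 <= t by move: Dt; rewrite /unit_itv/= in_itv/= => /andP[].
have Sne : S !=set0 by exists (vnrm (u t)); exists t => //=; rewrite in_itv/= t0 lexx.
have hS : has_sup S by split=> //; eexists; exact: Sub.
have hsup s : (`[0, t]%classic : set R) s -> vnrm (u s) <= sup S.
  by move=> st; apply: (ub_le_sup hS.2); exists s.
have S0 : 0 <= sup S.
  by apply: le_trans (vnrm_ge0 (u t)) (hsup t _); rewrite /= in_itv/= t0 lexx.
suff : sup S <= h0 + 2 * M.
  by apply: le_trans; apply: hsup; rewrite /= in_itv/= t0 lexx.
have key : sup S <= Num.sqrt (h0 ^+ 2 + 2 * M * sup S).
  apply: ge_sup => // _ [s st <-].
  rewrite -(ger0_norm (vnrm_ge0 (u s))) -sqrtr_sqr ler_wsqrtr//.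
  apply: le_trans (energy_le nu0 Lu E (sD _ st)) _; rewrite lerD2l -mulrA ler_pM2l//.
  apply: le_trans (ler_norm _) _.
  have sD' : (`[0, s]%classic : set (measurableTypeR R)) `<=` D.
    by apply: subset_trans sD; exact: in0t.
  have [_] := @integral_inner_le f u (sup S) `[0, s]%classic fL mu (measurable_itv _) sD'
    (fun s' h => Lu s' (sD' _ h)) (fun s' h => hsup _ (in0t _ st _ h)) S0.
  move=> /le_trans; apply; rewrite mulrC ler_wpM2r//.
  rewrite fine_le ?integral_l2norm_fin//; try exact: measurable_unit_itv.
  apply: ge0_subset_integral => //; try exact: measurable_unit_itv.
  - exact: measurable_l2norm fL.1.
  - by move=> s' _; exact: l2norm_ge0.
have key2 : sup S ^+ 2 <= h0 ^+ 2 + 2 * M * sup S.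
  rewrite -[leRHS]sqr_sqrtr ?ler_pXn2r ?nnegrE ?sqrtr_ge0//.
  by rewrite addr_ge0 ?sqr_ge0// !mulr_ge0.
rewrite leNgt; apply/negP => lt.
have : (h0 + 2 * M) * sup S < sup S ^+ 2.
  by rewrite expr2 ltr_pM2r//; lra.
have : h0 * h0 <= h0 * sup S by rewrite ler_wpM2l//; lra.
by move: key2; rewrite expr2 !mulrDl; lra.
Qed.

End time_integrals.

(** * Convergence of the power of the force *)

Section force_convergence.
Variable R : realType.
Local Notation torus := (torus_measure R).
Local Notation leb := (@lebesgue_measure R).
Local Notation D := (unit_itv R : set (measurableTypeR R)).
Implicit Types f u : R -> torus_field R 'I_3.

Lemma ae_inL2 f : inL1L2 f -> {ae leb, forall s, D s -> inL2 (f s)}.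
Proof.
move=> fL; have mD := (@measurable_unit_itv R).
have := integrable_ae mD (integrable_l2norm fL mD (@subset_refl _ _)).
apply: filterS => s h Ds; apply: l2norm_lty.
  exact: spacetime_measurable_field fL.1 Ds.
by have := h Ds; rewrite ge0_fin_numE ?l2norm_ge0.
Qed.

Variables (f_ u_ : nat -> R -> torus_field R 'I_3) (f u : R -> torus_field R 'I_3).
Variables (B : R) (A : set (measurableTypeR R)).
Hypotheses (f_L : forall n, inL1L2 (f_ n)) (fL : inL1L2 f).
Hypothesis f_cvg : (\int[leb]_(s in unit_itv R) l2norm (f_ n s - f s)%R)%E @[n --> \oo] --> 0%E.
Hypotheses (mu_ : forall n, spacetime_measurable (u_ n)) (mu : spacetime_measurable u).
Hypothesis Lu_ : forall n s, D s -> inL2 (u_ n s).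
Hypothesis u_B : forall n s, D s -> vnrm (u_ n s) <= B.
Hypothesis u_cvg : forall phi : torus_field R 'I_3, inL2 phi -> forall s, D s ->
  inner (u_ n s) phi @[n --> \oo] --> inner (u s) phi.
Hypotheses (mA : measurable A) (AD : A `<=` D).

Let D0 : D 0. Proof. by rewrite /unit_itv/= in_itv/= lexx ler01. Qed.
Let B0 : 0 <= B. Proof. exact: le_trans (vnrm_ge0 _) (u_B 0 D0). Qed.

(** Pointwise in time this is weak convergence; the powers are dominated by a multiple of
    the norm of [f]. *)
Lemma inner_force_cvg :
  \int[leb]_(s in A) inner (f s) (u_ n s) @[n --> \oo] -->
  \int[leb]_(s in A) inner (f s) (u s).
Proof.
have mD := (@measurable_unit_itv R).
have mi n : measurable_fun A (fun s => (inner (f s) (u_ n s))%:E).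
  apply/measurable_EFinP.
  by apply: measurable_funS (measurable_inner fL.1 (mu_ n)) => //.
have mi' : measurable_fun A (fun s => (inner (f s) (u s))%:E).
  apply/measurable_EFinP.
  by apply: measurable_funS (measurable_inner fL.1 mu) => //.
have B1 : 0 < B + 1 by rewrite ltr_wpDl.
have il := integrable_l2norm fL mA AD.
have ig : leb.-integrable A (fun s => (B + 1)%:E * l2norm (f s))%E by exact: integrableZl.
have cv : {ae leb, forall s, A s ->
    (fun n => (inner (f s) (u_ n s))%:E) @ \oo --> (inner (f s) (u s))%:E}.
  apply: filterS (ae_inL2 fL) => s Lf As.
  apply/cvg_EFin; first exact: nearW.
  rewrite innerC; under eq_fun do rewrite innerC.
  by apply: u_cvg; [apply: Lf|]; exact: AD.
have dom : {ae leb, forall s n, A s ->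
   (`|(inner (f s) (u_ n s))%:E| <= (B + 1)%:E * l2norm (f s))%E}.
  apply: aeW => s n As; apply: le_inner_l2norm => //;
    [exact: fL.1|exact: AD|exact: Lu_ (AD As)|].
  by rewrite (le_trans (u_B n (AD As)))// lerDl.
have [iu _ c] := dominated_convergence mA mi mi' cv ig dom.
rewrite /Rintegral.
apply: (@fine_cvg _ _ _ _ _ (fine (\int[leb]_(s in A) (inner (f s) (u s))%:E))).
by rewrite fineK ?integrable_fin_num.
Qed.

(** The velocities are bounded in [L^2], so replacing [f_ n] by [f] costs at most a
    multiple of the distance between the forces. *)
Lemma force_cvg :
  \int[leb]_(s in A) inner (f_ n s) (u_ n s) @[n --> \oo] -->
  \int[leb]_(s in A) inner (f s) (u s).
Proof.
have mD := (@measurable_unit_itv R).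
have u_B' n s : A s -> vnrm (u_ n s) <= B by move=> /AD; exact: u_B.
have Lu_' n s : A s -> inL2 (u_ n s) by move=> /AD; exact: Lu_.
have fin : \forall n \near \oo,
    (\int[leb]_(s in unit_itv R) l2norm (f_ n s - f s)%R)%E \is a fin_num.
  exact: cvg_is_fine f_cvg.
have d0 : fine (\int[leb]_(s in unit_itv R) l2norm (f_ n s - f s)%R)%E @[n --> \oo] --> (0 : R).
  exact: (fine_cvg f_cvg).
have le n : (\int[leb]_(s in unit_itv R) l2norm (f_ n s - f s)%R)%E \is a fin_num ->
   `|\int[leb]_(s in A) inner (f_ n s) (u_ n s) - \int[leb]_(s in A) inner (f s) (u_ n s)| <=
   B * fine (\int[leb]_(s in unit_itv R) l2norm (f_ n s - f s)%R)%E.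
  move=> fn.
  have dL : inL1L2 (fun s => f_ n s - f s).
    split; first exact: spacetime_measurableB (f_L n).1 fL.1.
    by rewrite -ge0_fin_numE// integral_ge0// => s _; exact: l2norm_ge0.
  have [i1 _] := integral_inner_le (f_L n) (mu_ n) mA AD (Lu_' n) (u_B' n) B0.
  have [i2 _] := integral_inner_le fL (mu_ n) mA AD (Lu_' n) (u_B' n) B0.
  have [i3 b3] := integral_inner_le dL (mu_ n) mA AD (Lu_' n) (u_B' n) B0.
  rewrite -RintegralB//.
  have -> : \int[leb]_(s in A) (inner (f_ n s) (u_ n s) - inner (f s) (u_ n s)) =
      \int[leb]_(s in A) inner (f_ n s - f s) (u_ n s).
    congr fine; apply: ae_eq_integral => //.
    - by under eq_fun do rewrite EFinB; apply: emeasurable_funB;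
        [exact: measurable_int i1|exact: measurable_int i2].
    - exact: measurable_int i3.
    - have [L1 L2] := (ae_inL2 (f_L n), ae_inL2 fL).
      apply: filterS2 L1 L2 => s h1 h2 As.
      by rewrite innerBl//; [exact: h1 (AD As)|exact: h2 (AD As)|exact: Lu_'].
  apply: le_trans b3 _; rewrite ler_wpM2l// fine_le//.
    exact: integral_l2norm_fin.
  apply: ge0_subset_integral => //.
  - exact: measurable_l2norm dL.1.
  - by move=> s _; exact: l2norm_ge0.
have dcv : \int[leb]_(s in A) inner (f_ n s) (u_ n s) -
    \int[leb]_(s in A) inner (f s) (u_ n s) @[n --> \oo] --> (0 : R).
  apply/cvgr0Pnorm_le => e e0.
  have e1 : 0 < e / (B + 1) by rewrite divr_gt0// ltr_wpDl.
  have /cvgr0_norm_le/(_ _ e1) d0e := d0.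
  near=> n; apply: le_trans (le n _) _; first by near: n.
  have I0 : 0 <= fine (\int[leb]_(s in unit_itv R) l2norm (f_ n s - f s)%R)%E.
    by rewrite fine_ge0// integral_ge0// => s _; exact: l2norm_ge0.
  have : `|fine (\int[leb]_(s in unit_itv R) l2norm (f_ n s - f s)%R)%E| <= e / (B + 1).
    by near: n.
  rewrite ger0_norm// ler_pdivlMr ?ltr_wpDl//; nra.
have -> : (fun n => \int[leb]_(s in A) inner (f_ n s) (u_ n s)) =
    (fun n => (\int[leb]_(s in A) inner (f_ n s) (u_ n s) -
      \int[leb]_(s in A) inner (f s) (u_ n s)) + \int[leb]_(s in A) inner (f s) (u_ n s)).
  by apply/funext => n; rewrite subrK.
by rewrite -[X in _ --> X]add0r; exact: cvgD dcv inner_force_cvg.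
Unshelve. all: by end_near. Qed.

End force_convergence.

(** * Dissipation *)

Section dissipation.
Variable R : realType.
Local Notation torus := (torus_measure R).
Local Notation leb := (@lebesgue_measure R).
Local Notation D := (unit_itv R : set (measurableTypeR R)).
Implicit Types f u : R -> torus_field R 'I_3.

(** [B] is the sum of the geometric series [\sum_q 2 ^ q.+1 * (K * r ^ q)], convergent as
    [r < 1 / 2], and there are nine partial derivatives.  A field that has no weak gradient
    is given the gradient [0]. *)
Lemma grad_l2norm_le (rho : R -> R) (v : torus_field R 'I_3) (K r : R) :
  lp_cutoff rho -> inL2 v -> 0 <= r -> r < 2^-1 -> 0 <= K ->
  (forall i q, nrm torus (block rho (v i) q) <= K * r ^+ q) ->
  (l2norm (grad v) ^+ 2 <= (9 * (2 * K / (1 - 2 * r)) ^+ 2)%:E)%E.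
Proof.
move=> rhoc Lv r0 r2 K0 vK; set B := 2 * K / _.
have B0 : 0 <= B by rewrite /B divr_ge0 ?mulr_ge0 ?subr_ge0//; lra.
have [[G wG]|noG] := pselect (exists G, is_weak_gradient v G); last first.
  have -> : grad v = (fun _ _ => 0) by apply: xgetPN => G wG; apply: noG; exists G.
  have L0 : inL2 (fun (_ : 'I_3 * 'I_3) (_ : R * R * R) => 0 : R) by move=> i; exact: L2_0.
  rewrite l2norm_fin// -EFin_expe vnrm_sqr lee_fin inner_sqr// big1 => [|i _].
    by rewrite mulr_ge0 ?sqr_ge0.
  rewrite nrm_sqr /ip; under eq_Rintegral do rewrite mulr0.
  by rewrite Rintegral_cst// mul0r.
have wgrad : is_weak_gradient v (grad v) by exact: (xgetPex _ (ex_intro _ G wG)).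
have Lg : inL2 (grad v) := wgrad.1.
rewrite l2norm_fin// -EFin_expe vnrm_sqr lee_fin inner_sqr//.
apply: (@le_trans _ _ (\sum_(i : 'I_3 * 'I_3) B ^+ 2)); last first.
  by rewrite sumr_const card_prod card_ord -[_ *+ _]mulr_natl.
apply: ler_sum => -[i j] _; rewrite lerXn2r ?nnegrE ?nrm_ge0//.
apply: (@gradient_nrm_le R rho v (grad v) i j (fun q => K * r ^+ q) B rhoc (Lv i) wgrad) => //.
move=> n.
have -> : \sum_(q < n) lp_lambda R q.+1 * (K * r ^+ q) = 2 * K * \sum_(q < n) (2 * r) ^+ q.
  rewrite big_distrr; apply: eq_bigr => q _.
  by rewrite /lp_lambda exprS exprMn; move: (2 ^+ q) (r ^+ q) => y z /=; ring.
by rewrite /B ler_wpM2l ?mulr_ge0// sum_geometric_le// mulr_ge0//=; lra.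
Qed.

(** Intervals open on the left make this additive in the interval. *)
Definition dissipation u a b : R :=
  fine (\int[leb]_(s in `]a, b]) l2norm (grad (u s)) ^+ 2)%E.

Lemma sub_itv_unit a b : 0 <= a -> b <= 1 ->
  (`]a, b]%classic : set (measurableTypeR R)) `<=` D.
Proof.
move=> a0 b1 s; rewrite /unit_itv/= !in_itv/= => /andP[as_ sb].
by rewrite (le_trans a0 (ltW as_)) (le_trans sb b1).
Qed.

Section solution.
Variables (nu : R) (f u : R -> torus_field R 'I_3).
Hypotheses (nu0 : 0 < nu) (fL : inL1L2 f) (ws : weak_solution nu f u)
  (en : energy_equality nu f u).

Let uC : inCwL2 u. Proof. by have [] := ws. Qed.
Let Lu s : D s -> inL2 (u s). Proof. by have [_ h _] := uC; exact: h. Qed.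
Let mu : spacetime_measurable u. Proof. by have [] := uC. Qed.

Lemma integrable_grad (A : set (measurableTypeR R)) : measurable A -> A `<=` D ->
  leb.-integrable A (fun s => l2norm (grad (u s)) ^+ 2)%E.
Proof.
move=> mA AD; have [_ [_ _ _ ig] _ _] := ws.
by apply: (integrableS (@measurable_unit_itv R) mA AD ig).
Qed.

Lemma dissipationE a b : 0 <= a -> b <= 1 ->
  (\int[leb]_(s in `]a, b]) l2norm (grad (u s)) ^+ 2)%E = (dissipation u a b)%:E.
Proof.
move=> a0 b1; rewrite fineK//; apply: integrable_fin_num; first exact: measurable_itv.
by apply: integrable_grad; [exact: measurable_itv|exact: sub_itv_unit].
Qed.

Lemma dissipation_ge0 a b : 0 <= dissipation u a b.
Proof. by rewrite fine_ge0// integral_ge0// => s _; rewrite expe_ge0// l2norm_ge0. Qed.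

Lemma integrable_power : leb.-integrable D (fun s => (inner (f s) (u s))%:E).
Proof.
have mD := @measurable_unit_itv R.
have [] := integral_inner_le fL mu mD (@subset_refl _ _) Lu
  (fun s h => energy_bound (ltW nu0) fL uC en h) => //.
rewrite addr_ge0 ?vnrm_ge0// mulr_ge0// fine_ge0// integral_ge0// => s _.
exact: l2norm_ge0.
Qed.

Lemma energy_increment a b : 0 <= a -> a <= b -> b <= 1 ->
  vnrm (u b) ^+ 2 = vnrm (u a) ^+ 2 - 2 * nu * dissipation u a b +
    2 * \int[leb]_(s in `]a, b]) inner (f s) (u s).
Proof.
move=> a0 ab b1.
have Da : D a by rewrite /unit_itv/= in_itv/= a0 (le_trans ab b1).
have Db : D b by rewrite /unit_itv/= in_itv/= b1 (le_trans a0 ab).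
have D0 : D 0 by rewrite /unit_itv/= in_itv/= lexx ler01.
have m0 t : measurable (`[0, t]%classic : set (measurableTypeR R)) by exact: measurable_itv.
have ma : measurable (`]a, b]%classic : set (measurableTypeR R)) by exact: measurable_itv.
have split0 : (`[0, b]%classic : set (measurableTypeR R)) = `[0, a]%classic `|` `]a, b]%classic.
  by rewrite -itv_bndbnd_setU// bnd_simp.
have disj : [disjoint (`[0, a]%classic : set (measurableTypeR R)) & `]a, b]%classic].
  apply/disj_setPS => s [/=]; rewrite !in_itv/= => /andP[_ h] /andP[h' _].
  by move: (lt_le_trans h' h); rewrite ltxx.
have iD0 t : D t -> leb.-integrable `[0, t] (fun s => l2norm (grad (u s)) ^+ 2)%E.
  by move=> Dt; apply: integrable_grad => //; exact: sub_unit_itv.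
have real t : D t -> vnrm (u t) ^+ 2 = vnrm (u 0) ^+ 2 - 2 * nu *
    fine (\int[leb]_(s in `[0%R, t]) l2norm (grad (u s)) ^+ 2)%E +
    2 * \int[leb]_(s in `[0, t]) inner (f s) (u s).
  move=> Dt; have := en Dt; rewrite !l2norm_fin; [|exact: Lu..].
  have <- := fineK (integrable_fin_num (m0 t) (iD0 t Dt)).
  by rewrite -!EFin_expe -EFinM -EFinB -EFinD => -[].
rewrite (real b Db) (real a Da).
have -> : fine (\int[leb]_(s in `[0%R, b]) l2norm (grad (u s)) ^+ 2)%E =
  fine (\int[leb]_(s in `[0%R, a]) l2norm (grad (u s)) ^+ 2)%E + dissipation u a b.
  rewrite split0 integral_setU//; last by rewrite -split0; exact: measurable_int (iD0 b Db).
  by rewrite dissipationE// fineD// integrable_fin_num//; exact: iD0.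
have -> : \int[leb]_(s in `[0, b]) inner (f s) (u s) =
  \int[leb]_(s in `[0, a]) inner (f s) (u s) + \int[leb]_(s in `]a, b]) inner (f s) (u s).
  rewrite split0 Rintegral_setU// -split0.
  by apply: (integrableS (@measurable_unit_itv R) (m0 b) (sub_unit_itv Db) integrable_power).
ring.
Qed.

Lemma dissipation_le a b C : 0 <= a -> a <= b -> b <= 1 -> 0 <= C ->
  (forall s, a < s <= b -> (l2norm (grad (u s)) ^+ 2 <= C%:E)%E) ->
  dissipation u a b <= C.
Proof.
move=> a0 ab b1 C0 gC; rewrite -lee_fin -dissipationE//.
have ma : measurable (`]a, b]%classic : set (measurableTypeR R)) by exact: measurable_itv.
apply: (@le_trans _ _ (\int[leb]_(s in `]a, b]) C%:E)%E).
  apply: ge0_le_integral => //.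
  - by move=> s _; rewrite expe_ge0// l2norm_ge0.
  - exact: measurable_int (integrable_grad ma (sub_itv_unit a0 b1)).
have lm : (leb `]a, b]%classic <= 1)%E.
  rewrite lebesgue_measure_itv/= lte_fin; case: ifPn => _; last by rewrite lee_fin.
  by rewrite -EFinB lee_fin; lra.
rewrite integral_cst// -[leRHS]mule1.
by apply: (lee_wpmul2l _ lm); rewrite lee_fin.
Qed.

End solution.

End dissipation.

(** * Vanishing of the dissipation when the limit is continuous *)

Section no_anomaly.
Variable R : realType.
Local Notation torus := (torus_measure R).
Local Notation leb := (@lebesgue_measure R).
Local Notation D := (unit_itv R : set (measurableTypeR R)).

Definition place (i : 'I_3) (p : R * R * R -> R) : torus_field R 'I_3 :=
  fun j x => if j == i then p x else 0.

Lemma inL2_place i p : L2 torus p -> inL2 (place i p).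
Proof. by move=> Lp j; rewrite /place; case: eqP => _ //; exact: L2_0. Qed.

Lemma inner_place v i p : inL2 v -> L2 torus p -> inner v (place i p) = ip torus (v i) p.
Proof.
move=> Lv Lp; rewrite innerE//; last exact: inL2_place.
rewrite (bigD1 i)//= big1 ?addr0 => [|j ji].
  by rewrite /place eqxx.
rewrite /place (negbTE ji) /ip; under eq_Rintegral do rewrite mulr0.
by rewrite Rintegral_cst// mul0r.
Qed.

(** By duality only the zero field is orthogonal to all trigonometric polynomials. *)
Lemma exists_detecting_mode (v : torus_field R 'I_3) : inL2 v -> 0 < vnrm v ->
  exists i s, ip torus (v i) (trigpoly s) != 0.
Proof.
move=> Lv v0; apply: contrapT => h.
suff : inner v v = 0 by move=> E; move: v0; rewrite /vnrm E sqrtr0 ltxx.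
rewrite inner_sqr// big1// => i _.
suff : nrm torus (v i) <= 0.
  by move=> h1; rewrite (_ : nrm torus (v i) = 0) ?expr0n//; apply/le_anti; rewrite h1 nrm_ge0.
apply: (nrm_dual_le (Lv i)) => // p [s ->]; rewrite mul0r.
apply: contrapT => /negP; rewrite -ltNge => hs; apply: h; exists i, s.
by rewrite gt_eqF.
Qed.

Variables (rho : R -> R) (rho_cutoff : lp_cutoff rho).
Variables (nu_ : nat -> R) (f_ u_ : nat -> R -> torus_field R 'I_3).
Variables (f u : R -> torus_field R 'I_3) (B c r : R).
Hypothesis nu_gt0 : forall n, 0 < nu_ n.
Hypothesis nu_cvg0 : nu_ n @[n --> \oo] --> (0 : R).
Hypothesis u_ws : forall n, weak_solution (nu_ n) (f_ n) (u_ n).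
Hypothesis u_energy : forall n, energy_equality (nu_ n) (f_ n) (u_ n).
Hypotheses (f_L : forall n, inL1L2 (f_ n)) (fL : inL1L2 f).
Hypothesis f_cvg :
  (\int[leb]_(s in unit_itv R) l2norm (f_ n s - f s)%R)%E @[n --> \oo] --> 0%E.
Hypothesis uC : inCwL2 u.
Hypothesis u_cvg : forall phi : torus_field R 'I_3, inL2 phi -> forall e, 0 < e ->
  \forall n \near \oo, forall s, D s -> `|inner (u_ n s) phi - inner (u s) phi| <= e.
Hypothesis u0_cvg : vnrm (u_ n 0 - u 0) @[n --> \oo] --> (0 : R).
Hypothesis u_B : forall n s, D s -> vnrm (u_ n s) <= B.
Hypotheses (c_ge0 : 0 <= c) (r_gt0 : 0 < r) (r_lt : r < 2^-1).
Hypothesis localized : forall n s, D s -> exists k : nat, forall i q,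
  nrm torus (block rho (u_ n s i) q) <= c * r ^+ `|q - k|%N.
Hypothesis u_continuous : forall t, D t -> forall e, 0 < e -> exists2 d, 0 < d &
  forall s, D s -> `|s - t| < d -> `|vnrm (u s) - vnrm (u t)| <= e.

Let Lu_ n s : D s -> inL2 (u_ n s).
Proof. by have [[_ h _] _ _ _] := u_ws n; exact: h. Qed.
Let mu_ n : spacetime_measurable (u_ n).
Proof. by have [[]] := u_ws n. Qed.
Let Lu s : D s -> inL2 (u s). Proof. by have [_ h _] := uC; exact: h. Qed.
Let mu : spacetime_measurable u. Proof. by have [] := uC. Qed.

Let DE s : D s = (0 <= s <= 1) :> Prop.
Proof. by rewrite /unit_itv/= in_itv. Qed.

Let u_cvg_at phi s : inL2 phi -> D s -> inner (u_ n s) phi @[n --> \oo] --> inner (u s) phi.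
Proof.
move=> Lphi Ds; apply/cvgrPdist_le => e e0.
apply: filterS (u_cvg Lphi e0) => n h; rewrite distrC; exact: h.
Qed.

Let power a b := \int[leb]_(s in `]a, b]) inner (f s) (u s).

Let power_cvg a b : 0 <= a -> b <= 1 ->
  \int[leb]_(s in `]a, b]) inner (f_ n s) (u_ n s) @[n --> \oo] --> power a b.
Proof.
move=> a0 b1; have mab : measurable (`]a, b]%classic : set (measurableTypeR R)).
  exact: measurable_itv.
exact: (force_cvg f_L fL f_cvg mu_ mu Lu_ u_B
  (fun phi Lphi s Ds => u_cvg_at Lphi Ds) mab (sub_itv_unit a0 b1)).
Qed.

(** Near [t] the fields have a nonnegligible component along a fixed trigonometric
    polynomial, which rules out high centers of localization.  Decay away from a
    bounded center is decay in [q]. *)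
Lemma localization_bounded t : D t -> 0 < vnrm (u t) -> exists2 d, 0 < d &
  exists2 K, 0 <= K & \forall n \near \oo, forall s, D s -> `|s - t| < d ->
    forall i q, nrm torus (block rho (u_ n s i) q) <= K * r ^+ q.
Proof.
move=> Dt ut; have [i [p pi0]] := exists_detecting_mode (Lu Dt) ut.
have Lp : L2 torus (trigpoly p) by apply: L2_trigonometric; exists p.
have Lphi := inL2_place i Lp.
(* Of the size [4 kappa] of the pairing at time [t], moving to the time [s] loses
   [kappa] and passing from [u] to [u_ n] loses another [kappa]. *)
pose kappa := `|ip torus (u t i) (trigpoly p)| / 4.
have kappa0 : 0 < kappa by rewrite divr_gt0// normr_gt0.
have [d d0 hd] : exists2 d, 0 < d & forall s, D s -> `|s - t| < d ->
    `|inner (u s) (place i (trigpoly p)) - inner (u t) (place i (trigpoly p))| <= kappa.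
  have [_ _ /(_ _ Lphi) /subspace_continuousP/(_ t Dt)] := uC.
  move=> /cvgrPdist_le/(_ _ kappa0).
  rewrite near_withinE => /nbhs_ballP[d /= d0 hd]; exists d => // s Ds sd.
  by rewrite distrC; apply: hd => //; rewrite /ball/= distrC.
have [N bN] := trigpoly_bandlimited p.
have [Q hQ] := frequency_le rho_cutoff r_gt0 r_lt bN c_ge0 kappa0.
exists d => //; exists (c * r^-1 ^+ Q).
  by rewrite mulr_ge0// exprn_ge0// invr_ge0 ltW.
apply: filterS (u_cvg Lphi kappa0) => n hn s Ds sd j q.
have [k hk] := localized n Ds.
have kQ : (k <= Q)%N.
  apply: (hQ (u_ n s i) k (Lu_ n Ds i) (hk i)).
  have := hn s Ds; have := hd s Ds sd.
  rewrite !(inner_place _ (Lu Ds) Lp) !(inner_place _ (Lu Dt) Lp).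
  rewrite !(inner_place _ (Lu_ n Ds) Lp).
  set x := ip torus (u s i) _; set y := ip torus (u t i) _; set z := ip torus (u_ n s i) _.
  move=> h1 h2; have : `|y| <= `|z| + (`|z - x| + `|x - y|).
    rewrite -lerBlDl (le_trans (lerB_dist _ _))// distrC (le_trans _ (ler_normD _ _))//.
    by rewrite addrA subrK.
  have -> : `|y| = 4 * kappa by rewrite /kappa mulrC divfK.
  by lra.
apply: le_trans (hk j q) _; rewrite -mulrA ler_wpM2l//.
exact: expr_dist_le.
Qed.

Lemma vnrm_cvg s : D s -> vnrm (u_ n s - u s) @[n --> \oo] --> (0 : R) ->
  vnrm (u_ n s) ^+ 2 @[n --> \oo] --> vnrm (u s) ^+ 2.
Proof.
move=> Ds h.
have c1 : vnrm (u_ n s) @[n --> \oo] --> vnrm (u s).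
  apply/cvgrPdist_le => e e0; move/cvgr0_norm_le/(_ _ e0) : h; apply: filterS => n.
  rewrite ger0_norm ?vnrm_ge0// => /(le_trans _); apply.
  by rewrite distrC vnrm_dist_le//; [exact: Lu_|exact: Lu].
exact: (cvgM c1 c1).
Qed.

Lemma localized_vnrm_cvg s K : D s -> 0 <= K ->
  (\forall n \near \oo, forall i q, nrm torus (block rho (u_ n s i) q) <= K * r ^+ q) ->
  vnrm (u_ n s - u s) @[n --> \oo] --> (0 : R).
Proof.
move=> Ds K0 hK.
rewrite -[X in _ --> X]sqrtr0; apply: continuous_cvg; first exact: sqrt_continuous.
have -> : (fun n => inner (u_ n s - u s) (u_ n s - u s)) = (fun n =>
    \sum_(i < 3) nrm torus (fun x => u_ n s i x - u s i x) ^+ 2).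
  by apply/funext => n; rewrite inner_sqr//; apply: inL2B; [exact: Lu_|exact: Lu].
apply: cvg_sum0 => i.
have h : nrm torus (fun x => u_ n s i x - u s i x) @[n --> \oo] --> (0 : R).
  apply: (localized_cvg rho_cutoff r_gt0 r_lt _ _ K0).
  - by move=> n; exact: Lu_.
  - exact: (Lu Ds).
  - move=> p Lp; have := u_cvg_at (inL2_place i Lp) Ds.
    rewrite (inner_place _ (Lu Ds) Lp).
    have -> // : (fun n => inner (u_ n s) (place i p)) = (fun n => ip torus (u_ n s i) p).
    by apply/funext => n; exact: inner_place (Lu_ n Ds) Lp.
  - by apply: filterS hK => n; exact.
by rewrite -[X in _ --> X](mulr0 (0 : R)); exact: (cvgM h h).
Qed.

(** The gradients are bounded near [t], so the viscous term tends to [0], and the norms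
    at [a] and [b] converge because the convergence there is strong. *)
Lemma local_energy_balance t : D t -> 0 < vnrm (u t) -> exists2 d, 0 < d & forall a b,
  0 <= a -> t - d < a -> a <= t -> t <= b -> b < t + d -> b <= 1 ->
  vnrm (u b) ^+ 2 - vnrm (u a) ^+ 2 = 2 * power a b.
Proof.
move=> Dt ut; have [d d0 [K K0 hK]] := localization_bounded Dt ut.
exists d => // a b a0 ta a_t tb bt b1; have ab := le_trans a_t tb.
have near_t s : a <= s <= b -> D s /\ `|s - t| < d.
  move=> /andP[as_ sb]; rewrite DE ltr_norml; split; first by lra.
  by apply/andP; split; lra.
have cv s : a <= s <= b -> vnrm (u_ n s) ^+ 2 @[n --> \oo] --> vnrm (u s) ^+ 2.
  move=> /near_t[Ds sd]; apply: vnrm_cvg => //; apply: (localized_vnrm_cvg Ds K0).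
  by apply: filterS hK => n; exact.
pose C := 9 * (2 * K / (1 - 2 * r)) ^+ 2.
have C0 : 0 <= C by rewrite mulr_ge0 ?sqr_ge0.
have dis : nu_ n * dissipation (u_ n) a b @[n --> \oo] --> (0 : R).
  apply: (@squeeze_cvgr _ _ _ _ (cst 0) (fun n => C * nu_ n)).
  - apply: filterS hK => n hn; apply/andP; split.
      by rewrite mulr_ge0 ?dissipation_ge0// ltW.
    rewrite (mulrC C); apply: ler_wpM2l; first exact: ltW.
    apply: (dissipation_le (u_ws n) a0 ab b1 C0) => s /andP[as_ sb].
    have [Ds sd] := near_t s (introT andP (conj (ltW as_) sb)).
    by apply: (grad_l2norm_le rho_cutoff (Lu_ n Ds) (ltW r_gt0) r_lt K0); exact: hn.
  - exact: cvg_cst.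
  - exact: cvg0Ml.
have lim1 : vnrm (u_ n b) ^+ 2 - vnrm (u_ n a) ^+ 2 @[n --> \oo] -->
    vnrm (u b) ^+ 2 - vnrm (u a) ^+ 2.
  by apply: cvgB; apply: cv; rewrite lexx ab.
have lim2 : - 2 * (nu_ n * dissipation (u_ n) a b) +
    2 * \int[leb]_(s in `]a, b]) inner (f_ n s) (u_ n s) @[n --> \oo] --> 0 + 2 * power a b.
  apply: cvgD; first exact: cvg0Ml.
  by apply: cvgM; [exact: cvg_cst|exact: power_cvg].
rewrite add0r in lim2.
have E : (fun n => vnrm (u_ n b) ^+ 2 - vnrm (u_ n a) ^+ 2) =
  (fun n => - 2 * (nu_ n * dissipation (u_ n) a b) +
    2 * \int[leb]_(s in `]a, b]) inner (f_ n s) (u_ n s)).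
  apply/funext => n.
  by rewrite (energy_increment (nu_gt0 n) (f_L n) (u_ws n) (@u_energy n) a0 ab b1); ring.
rewrite E in lim1.
exact: (cvg_unique _ lim1 lim2).
Qed.

(** The local balances do not reach the times at which [u] vanishes; strong continuity
    of [u] bridges them. *)
Lemma limit_energy_balance : vnrm (u 1) ^+ 2 - vnrm (u 0) ^+ 2 = 2 * power 0 1.
Proof.
have uB s : D s -> vnrm (u s) <= B.
  move=> Ds; have [u0|u0] := leP (vnrm (u s)) 0.
    by apply: le_trans u0 (le_trans (vnrm_ge0 _) (u_B 0 Ds)).
  rewrite -(ler_pM2r u0) -expr2 vnrm_sqr.
  have h := u_cvg_at (Lu Ds) Ds.
  rewrite -(cvg_lim _ h)//; apply: limr_le; first by apply/cvg_ex; eexists; exact: h.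
  apply: nearW => n; apply: le_trans (ler_norm _) _.
  apply: le_trans (inner_le (Lu_ n Ds) (Lu Ds)) _.
  by rewrite ler_wpM2r ?vnrm_ge0// u_B.
have m a b : measurable (`]a, b]%classic : set (measurableTypeR R)) by exact: measurable_itv.
have splitI a b d : a <= b -> b <= d ->
    (`]a, d]%classic : set (measurableTypeR R)) = `]a, b]%classic `|` `]b, d]%classic.
  by move=> ab bd; rewrite -itv_bndbnd_setU// bnd_simp.
have disj a b d : [disjoint (`]a, b]%classic : set (measurableTypeR R)) & `]b, d]%classic].
  apply/disj_setPS => s [/=]; rewrite !in_itv/= => /andP[_ h] /andP[h' _].
  by move: (lt_le_trans h' h); rewrite ltxx.
have sub a b : 0 <= a -> b <= 1 -> (`]a, b]%classic : set (measurableTypeR R)) `<=` D.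
  exact: sub_itv_unit.
pose Phi a b := fine (\int[leb]_(s in `]a, b]) l2norm (f s))%E.
apply: (@energy_balance R (fun s => vnrm (u s)) power Phi).
- by move=> t _; exact: vnrm_ge0.
- move=> t t01 e e0; have Dt : D t by rewrite DE.
  have [d d0 hd] := u_continuous Dt e0.
  by exists d => // s s01 sd; apply: (hd s) sd; rewrite DE.
- by move=> a b *; rewrite fine_ge0// integral_ge0// => s _; exact: l2norm_ge0.
- move=> a b d a0 ab bd d1; rewrite /Phi (splitI a b d)// integral_setU//.
    by rewrite fineD//; apply: integral_l2norm_fin => //; apply: sub; lra.
  rewrite -splitI//; have iL := integrable_l2norm fL (m a d) (sub a d a0 d1).
  exact: measurable_int iL.
- move=> a b d a0 ab bd d1; rewrite /power (splitI a b d)// Rintegral_setU//.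
  rewrite -splitI//.
  have B0 : 0 <= B by apply: le_trans (vnrm_ge0 _) (u_B 0 (_ : D 0)); rewrite DE; lra.
  have [] := @integral_inner_le R f u B _ fL mu (m a d) (sub a d a0 d1)
    (fun s h => Lu (sub a d a0 d1 _ h)) (fun s h => uB s (sub a d a0 d1 _ h)) B0.
  by [].
- move=> a b M a0 ab b1 hM.
  have M0 : 0 <= M by apply: le_trans (vnrm_ge0 _) (hM a _); rewrite lexx ab.
  have [] := @integral_inner_le R f u M _ fL mu (m a b) (sub a b a0 b1)
    (fun s h => Lu (sub a b a0 b1 _ h)) _ M0.
    by move=> s /=; rewrite in_itv/= => /andP[as_ sb]; apply: hM; rewrite (ltW as_).
  by [].
- by move=> t t01 ut; apply: local_energy_balance => //; rewrite DE.
Qed.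

(** Subtract the balance of the limit from the energy equality on [[0, 1]].  At time [1]
    the convergence is only weak, and the norm is lower semicontinuous. *)
Theorem dissipation_vanishes e : 0 < e ->
  \forall n \near \oo, nu_ n * dissipation (u_ n) 0 1 <= e.
Proof.
move=> e0; have D0 : D 0 by rewrite DE; lra.
have D1 : D 1 by rewrite DE; lra.
have e4 : 0 < e / 4 by lra.
have /cvgrPdist_le/(_ _ e4) h0 := vnrm_cvg D0 u0_cvg.
have h1 := u_cvg (Lu D1) e4.
have /cvgrPdist_le/(_ _ e4) hp := power_cvg (lexx 0) (lexx 1).
near=> n.
have E := energy_increment (nu_gt0 n) (f_L n) (u_ws n) (@u_energy n)
  (lexx 0) (@ler01 R) (lexx 1).
have L := limit_energy_balance.
have n0 : `|vnrm (u 0) ^+ 2 - vnrm (u_ n 0) ^+ 2| <= e / 4 by near: n.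
have n1 : `|inner (u_ n 1) (u 1) - inner (u 1) (u 1)| <= e / 4.
  by near: n; apply: filterS h1 => n; exact.
have n2 : `|power 0 1 - \int[leb]_(s in `]0, 1]) inner (f_ n s) (u_ n s)| <= e / 4 by near: n.
have sq : 2 * inner (u_ n 1) (u 1) - inner (u 1) (u 1) <= vnrm (u_ n 1) ^+ 2.
  have := inner_ge0 (u_ n 1 - u 1); have Ln := Lu_ n D1; have L1 := Lu D1.
  rewrite innerBl//; last exact: inL2B.
  rewrite !innerBr// (innerC (u 1) (u_ n 1)) vnrm_sqr; lra.
rewrite -vnrm_sqr in n1 sq.
move: n0 n1 n2 E L sq; rewrite !ler_norml => /andP[? ?] /andP[? ?] /andP[? ?].
by lra.
Unshelve. all: by end_near. Qed.

End no_anomaly.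

(** * Vanishing viscosity along a sequence *)

Section passing_to_sequences.
Variable R : realType.
Local Notation leb := (@lebesgue_measure R).
Local Notation D := (unit_itv R : set (measurableTypeR R)).

Lemma l2norm_triangle (v w : torus_field R 'I_3) : measurable_field v -> measurable_field w ->
  (l2norm v <= l2norm w + l2norm (v - w)%R)%E.
Proof.
move=> mv mw; have md : measurable_field (v - w) by move=> i; exact: measurable_funB.
have [wy|] := boolP (l2norm w < +oo)%E; last first.
  rewrite -leNgt leye_eq => /eqP ->.
  by rewrite addye ?leey// gt_eqF// (lt_le_trans (ltNyr 0))// l2norm_ge0.
have [dy|] := boolP (l2norm (v - w)%R < +oo)%E; last first.
  rewrite -leNgt leye_eq => /eqP ->.
  by rewrite addey ?leey// gt_eqF// (lt_le_trans (ltNyr 0))// l2norm_ge0.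
have Lw := l2norm_lty mw wy; have Ld := l2norm_lty md dy.
have E : v = w + (v - w) by rewrite addrC subrK.
have Lv : inL2 v by rewrite E; exact: inL2D.
by rewrite !l2norm_fin// -EFinD lee_fin {1}E vnrmD_le.
Qed.

Lemma integral_l2norm_triangle (f g : R -> torus_field R 'I_3) : inL1L2 f -> inL1L2 g ->
  inL1L2 (fun s => f s - g s) ->
  fine (\int[leb]_(s in D) l2norm (f s))%E <=
  fine (\int[leb]_(s in D) l2norm (g s))%E + fine (\int[leb]_(s in D) l2norm (f s - g s)%R)%E.
Proof.
move=> fL gL dL; have mD := @measurable_unit_itv R.
have fin h (hL : inL1L2 h) := @integral_l2norm_fin R h D hL mD (@subset_refl _ _).
have [F1 F2 F3] := And3 (fin _ fL) (fin _ gL) (fin _ dL).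
rewrite -fineD//; apply: (fine_le F1); first by rewrite fin_numD F2 F3.
rewrite -ge0_integralD//; try by move=> *; exact: l2norm_ge0.
- apply: ge0_le_integral => //.
  + by move=> *; exact: l2norm_ge0.
  + exact: measurable_l2norm fL.1.
  + by apply: emeasurable_funD; [exact: measurable_l2norm gL.1|exact: measurable_l2norm dL.1].
  + move=> s Ds; apply: l2norm_triangle.
      exact: spacetime_measurable_field fL.1 Ds.
    exact: spacetime_measurable_field gL.1 Ds.
- exact: measurable_l2norm gL.1.
- exact: measurable_l2norm dL.1.
Qed.

(** What an anomaly provides: dissipation above a threshold for arbitrarily small
    viscosities. *)
Lemma limf_esup_gt0 (F : set_system R) (g : R -> \bar R) : (0 < limf_esup g F)%E ->
  exists2 kappa : R, 0 < kappa & forall V, F V -> exists2 x, V x & (kappa%:E < g x)%E.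
Proof.
move=> h; have [k k0 hk] : exists2 k : R, 0 < k & (k%:E < limf_esup g F)%E.
  case: (limf_esup g F) h => [x| |]//.
  - by rewrite lte_fin => x0; exists (x / 2); rewrite ?lte_fin; lra.
  - by move=> _; exists 1; rewrite ?ltry.
exists k => // V FV.
have : (k%:E < ereal_sup (g @` V))%E.
  by apply: lt_le_trans hk _; apply: ereal_inf_lbound; exists V.
by move=> /ereal_sup_gt[_ [x Vx <-] kx]; exists x.
Qed.

Lemma uniform_cvg_near (T : Type) (F : set_system T) {FF : Filter F} (A : set R)
    (h : T -> R -> R) (g : R -> R) (e : R) :
  {uniform A, h @ F --> g} -> 0 < e ->
  \forall x \near F, forall s, A s -> `|h x s - g s| <= e.
Proof.
move=> hg e0.
have : nbhs (g : {uniform` A -> R}) [set k | forall s, A s -> `|k s - g s| <= e].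
  apply/uniform_nbhs; exists [set xy : R * R | ball xy.1 e xy.2]; split.
    by apply: entourage_ball (PosNum e0).
  by move=> k hk s As; have := hk s As; rewrite /ball/= distrC => /ltW.
exact: hg.
Qed.

Lemma powR_lp_lambda (alpha : R) m :
  lp_lambda R m `^ (- alpha) = (2 `^ (- alpha)) ^+ m.
Proof.
rewrite /lp_lambda -(powR_mulrn m) ?ler0n// -powRrM mulrC powRrM powR_mulrn//.
Qed.

Lemma powR2_lt_half (alpha : R) : 1 < alpha -> 0 < 2 `^ (- alpha) < (2^-1 : R).
Proof.
move=> a1; rewrite powR_gt0//= powRN ltf_pV2 ?posrE ?powR_gt0// -[X in X < _]powRr1//.
by rewrite /powR gt_eqF// ltr_expR ltr_pM2r// ln_gt0// ltr1n.
Qed.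

End passing_to_sequences.

Theorem theorem2p6 (R : realType)
    (rho : R -> R) (rho_cutoff : lp_cutoff rho)
    (N : set R) (N_pos : forall nu, N nu -> 0 < nu) (N_to_0 : closure N 0)
    (f_ u_ : R -> R -> torus_field R 'I_3) (f u : R -> torus_field R 'I_3)
    (u_weak_solution : forall nu, N nu -> weak_solution nu (f_ nu) (u_ nu))
    (u_energy : forall nu, N nu -> energy_equality nu (f_ nu) (u_ nu))
    (f_L1L2 : forall nu, N nu -> inL1L2 (f_ nu))
    (flim_L1L2 : inL1L2 f)
    (f_cvg : (fun nu => \int[@lebesgue_measure R]_(t in unit_itv R)
                l2norm (f_ nu t - f t)%R)%E @ within N (nbhs 0) --> 0%E)
    (u_LooL2 : inLooL2 u)
    (u_CwL2 : inCwL2 u)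
    (u_cvg : forall phi : torus_field R 'I_3, inL2 phi ->
       {uniform unit_itv R, (fun nu t => inner (u_ nu t) phi) @ within N (nbhs 0)
          --> (fun t => inner (u t) phi)})
    (u0_cvg : (fun nu => l2norm (u_ nu 0 - u 0)) @ within N (nbhs 0) --> 0%E)
    (anomaly : (0 < limf_esup
       (fun nu : R => nu%:E * \int[@lebesgue_measure R]_(t in unit_itv R)
                    l2norm (grad (u_ nu t)) ^+ 2)
       (within N (nbhs 0%R)))%E)
    (c alpha : R) (c_pos : 0 < c) (alpha_gt1 : 1 < alpha)
    (localization : forall nu, N nu -> forall t, unit_itv R t ->
       exists qt : nat, forall q : nat,
         (l2norm (lp_block rho q (u_ nu t)) <=
            (c * lp_lambda R (`|q - qt|)%N `^ (- alpha))%:E)%E) :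
  exists2 t, unit_itv R t &
    ~ ((fun s => l2norm (u s - u t)) @ within (unit_itv R) (nbhs t) --> 0%E).
Proof.
apply: contrapT => noD.
set D := unit_itv R.
have DE s : D s = (0 <= s <= 1) :> Prop by rewrite /D /unit_itv/= in_itv.
have D0 : D 0 by rewrite DE; lra.
have u_strong t : D t -> (fun s => l2norm (u s - u t)) @ within D (nbhs t) --> 0%E.
  by move=> Dt; apply: contrapT => h; apply: noD; exists t.
have [mu Lu _] := u_CwL2.
pose F := within N (nbhs (0 : R)).
have FF : Filter F by exact: within_filter.
have [kappa kappa0 hkappa] := limf_esup_gt0 anomaly.
pose X nu := (\int[@lebesgue_measure R]_(t in unit_itv R) l2norm (f_ nu t - f t)%R)%E.
pose Y nu := l2norm (u_ nu 0 - u 0).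
have good : \forall nu \near F, [/\ X nu \is a fin_num, fine (X nu) <= 1,
    Y nu \is a fin_num & fine (Y nu) <= 1].
  have X0 : fine (X nu) @[nu --> F] --> (0 : R) by exact: (fine_cvg f_cvg).
  have Y0 : fine (Y nu) @[nu --> F] --> (0 : R) by exact: (fine_cvg u0_cvg).
  have Xf := cvg_is_fine f_cvg; have Yf := cvg_is_fine u0_cvg.
  move: X0 Y0 => /cvgr0_norm_le/(_ _ (@ltr01 R)) X1 /cvgr0_norm_le/(_ _ (@ltr01 R)) Y1.
  near=> nu; split.
  - by near: nu.
  - by apply: le_trans (ler_norm _) _; near: nu.
  - by near: nu.
  - by apply: le_trans (ler_norm _) _; near: nu.
have /choice[nu_ hnu] : forall n, exists nu, [/\ N nu, `|nu| < n.+1%:R^-1,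
    [/\ X nu \is a fin_num, fine (X nu) <= 1, Y nu \is a fin_num & fine (Y nu) <= 1] &
    (kappa%:E < nu%:E * \int[@lebesgue_measure R]_(t in unit_itv R)
      l2norm (grad (u_ nu t)) ^+ 2)%E].
  move=> n.
  have small : \forall nu \near F, `|nu| < n.+1%:R^-1.
    have n0 : 0 < n.+1%:R^-1 :> R by rewrite invr_gt0.
    by rewrite near_withinE; apply: filterS (nbhs0_lt n0) => x h _.
  have inN : \forall nu \near F, N nu by rewrite near_withinE; exact: nearW.
  have [nu [Nnu [snu gnu]] knu] := hkappa _ (filterI inN (filterI small good)).
  by exists nu.
have NN n : N (nu_ n) by have [] := hnu n.
have nu_0 : nu_ n @[n --> \oo] --> (0 : R).
  apply: norm_cvg0; apply: (@squeeze_cvgr _ _ _ _ (cst 0) (@harmonic R)).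
  - by near=> n; rewrite normr_ge0 /harmonic/= ltW//; have [] := hnu n.
  - exact: cvg_cst.
  - exact: cvg_harmonic.
have nuF : nu_ n @[n --> \oo] --> F.
  move=> P; rewrite /F /within/= => /nu_0 FP.
  have h : \forall n \near \oo, N (nu_ n) -> P (nu_ n) by exact: FP.
  by apply: filterS h => n; apply.
have ws n := u_weak_solution _ (NN n).
have en n := u_energy _ (NN n).
have fL n := f_L1L2 _ (NN n).
have Lu_ n s : D s -> inL2 (u_ (nu_ n) s) by have [[_ h _] _ _ _] := ws n; exact: h.
pose r : R := 2 `^ (- alpha).
have /andP[r0 r2] : 0 < r < 2^-1 by exact: powR2_lt_half.
pose M := fine (\int[@lebesgue_measure R]_(s in unit_itv R) l2norm (f s))%E.
have u_B n s : D s -> vnrm (u_ (nu_ n) s) <= vnrm (u 0) + 1 + 2 * (M + 1).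
  move=> Ds; have [_ _ [Xf X1 Yf Y1] _] := hnu n.
  have [uC _ _ _] := ws n.
  apply: le_trans (energy_bound (ltW (N_pos _ (NN n))) (fL n) uC (en n) Ds) _.
  apply: lerD.
    have := vnrmD_le (inL2B (Lu_ n _ D0) (Lu _ D0)) (Lu _ D0).
    rewrite subrK => /le_trans; apply.
    move: Y1; rewrite /Y l2norm_fin/=; last exact: inL2B (Lu_ n _ D0) (Lu _ D0).
    by lra.
  rewrite ler_pM2l//.
  have dL : inL1L2 (fun s => f_ (nu_ n) s - f s).
    split; first exact: spacetime_measurableB (fL n).1 flim_L1L2.1.
    by move: Xf; rewrite ge0_fin_numE// integral_ge0// => ? _; exact: l2norm_ge0.
  by apply: le_trans (integral_l2norm_triangle (fL n) flim_L1L2 dL) _; rewrite lerD2l.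
have loc n s : D s -> exists k : nat, forall i q,
    nrm (torus_measure R) (block rho (u_ (nu_ n) s i) q) <= c * r ^+ `|q - k|%N.
  move=> Ds; have [k hk] := localization _ (NN n) s Ds; exists k => i q.
  have Lb : inL2 (lp_block rho q (u_ (nu_ n) s)).
    by move=> j; exact: (L2_block rho_cutoff).
  have := hk q; rewrite l2norm_fin// lee_fin powR_lp_lambda -/r.
  exact: le_trans (nrm_le_vnrm i Lb).
have u_cont t : D t -> forall e, 0 < e -> exists2 d, 0 < d &
    forall s, D s -> `|s - t| < d -> `|vnrm (u s) - vnrm (u t)| <= e.
  move=> Dt e e0.
  have : fine (l2norm (u s - u t)) @[s --> within D (nbhs t)] --> (0 : R).
    exact: fine_cvg (u_strong t Dt).
  move=> /cvgr0_norm_le/(_ _ e0); rewrite near_withinE => /nbhs_ballP[d /= d0 hd].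
  exists d => // s Ds sd.
  apply: le_trans (vnrm_dist_le (Lu _ Ds) (Lu _ Dt)) _.
  have := hd s _ Ds; rewrite /ball/= distrC => /(_ sd).
  by rewrite l2norm_fin/= ?ger0_norm ?vnrm_ge0//; exact: inL2B (Lu _ Ds) (Lu _ Dt).
have u0c : vnrm (u_ (nu_ n) 0 - u 0) @[n --> \oo] --> (0 : R).
  have <- : fine \o (Y \o nu_) = fun n => vnrm (u_ (nu_ n) 0 - u 0).
    by apply/funext => n; rewrite /Y /= l2norm_fin//; exact: inL2B (Lu_ n _ D0) (Lu _ D0).
  exact: fine_cvg (cvg_comp _ _ nuF u0_cvg).
have fc : (\int[@lebesgue_measure R]_(s in unit_itv R)
    l2norm (f_ (nu_ n) s - f s)%R)%E @[n --> \oo] --> 0%E.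
  exact: (cvg_comp _ _ nuF f_cvg).
have uc phi : inL2 phi -> forall e, 0 < e -> \forall n \near \oo, forall s, D s ->
    `|inner (u_ (nu_ n) s) phi - inner (u s) phi| <= e.
  move=> Lphi e e0.
  exact: (nuF _ (uniform_cvg_near (u_cvg phi Lphi) e0)).
have := dissipation_vanishes rho_cutoff (fun n => N_pos _ (NN n)) nu_0 ws en fL flim_L1L2
  fc u_CwL2 uc u0c u_B (ltW c_pos) r0 r2 loc u_cont kappa0.
move=> [n _ /(_ n (leqnn n))]/=.
have [_ _ _] := hnu n.
have mD1 : measurable (`]0, 1]%classic : set (measurableTypeR R)) by exact: measurable_itv.
have -> : (\int[@lebesgue_measure R]_(t in unit_itv R) l2norm (grad (u_ (nu_ n) t)) ^+ 2 =
    (dissipation (u_ (nu_ n)) 0 1)%:E)%E.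
  rewrite -(dissipationE (ws n) (lexx 0) (lexx 1)) -integral_itv_obnd_cbnd//.
  exact: measurable_int (integrable_grad (ws n) mD1 (sub_itv_unit (lexx 0) (lexx 1))).
by rewrite -EFinM lte_fin ltNge => /negP h /h.
Unshelve. all: by end_near. Qed.
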